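(* Let $n\ge1$ and let $K$ be either the Poisson kernel or the heat kernel on $\mathbb{R}^n$. For any non-negative measurable function $f$ on $(0,\infty)$ and any numbers $\delta,\tilde\delta,p$ with $1<\tilde\delta<\delta$ and $1<p\le\infty$, we have $$\mathbf{D}_{p,K}(x;\tilde\delta,f,n)\le \mathbf{D}_p(x;\delta,f)\qquad\text{for all }x\in\Omega_{p,\tilde\delta}.$$
   Context: For $y\in\mathbb{R}^n$, $t>0$: $P_t(y)=\frac{\Gamma(\frac{n+1}2)}{\pi^{(n+1)/2}}\frac{t}{(t^2+|y|^2)^{(n+1)/2}}$, $H_t(y)=(4\pi t)^{-n/2}e^{-|y|^2/(4t)}$; $K_t$ is either one. For $g$ on $\mathbb{R}^n$ and $z=(y,t)\in\mathbb{R}^n\times(0,\infty)$, $g(z):=(K_t*g)(y)$; e.g. $w^{-1/(p-1)}(z)$, $\log w(z)$, $(f\circ w)(z)$ are $K$-extensions of $w^{-1/(p-1)}$, $\log w$, $f\circ w$. A weight is an a.e. positive locally integrable function. For a finite interval $I$ and a weight $v$ on $I$: $\langle v\rangle_J=\frac1{|J|}\int_Jv$; for $1<p<\infty$, $[v]_{p,I}=\sup_{J\subset I}\langle v\rangle_J\langle v^{-1/(p-1)}\rangle_J^{p-1}$, and $[v]_{\infty,I}=\sup_{J\subset I}\langle v\rangle_Je^{-\langle\log v\rangle_J}$ (sup over subintervals $J$). For a weight $w$ on $\mathbb{R}^n$: $[w]^K_p=\sup_{z}w(z)[w^{-1/(p-1)}(z)]^{p-1}$ ($1<p<\infty$), $[w]^K_\infty=\sup_z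 w(z)e^{-\log w(z)}$, sup over $z\in\mathbb{R}^{n+1}_+$. Domains: for $1<p<\infty$, $\Omega_{p,\delta}=\{x\in\mathbb{R}^2: x_1>0,x_2>0,1\le x_1x_2^{p-1}\le\delta\}$; $\Omega_{\infty,\delta}=\{x\in\mathbb{R}^2: x_1>0, 1\le x_1e^{-x_2}\le\delta\}$. Bellman functions (independent of $I$, resp. $z$): for $1<p<\infty$, $\mathbf{D}_p(x;\delta,f)=\sup\{\langle f\circ v\rangle_I: [v]_{p,I}\le\delta,\ \langle v\rangle_I=x_1,\ \langle v^{-1/(p-1)}\rangle_I=x_2\}$ and $\mathbf{D}_{p,K}(x;\delta,f,n)=\sup\{(f\circ w)(z): [w]^K_p\le\delta,\ w(z)=x_1,\ w^{-1/(p-1)}(z)=x_2\}$; for $p=\infty$, $\mathbf{D}_\infty(x;\delta,f)=\sup\{\langle f\circ v\rangle_I:[v]_{\infty,I}\le\delta,\ \langle v\rangle_I=x_1,\ \langle\log v\rangle_I=x_2\}$ and $\mathbf{D}_{\infty,K}(x;\delta,f,n)=\sup\{(f\circ w)(z):[w]^K_\infty\le\delta,\ w(z)=x_1,\ \log w(z)=x_2\}$. *)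

(* Defs.v *)
From HB Require Import structures.
From mathcomp Require Import all_boot all_order all_algebra.
From mathcomp Require Import all_classical all_reals all_analysis.
Set Implicit Arguments. Unset Strict Implicit. Unset Printing Implicit Defensive.
Import Order.TTheory GRing.Theory Num.Theory.
Import numFieldNormedType.Exports.
Local Open Scope classical_set_scope.
Local Open Scope ring_scope.

(* ---------- R^n, represented as n.-tuple R (product = Borel sigma-algebra) *)

Definition sqnorm (R : realType) (n : nat) (v : n.-tuple R) : R :=
  \sum_(i < n) tnth v i ^+ 2.

Definition tsub (R : realType) (n : nat) (y u : n.-tuple R) : n.-tuple R :=
  [tuple tnth y i - tnth u i | i < n].

(* Lebesgue integral over R^n of a function with values in \bar R, computed
   as the iterated integral over the coordinates (for non-negative measurable
   integrands this is the integral w.r.t. n-dimensional Lebesgue measure, by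
   Tonelli's theorem; we only ever apply it to non-negative integrands). *)
Fixpoint intRn (R : realType) (n : nat) : (n.-tuple R -> \bar R) -> \bar R :=
  match n return (n.-tuple R -> \bar R) -> \bar R with
  | 0 => fun g => g [tuple]
  | m.+1 => fun g =>
      (\int[@lebesgue_measure R]_(x in [set: R]) intRn (fun v => g (cons_tuple x v)))%E
  end.

Definition lebn (R : realType) (n : nat) (A : set (n.-tuple R)) : \bar R :=
  intRn (fun u => ((u \in A)%:R : R)%:E).

Definition weightRn (R : realType) (n : nat) (w : n.-tuple R -> R) : Prop :=
  [/\ measurable_fun [set: n.-tuple R] w,
      lebn [set u | w u <= 0] = 0%E &
      forall k : nat,
        (intRn (fun u => (((u \in [set u : n.-tuple R | forall i, `|tnth u i| <= k%:R])%:R : R)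
                          * `|w u|)%:E) < +oo)%E].

Definition Gamma (R : realType) (a : R) : R :=
  fine (\int[@lebesgue_measure R]_(s in `]0%R, +oo[) ((s `^ (a - 1)) * expR (- s))%:E)%E.

Inductive kernel_kind := Poisson | Heat.

Definition kernel (R : realType) (K : kernel_kind) (n : nat) (t : R)
    (y : n.-tuple R) : R :=
  match K with
  | Poisson => Gamma ((n.+1)%:R / 2) / (pi `^ ((n.+1)%:R / 2))
               * (t / ((t ^+ 2 + sqnorm y) `^ ((n.+1)%:R / 2)))
  | Heat => (4 * pi * t) `^ (- (n%:R / 2)) * expR (- sqnorm y / (4 * t))
  end.

Definition ext (R : realType) (K : kernel_kind) (n : nat) (g : n.-tuple R -> R)
    (y : n.-tuple R) (t : R) : \bar R :=
  (intRn (fun u => (kernel K t (tsub y u) * Num.max (g u) 0)%:E)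
   - intRn (fun u => (kernel K t (tsub y u) * Num.max (- g u) 0)%:E))%E.

Definition ext_defined (R : realType) (K : kernel_kind) (n : nat)
    (g : n.-tuple R -> R) : Prop :=
  forall (y : n.-tuple R) (t : R), 0 < t ->
    (intRn (fun u => (kernel K t (tsub y u) * `|g u|)%:E) < +oo)%E.

(* f o w, defined to be 0 on the (null) set where w <= 0 *)
Definition fcomp (R : realType) (T : Type) (f : R -> R) (w : T -> R) : T -> R :=
  fun u => if 0 < w u then f (w u) else 0.

Definition dualw (R : realType) (T : Type) (p : R) (w : T -> R) : T -> R :=
  fun u => w u `^ (- (p - 1)^-1).

(* a * b^(p-1) for a, b in [0, +oo] (+oo if either is infinite;
   this is only used when b > 0) *)
Definition Aprod (R : realType) (p : R) (a b : \bar R) : \bar R :=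
  if (a \is a fin_num) && (b \is a fin_num) then (fine a * (fine b) `^ (p - 1))%:E
  else +oo%E.

Definition ApK (R : realType) (K : kernel_kind) (n : nat) (p : R)
    (w : n.-tuple R -> R) : \bar R :=
  ereal_sup [set Aprod p (ext K w z.1 z.2) (ext K (dualw p w) z.1 z.2)
            | z in [set z : n.-tuple R * R | 0 < z.2]].

Definition AinfK (R : realType) (K : kernel_kind) (n : nat)
    (w : n.-tuple R -> R) : \bar R :=
  ereal_sup [set (ext K w z.1 z.2 * (expR (- fine (ext K (fun u => ln (w u)) z.1 z.2)))%:E)%E
            | z in [set z : n.-tuple R * R | 0 < z.2]].

Definition DpK (R : realType) (K : kernel_kind) (n : nat) (p delta : R)
    (f : R -> R) (x : R * R) : \bar R :=
  ereal_sup [set ext K (fcomp f wz.1) wz.2.1 wz.2.2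
            | wz in [set wz : (n.-tuple R -> R) * (n.-tuple R * R) |
                      [/\ weightRn wz.1, 0 < wz.2.2,
                          (ApK K p wz.1 <= delta%:E)%E,
                          ext K wz.1 wz.2.1 wz.2.2 = x.1%:E &
                          ext K (dualw p wz.1) wz.2.1 wz.2.2 = x.2%:E]]].

Definition DinfK (R : realType) (K : kernel_kind) (n : nat) (delta : R)
    (f : R -> R) (x : R * R) : \bar R :=
  ereal_sup [set ext K (fcomp f wz.1) wz.2.1 wz.2.2
            | wz in [set wz : (n.-tuple R -> R) * (n.-tuple R * R) |
                      [/\ weightRn wz.1 /\ ext_defined K (fun u => ln (wz.1 u)), 0 < wz.2.2,
                          (AinfK K wz.1 <= delta%:E)%E,
                          ext K wz.1 wz.2.1 wz.2.2 = x.1%:E &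
                          ext K (fun u => ln (wz.1 u)) wz.2.1 wz.2.2 = x.2%:E]]].

Definition avg (R : realType) (c d : R) (g : R -> R) : \bar R :=
  ((d - c)^-1)%:E * (\int[@lebesgue_measure R]_(s in `[c, d]) (g s)%:E)%E.

Definition weightI (R : realType) (a b : R) (v : R -> R) : Prop :=
  [/\ measurable_fun `[a, b] v,
      @lebesgue_measure R ([set s | s \in `[a, b] /\ v s <= 0]) = 0%E &
      (@lebesgue_measure R).-integrable `[a, b] (EFin \o v)].

Definition subitv (R : realType) (a b : R) : set (R * R) :=
  [set cd | a <= cd.1 /\ cd.1 < cd.2 /\ cd.2 <= b].

Definition ApI (R : realType) (p a b : R) (v : R -> R) : \bar R :=
  ereal_sup [set Aprod p (avg J.1 J.2 v) (avg J.1 J.2 (dualw p v)) | J in subitv a b].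

Definition AinfI (R : realType) (a b : R) (v : R -> R) : \bar R :=
  ereal_sup [set (avg J.1 J.2 v * (expR (- fine (avg J.1 J.2 (fun s => ln (v s)))))%:E)%E
            | J in subitv a b].

Definition Dp (R : realType) (p delta : R) (f : R -> R) (x : R * R) : \bar R :=
  ereal_sup [set avg vI.2.1 vI.2.2 (fcomp f vI.1)
            | vI in [set vI : (R -> R) * (R * R) |
                      [/\ vI.2.1 < vI.2.2, weightI vI.2.1 vI.2.2 vI.1,
                          (ApI p vI.2.1 vI.2.2 vI.1 <= delta%:E)%E,
                          avg vI.2.1 vI.2.2 vI.1 = x.1%:E &
                          avg vI.2.1 vI.2.2 (dualw p vI.1) = x.2%:E]]].

Definition Dinf (R : realType) (delta : R) (f : R -> R) (x : R * R) : \bar R :=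
  ereal_sup [set avg vI.2.1 vI.2.2 (fcomp f vI.1)
            | vI in [set vI : (R -> R) * (R * R) |
                      [/\ vI.2.1 < vI.2.2, weightI vI.2.1 vI.2.2 vI.1 /\
                          (@lebesgue_measure R).-integrable `[vI.2.1, vI.2.2]
                             (EFin \o (fun s => ln (vI.1 s))),
                          (AinfI vI.2.1 vI.2.2 vI.1 <= delta%:E)%E,
                          avg vI.2.1 vI.2.2 vI.1 = x.1%:E &
                          avg vI.2.1 vI.2.2 (fun s => ln (vI.1 s)) = x.2%:E]]].

Definition Dbell (R : realType) (p : \bar R) (delta : R) (f : R -> R) (x : R * R) : \bar R :=
  match p with
  | EFin q => Dp q delta f x
  | _ => Dinf delta f x
  end.

Definition DbellK (R : realType) (K : kernel_kind) (n : nat) (p : \bar R) (delta : R)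
    (f : R -> R) (x : R * R) : \bar R :=
  match p with
  | EFin q => DpK K n q delta f x
  | _ => DinfK K n delta f x
  end.

Definition Omega (R : realType) (p : \bar R) (delta : R) : set (R * R) :=
  match p with
  | EFin q => [set x | 0 < x.1 /\ 0 < x.2 /\ 1 <= x.1 * x.2 `^ (q - 1) <= delta]
  | _ => [set x | 0 < x.1 /\ 1 <= x.1 * expR (- x.2) <= delta]
  end.

(* Main.v *)
Require Import Defs.
From HB Require Import structures.
From mathcomp Require Import all_boot all_order all_algebra.
From mathcomp Require Import all_classical all_reals all_analysis.
From mathcomp Require Import measurable_realfun measurable_fun_approximation.
From mathcomp Require Import ring lra.
Import Order.TTheory GRing.Theory Num.Theory.
Import numFieldNormedType.Exports HBNNSimple.
Set Implicit Arguments. Unset Strict Implicit. Unset Printing Implicit Defensive.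
Local Open Scope classical_set_scope.
Local Open Scope ring_scope.

(** The two cases have one form. For finite p put [phi r = r^(-(p-1))] and [rho = w^(-1/(p-1))], on
    the half-line; for p = oo put [phi = exp] and [rho = log w], on the whole line. Then [phi] is
    convex, [phi o rho = w] almost everywhere, and the hypothesis on w reads
    [E_z (phi o rho) <= delta phi(E_z rho)] for every z = (y,t), where E_z is the average against
    the probability density K_t(y - u) du. Fix z0 and let v be the nondecreasing rearrangement of
    rho for the density at z0, a function on [0,1]. Since v and rho have the same law, [phi o v] has
    on [0,1] the same averages (of itself, of v, of f composed with it) as w has at z0. So it is
    enough that [<phi o v>_J <= delta phi(<v>_J)] for every J = [c,d] in [0,1]: then [phi o v]
    competes in the interval problem with the value that w has ([rearrangement_bellman],
    [bellman_transfer]).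

    To see this for J, set a = v(c), b = v(d) and clip rho to [a,b]. Clipping preserves the
    hypothesis at every z with the same delta ([clip_powR], [clip_expR]), and at z0 the pair (E rho,
    E (phi o rho)) of the clipped function is c (a, phi a) + (d - c) (x2, x1) + (1 - d) (b, phi b),
    with x2 = <v>_J and x1 = <phi o v>_J. Suppose x1 > delta phi(x2); up to the reflection r -> -r
    one may assume E rho >= x2 at z0. Take the line through (b, phi b) and (x2, y) with delta
    phi(x2) < y < x1, and let psi be phi o rho minus that line at rho. By convexity psi <= 0 where
    rho >= x2. By hypothesis E psi < 0 where E rho is at least x2 and close to x2. Yet the
    three-point mean gives E psi > 0 at z0 ([bellman_point]). Now cut the positive part of E psi off
    to 0 outside the region E rho >= x2. It vanishes near the edge of that region, so it is a
    subsolution of the equation that K solves, and its boundary values are 0; by the maximum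
    principle it vanishes, a contradiction ([one_sided]).

    The analysis rests on a finite-difference mean value property with domination, collected in
    [good_kernel] and proved for both kernels. It gives a maximum principle on strips
    ([maximum_principle]), then comparison with the extension of the boundary values ([sub_le]),
    then the semigroup law. Boundary values are attained in the mean: E |E_e g - g| tends to 0 for
    every bounded measurable g ([approximable_bmeas]), which takes the place of almost everywhere
    boundary limits. *)

(** * Lebesgue measure behind the iterated integral *)

(** Induction on n: the measure on longer tuples is the image of the product of Lebesgue measure and
    [mu] under [cons_tuple], and Tonelli turns its integral into the iterated one. *)
Lemma lebT_ex (R : realType) (n : nat) :
  exists mu : {sigma_finite_measure set (n.-tuple R) -> \bar R},
    forall g : n.-tuple R -> \bar R, measurable_fun [set: n.-tuple R] g ->
      (forall u, 0 <= g u)%E -> intRn g = (\int[mu]_u g u)%E.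
Proof.
elim: n => [|n [mu muE]].
  exists (\d_ ([tuple] : 0.-tuple R)) => g mg g0 /=.
  by rewrite integral_dirac// diracT mul1e.
pose cn (xv : measurableTypeR R * n.-tuple R) : n.+1.-tuple R :=
  cons_tuple xv.1 xv.2.
have mcn : measurable_fun setT cn.
  exact: (@measurable_cons _ _ (measurableTypeR R * n.-tuple R)%type R fst n snd).
pose nu0 : {measure set (n.+1.-tuple R) -> \bar R} :=
  pushforward (@lebesgue_measure R \x mu)%E cn.
pose nu := nu0 mcn.
pose inv (u : n.+1.-tuple R) : measurableTypeR R * n.-tuple R :=
  (thead u, [tuple of behead u]).
have minv : measurable_fun setT inv.
  apply: measurable_fun_pair; first exact: measurable_tnth.
  exact: measurable_behead.
have cnK : cancel cn inv.
  by move=> [x v]; rewrite /inv /cn/= theadE; congr pair; exact/val_inj.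
(* Rectangles of exhausting sets of finite measure, pulled back by the inverse of [cn]. *)
have sf : sigma_finite setT nu.
  have /sigma_finiteP[F [FT ndF Foo]] := sigma_finiteT (@lebesgue_measure R).
  have /sigma_finiteP[G [GT ndG Goo]] := sigma_finiteT mu.
  exists (fun k => inv @^-1` (F k `*` G k)).
    rewrite -preimage_bigcup (_ : \bigcup_i _ = setT) ?preimage_setT//.
    apply/seteqP; split => // -[x v] _.
    have [i _ Fx] : (\bigcup_i F i) x by rewrite -FT.
    have [j _ Gv] : (\bigcup_i G i) v by rewrite -GT.
    exists (maxn i j) => //; split => /=.
      by move: (x) Fx; exact/subsetPset/ndF/leq_maxl.
    by move: (v) Gv; exact/subsetPset/ndG/leq_maxr.
  move=> k; have [mF oF] := Foo k; have [mG oG] := Goo k; split.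
    by rewrite -[X in measurable X]setTI; apply: minv => //; exact: measurableX.
  rewrite /nu /nu0 /= /pushforward (_ : cn @^-1` _ = F k `*` G k); last first.
    by rewrite -comp_preimage (_ : inv \o cn = id) ?preimage_id//; exact/funext/cnK.
  by rewrite product_measure1E// lte_mul_pinfty// ge0_fin_numE.
pose Hs := Measure_isSigmaFinite.Build _ _ _ nu sf.
pose nu' : {sigma_finite_measure set (n.+1.-tuple R) -> \bar R} :=
  HB.pack (Measure.sort nu) Hs.
exists nu' => g mg g0 /=.
rewrite [RHS](_ : _ = \int[nu]_u g u)%E//.
rewrite ge0_integral_pushforward//= preimage_setT.
have mgc : measurable_fun setT (g \o cn) by exact: measurableT_comp mg mcn.
rewrite (@fubini_tonelli1 _ _ _ _ _ _ _ (g \o cn) mgc) => [|x]; last exact: g0.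
apply: eq_integral => x _; rewrite muE//.
exact: (measurableT_comp mgc (measurable_pair1 x)).
Qed.
Lemma measurable_fun_sumr d (T : measurableType d) (R : realType) (D : set T)
    (I : Type) (s : seq I) (h : I -> T -> R) :
  (forall i, measurable_fun D (h i)) -> measurable_fun D (fun x => \sum_(i <- s) h i x).
Proof.
move=> mh; elim: s => [|i s ih]; first by under eq_fun do rewrite big_nil; exact: measurable_cst.
by under eq_fun do rewrite big_cons; apply: measurable_funD.
Qed.

Lemma Rintegral_sum d (T : measurableType d) (R : realType)
    (mu : {measure set T -> \bar R}) (D : set T) (I : Type) (s : seq I)
    (h : I -> T -> R) : measurable D ->
  (forall i, mu.-integrable D (EFin \o h i)) ->
  \int[mu]_(x in D) (\sum_(i <- s) h i x) = \sum_(i <- s) \int[mu]_(x in D) h i x.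
Proof.
move=> mD ih; elim: s => [|i s IH].
  by under eq_Rintegral do rewrite big_nil; rewrite big_nil Rintegral_cst// mul0r.
under eq_Rintegral do rewrite big_cons.
rewrite big_cons RintegralD// ?IH//.
have := @integrable_sum _ _ _ mu D mD _ s xpredT _ (fun j _ => ih j).
apply: eq_integrable => // x _.
by rewrite /= sumEFin.
Qed.

(** * Averages against an abstract kernel *)

Section averages.
Context (R : realType) (n : nat).
Local Notation T := (n.-tuple R).

Definition near_pt (r : R) (y u : T) := forall i, `|tnth y i - tnth u i| < r.

Definition bmeas (M : R) (g : T -> R) :=
  measurable_fun [set: T] g /\ forall u, `|g u| <= M.

Variable mu : {sigma_finite_measure set T -> \bar R}.

(** What the comparison argument asks of a kernel. Errors are dominated by the kernel itself at
    another time and the same centre, so that integrating them against g with |g| <= M costs only a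
    factor M. [yj] and [dj] are the moves of a finite-difference stencil of step h. [gk_mvp] says
    that the stencil annihilates the kernel up to order h^3, which encodes the Laplace or heat
    equation; [gk_dj_le0] makes t a supersolution and [gk_barrier] makes t (3 T0 - t) a strict one,
    by order h^2. *)
Record good_kernel (k : T -> R -> T -> R) (J : finType)
    (yj : T -> R -> J -> T) (dj : R -> J -> R) : Prop := GoodKernel {
  gk_ge0 : forall y t u, 0 < t -> 0 <= k y t u;
  gk_meas : forall t, 0 < t ->
    measurable_fun [set: (T * T)%type] (fun yu => k yu.1 t yu.2);
  gk_int : forall y t, 0 < t -> (\int[mu]_u (k y t u)%:E = 1)%E;
  gk_mod : forall e T0, 0 < e -> e <= T0 -> exists2 s, 0 < s &
    forall eta, 0 < eta -> exists2 r, 0 < r & forall y y' t t' u,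
      e <= t <= T0 -> `|t' - t| < r -> near_pt r y y' ->
      `|k y' t' u - k y t u| <= eta * k y s u;
  gk_mvp : forall e T0, 0 < e -> e <= T0 -> exists s C r,
    [/\ 0 < s, 0 <= C, 0 < r & forall h y t u, 0 < h < r -> e <= t <= T0 ->
      `|\sum_j (k (yj y h j) (t + dj h j) u - k y t u)| <= C * h ^+ 3 * k y s u];
  gk_tail : forall eta om, 0 < eta -> 0 < om -> exists r s,
    [/\ 0 < r, 0 < s & forall y t u, 0 < t < r -> ~ near_pt eta y u ->
      k y t u <= om * k y s u];
  gk_dom : forall t, 0 < t -> exists2 C, 0 <= C & forall t' y u,
    t <= t' <= 2 * t -> k y t' u <= C * k y (2 * t) u;
  gk_yj : forall h r y j, 0 < h < r -> near_pt r y (yj y h j);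
  gk_dj : forall h j, 0 < h <= 1 -> `|dj h j| <= h;
  gk_dj_le0 : forall h, 0 < h -> \sum_j dj h j <= 0;
  gk_barrier : forall T0, 0 < T0 -> exists2 c, 0 < c & forall h t,
    0 < h <= 1 -> 0 < t <= T0 ->
    \sum_j ((t + dj h j) * (3 * T0 - (t + dj h j)) - t * (3 * T0 - t))
      <= - (c * h ^+ 2)
}.

Variables (k : T -> R -> T -> R) (J : finType).
Variables (yj : T -> R -> J -> T) (dj : R -> J -> R).
Hypothesis gk : good_kernel k yj dj.

Definition kavg (y : T) (t : R) (g : T -> R) : R := \int[mu]_u (k y t u * g u).

Lemma near_pt_refl r y : 0 < r -> near_pt r y y.
Proof. by move=> r0 i; rewrite subrr normr0. Qed.

Lemma near_pt_le r r' y u : r <= r' -> near_pt r y u -> near_pt r' y u.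
Proof. by move=> rr' H i; exact: lt_le_trans (H i) rr'. Qed.

Lemma measurable_gk y t : 0 < t -> measurable_fun [set: T] (k y t).
Proof.
by move=> t0; exact: measurableT_comp (gk_meas gk t0) (measurable_pair1 y).
Qed.

Lemma integrable_gk y t : 0 < t -> mu.-integrable setT (EFin \o k y t).
Proof.
move=> t0; apply/integrableP; split.
  by apply/measurable_EFinP; exact: measurable_gk.
under eq_integral do rewrite /= ger0_norm ?(gk_ge0 gk)//.
by rewrite (gk_int gk)// ltry.
Qed.

Lemma integrable_le_gk c y t (q g : T -> R) M : 0 < t ->
  measurable_fun [set: T] q -> (forall u, `|q u| <= c * k y t u) ->
  bmeas M g -> mu.-integrable setT (EFin \o (fun u => q u * g u)).
Proof.
move=> t0 mq qk [mg gM].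
apply: (@le_integrable _ _ _ mu _ measurableT _ (fun u => (c * M)%:E * (k y t u)%:E)%E).
- exact/measurable_EFinP/measurable_funM.
- move=> u _ /=; rewrite lee_fin normrM.
  apply: le_trans (ler_norm _); rewrite mulrAC.
  by apply: ler_pM => //; exact: le_trans (ler_norm _).
- by apply: integrableZl => //; exact: integrable_gk.
Qed.

Lemma integrable_kavg y t g M : 0 < t -> bmeas M g ->
  mu.-integrable setT (EFin \o (fun u => k y t u * g u)).
Proof.
move=> t0; apply: (@integrable_le_gk 1 y t) => //; first exact: measurable_gk.
by move=> u; rewrite mul1r ger0_norm// (gk_ge0 gk).
Qed.

Lemma le_abs_int_gk c y t (q g : T -> R) M : 0 < t ->
  measurable_fun [set: T] q -> (forall u, `|q u| <= c * k y t u) ->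
  bmeas M g -> `|\int[mu]_u (q u * g u)| <= c * M.
Proof.
move=> t0 mq qk gM.
have iq := integrable_le_gk t0 mq qk gM.
apply: le_trans (le_normr_Rintegral measurableT iq) _.
have -> : c * M = \int[mu]_u (c * M * k y t u).
  rewrite RintegralZl//; last exact: integrable_gk.
  by rewrite /Rintegral (gk_int gk)//= mulr1.
apply: le_Rintegral => //.
- exact: integrable_norm.
- under [X in integrable _ _ X]eq_fun do rewrite /= EFinM.
  by apply: integrableZl => //; exact: integrable_gk.
move=> u _; rewrite normrM mulrAC; apply: ler_pM => //; exact: gM.2.
Qed.

Lemma kavg_bound y t g M : 0 < t -> bmeas M g -> `|kavg y t g| <= M.
Proof.
move=> t0 gM; rewrite -(mul1r M); apply: (@le_abs_int_gk 1 y t) => //.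
  exact: measurable_gk.
by move=> u; rewrite mul1r ger0_norm// (gk_ge0 gk).
Qed.

Lemma kavgD y t f g M N : 0 < t -> bmeas M f -> bmeas N g ->
  kavg y t (fun u => f u + g u) = kavg y t f + kavg y t g.
Proof.
move=> t0 fM gN; rewrite -RintegralD//; [|exact: integrable_kavg fM|exact: integrable_kavg gN].
by apply: eq_Rintegral => u _; rewrite mulrDr.
Qed.

Lemma kavgB y t f g M N : 0 < t -> bmeas M f -> bmeas N g ->
  kavg y t (fun u => f u - g u) = kavg y t f - kavg y t g.
Proof.
move=> t0 fM gN; rewrite -RintegralB//; [|exact: integrable_kavg fM|exact: integrable_kavg gN].
by apply: eq_Rintegral => u _; rewrite mulrBr.
Qed.

Lemma kavgZ y t c g M : 0 < t -> bmeas M g ->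
  kavg y t (fun u => c * g u) = c * kavg y t g.
Proof.
move=> t0 gM; rewrite -RintegralZl//; last exact: integrable_kavg gM.
by apply: eq_Rintegral => u _; rewrite mulrCA.
Qed.

Lemma kavg_cst y t c : 0 < t -> kavg y t (fun=> c) = c.
Proof.
move=> t0; rewrite /kavg; under eq_Rintegral do rewrite mulrC.
rewrite RintegralZl//; last exact: integrable_gk.
by rewrite /Rintegral (gk_int gk)//= mulr1.
Qed.

Lemma le_kavg y t f g M N : 0 < t -> bmeas M f -> bmeas N g ->
  (forall u, f u <= g u) -> kavg y t f <= kavg y t g.
Proof.
move=> t0 fM gN fg; apply: le_Rintegral => //; [exact: integrable_kavg fM|exact: integrable_kavg gN|].
by move=> u _; apply: ler_wpM2l; rewrite ?(gk_ge0 gk).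
Qed.

Lemma kavg_ge0 y t g : 0 < t -> (forall u, 0 <= g u) -> 0 <= kavg y t g.
Proof. by move=> t0 g0; apply: Rintegral_ge0 => u _; rewrite mulr_ge0// (gk_ge0 gk). Qed.

Lemma measurable_kavg t g M : 0 < t -> bmeas M g ->
  bmeas M (fun y => kavg y t g).
Proof.
move=> t0 gM; split=> [|y]; last exact: kavg_bound.
rewrite [X in measurable_fun _ X](_ : _ = fine \o fubini_F mu
  (fun yu : T * T => (k yu.1 t yu.2 * g yu.2)%:E))//.
apply: measurableT_comp; first exact: fine_measurable.
(* For s = 1 and s = -1 these are the positive and negative parts; Tonelli gives measurability of
   each integral. *)
pose q (s : R) (yu : T * T) : \bar R := (k yu.1 t yu.2 * Num.max (s * g yu.2) 0)%:E.
have mq s : measurable_fun setT (q s).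
  apply/measurable_EFinP/measurable_funM; first exact: (gk_meas gk).
  apply: measurable_maxr => //; apply: measurable_funM => //.
  by apply: measurableT_comp => //; exact: gM.1.
have q0 s yu : (0 <= q s yu)%E.
  by rewrite lee_fin mulr_ge0// ?(gk_ge0 gk)// le_max lexx orbT.
rewrite (_ : fubini_F _ _ = (fubini_F mu (q 1%R) \- fubini_F mu (q (-1)%R))%E).
  by apply: emeasurable_funB; exact: measurable_fun_fubini_tonelli_F.
apply/funext => y; rewrite /fubini_F.
have iq s : `|s| <= 1 -> mu.-integrable setT (fun u => q s (y, u)).
  move=> s1; apply: (@integrable_kavg y t _ M) => //; split.
    by apply: measurable_maxr => //; apply: measurable_funM => //; exact: gM.1.
  move=> u; have := gM.2 u => gu.
  have /le_trans/(_ gu) : `|s * g u| <= `|g u|.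
    by rewrite normrM ler_piMl.
  rewrite !ler_norml => /andP[h1 h2]; apply/andP; split.
    by rewrite le_max h1.
  by rewrite ge_max h2; exact: le_trans gu.
rewrite -integralB//; [|by apply: iq; rewrite normr1|by apply: iq; rewrite normrN1].
apply: eq_integral => u _; rewrite /q/= -EFinB -mulrBr mul1r mulN1r; congr (_ * _)%:E.
have [g0|g0] := boolP (0 <= g u).
  by rewrite max_l// max_r ?oppr_le0// subr0.
by rewrite max_r ?max_l ?oppr_ge0 ?sub0r ?opprK// ltW// ltNge.
Qed.

(** The radius is uniform in y and in all g of a given bound; this replaces compactness in the
    unbounded variable y. *)
Lemma kavg_mod e T0 : 0 < e -> e <= T0 ->
  forall eta, 0 < eta -> exists2 r, 0 < r & forall y y' t t' g M,
    e <= t <= T0 -> `|t' - t| < r -> near_pt r y y' -> bmeas M g ->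
    `|kavg y' t' g - kavg y t g| <= eta * M.
Proof.
move=> e0 eT; have [s s0 Hs] := gk_mod gk e0 eT.
move=> eta eta0; have [r r0 Hr] := Hs _ eta0.
exists (Num.min r e); first by rewrite lt_min r0.
move=> y y' t t' g M /andP[et tT]; rewrite lt_min => /andP[tr te] yr gM.
have t0 : 0 < t by exact: lt_le_trans et.
have t'0 : 0 < t' by move: te; rewrite ltr_norml => /andP[]; lra.
rewrite -RintegralB//; [|exact: integrable_kavg gM|exact: integrable_kavg gM].
under eq_Rintegral do rewrite -mulrBl.
apply: (@le_abs_int_gk _ y s) => //.
  by apply: measurable_funB; exact: measurable_gk.
move=> u; apply: Hr => //; first by rewrite et.
by apply: near_pt_le yr; rewrite ge_min lexx.
Qed.

Lemma kavg_mvp e T0 : 0 < e -> e <= T0 -> exists C r,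
  [/\ 0 <= C, 0 < r & forall h y t g M, 0 < h < r -> e <= t <= T0 -> bmeas M g ->
  `|\sum_j (kavg (yj y h j) (t + dj h j) g - kavg y t g)| <= C * h ^+ 3 * M].
Proof.
move=> e0 eT; have [s [C [r [s0 C0 r0 Hr]]]] := gk_mvp gk e0 eT.
(* The bound e / 2 keeps every stencil time [t + dj h j] positive. *)
exists C, (Num.min r (Num.min 1 (e / 2))); split => //.
  by rewrite !lt_min r0 ltr01 divr_gt0.
move=> h y t g M /andP[h0]; rewrite !lt_min => /and3P[hr h1 he] /andP[et tT] gM.
have t0 : 0 < t by exact: lt_le_trans et.
have tj0 j : 0 < t + dj h j.
  have := gk_dj gk j (h := h); rewrite h0 ltW// => /(_ isT).
  by rewrite ler_norml => /andP[]; lra.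
have -> : \sum_j (kavg (yj y h j) (t + dj h j) g - kavg y t g) =
   \int[mu]_u ((\sum_j (k (yj y h j) (t + dj h j) u - k y t u)) * g u).
  under [RHS]eq_Rintegral do rewrite mulr_suml.
  rewrite Rintegral_sum//; last first.
    move=> j; under [X in integrable _ _ X]eq_fun do rewrite /= mulrBl EFinB.
    by apply: integrableB => //; exact: integrable_kavg gM.
  apply: eq_bigr => j _.
  rewrite -RintegralB//; [|exact: integrable_kavg gM|exact: integrable_kavg gM].
  by apply: eq_Rintegral => u _; rewrite mulrBl.
apply: (@le_abs_int_gk _ y s) => //.
  apply: measurable_fun_sumr => j; apply: measurable_funB; exact: measurable_gk.
by move=> u; apply: Hr; rewrite ?h0 ?et.
Qed.

End averages.

(** * Maximum principle on a strip *)

Section maximum_principle.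
Context (R : realType) (n : nat).
Local Notation T := (n.-tuple R).
Variable mu : {sigma_finite_measure set T -> \bar R}.
Variables (k : T -> R -> T -> R) (J : finType).
Variables (yj : T -> R -> J -> T) (dj : R -> J -> R).
Hypothesis gk : good_kernel mu k yj dj.
Local Notation E := (kavg mu k).

(** Otherwise W = V - (M / T0) t - kap t (3 T0 - t) has a positive supremum. The bound V <= M keeps
    near-maxima away from t = T0, and smallness of V near t = 0 keeps them away from the bottom, so
    the stencil around a near-maximum stays in the strip. There the stencil sum of W is at most kap
    c h^2 / 2, whereas the strict barrier contributes at least kap c h^2, which for small h
    dominates the error C h^3. The supremum need not be attained, since y is unbounded. *)
Lemma maximum_principle (V : T -> R -> R) M T0 : 0 < T0 -> 0 <= M ->
  (forall y t, 0 < t <= T0 -> V y t <= M) ->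
  (forall eta, 0 < eta -> exists2 r, 0 < r & forall y t, 0 < t < r -> V y t <= eta) ->
  (forall eta e, 0 < eta -> 0 < e -> e <= T0 -> exists C r,
    [/\ 0 <= C, 0 < r & forall h y t, 0 < h < r -> e <= t <= T0 -> eta <= V y t ->
     - (C * h ^+ 3) <= \sum_j (V (yj y h j) (t + dj h j) - V y t)]) ->
  forall y t, 0 < t <= T0 -> V y t <= M / T0 * t.
Proof.
move=> T00 M0 VM Vt Vh y1 t1 /andP[t10 t1T]; rewrite leNgt; apply/negP => VL.
pose b t := t * (3 * T0 - t).
have b0 t : 0 < t <= T0 -> 0 < b t.
  by move=> /andP[t0 tT]; rewrite mulr_gt0//; lra.
pose d := V y1 t1 - M / T0 * t1.
have d0 : 0 < d by rewrite subr_gt0.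
have bt1 : 0 < b t1 by apply: b0; rewrite t10.
(* Chosen so that W equals d / 2 at the offending point. *)
pose kap := d / (2 * b t1).
have kap0 : 0 < kap by rewrite divr_gt0// mulr_gt0.
pose W y t := V y t - M / T0 * t - kap * b t.
pose A := [set w | exists y t, 0 < t <= T0 /\ w = W y t].
have W1 : W y1 t1 = d / 2.
  rewrite /W -/d /kap; field.
  by rewrite gt_eqF.
have MT t : 0 < t -> 0 <= M / T0 * t.
  by move=> t0; apply: mulr_ge0; [apply: divr_ge0|] => //; exact: ltW.
have WV y t : 0 < t <= T0 -> W y t <= V y t.
  move=> t0; rewrite /W.
  have := MT t (andP t0).1; have := mulr_gt0 kap0 (b0 _ t0); lra.
have supA : has_sup A.
  split; first by exists (W y1 t1), y1, t1; rewrite t10.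
  by exists M => _ [y [t [t0 ->]]]; exact: le_trans (WV _ _ t0) (VM _ _ t0).
pose S := sup A.
have WS y t : 0 < t <= T0 -> W y t <= S.
  by move=> t0; apply: ub_le_sup; [exact: supA.2|exists y, t].
have Sd : d / 2 <= S by rewrite -W1 WS// t10.
have [r r0 Hr] := Vt (d / 8) ltac:(by rewrite divr_gt0).
pose e := Num.min r T0.
have e0 : 0 < e by rewrite lt_min r0.
have eT : e <= T0 by rewrite ge_min lexx orbT.
have [C [r2 [C0 r20 Hr2]]] := Vh (d / 4) e ltac:(by rewrite divr_gt0) e0 eT.
have [c c0 Hc] := gk_barrier gk T00.
(* The five bounds serve, in turn, the mean value estimate, [|dj h j| <= h], t + h <= T0, t - h > 0,
   and C h^3 <= kap c h^2 / 4. *)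
pose h := Num.min (r2 / 2) (Num.min 1 (Num.min (d * T0 / (4 * (M + 1)))
   (Num.min (e / 2) (kap * c / (4 * (C + 1)))))).
have M1 : 0 < M + 1 by lra.
have C1 : 0 < C + 1 by lra.
have h0 : 0 < h.
  have hA : 0 < d * T0 / (4 * (M + 1)) by apply: divr_gt0; apply: mulr_gt0.
  have hB : 0 < kap * c / (4 * (C + 1)) by apply: divr_gt0; apply: mulr_gt0.
  by rewrite !lt_min ltr01 hA hB !divr_gt0.
have : h <= h by [].
rewrite {2}/h !le_min => /and5P[hr2 h1 hM he hC].
clearbody h.
have hrr : 0 < h < r2 by rewrite h0; lra.
have Ch3 : C * h ^+ 3 <= kap * c * h ^+ 2 / 4.
  have m1 : 0 < 4 * (C + 1) by apply: mulr_gt0.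
  rewrite ler_pdivlMr// in hC.
  have -> : C * h ^+ 3 = (C * h) * h ^+ 2 by ring.
  have -> : kap * c * h ^+ 2 / 4 = (kap * c / 4) * h ^+ 2 by field.
  by apply: ler_wpM2r; [exact: sqr_ge0|nra].
pose N : R := #|J|%:R.
have N0 : 0 <= N by rewrite ler0n.
(* Slack of the near-maximum: the first bound keeps W > d / 4 there, the second keeps the sum over
   all neighbours below kap c h^2 / 2. *)
pose th := Num.min (d / 4) (kap * c * h ^+ 2 / (2 * (N + 1))).
have kch : 0 < kap * c * h ^+ 2 by apply: mulr_gt0; [exact: mulr_gt0|exact: exprn_gt0].
have N1 : 0 < 2 * (N + 1) by lra.
have th0 : 0 < th by rewrite lt_min !divr_gt0.
have [_ [y [t [tT ->]]] Wz] := sup_adherent th0 supA.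
rewrite -/S in Wz.
have [t0 tT0] := andP tT.
have thd : th <= d / 4 by rewrite ge_min lexx.
have Wd : d / 4 < W y t by lra.
have Vd : d / 4 <= V y t by apply: ltW; apply: lt_le_trans Wd (WV _ _ tT).
have et : e <= t.
  rewrite leNgt; apply/negP => te.
  have : V y t <= d / 8 by apply: Hr; rewrite t0 (lt_le_trans te)// ge_min lexx.
  lra.
(* V <= M and W > d / 4 give M (T0 - t) / T0 >= d / 4, which leaves room for h below T0. *)
have tTh : t + h <= T0.
  have : d / 4 <= M * (T0 - t) / T0.
    have -> : M * (T0 - t) / T0 = M - M / T0 * t by field; rewrite gt_eqF.
    have := VM y _ tT; have := mulr_gt0 kap0 (b0 _ tT); move: Wd; rewrite /W; lra.
  rewrite ler_pdivlMr// => dM.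
  have m1 : 0 < 4 * (M + 1) by apply: mulr_gt0.
  rewrite ler_pdivlMr// in hM.
  have : M * (T0 - t) <= (M + 1) * (T0 - t) by apply: ler_wpM2r; [rewrite subr_ge0|rewrite lerDl].
  move=> HM; have : (M + 1) * h <= (M + 1) * (T0 - t) by lra.
  by rewrite ler_pM2l//; lra.
have hh1 : 0 < h <= 1 by rewrite h0.
have tj j : 0 < t + dj h j <= T0.
  have := gk_dj gk j hh1; rewrite ler_norml => /andP[? ?]; apply/andP; split; lra.
have ub : \sum_j (W (yj y h j) (t + dj h j) - W y t) <= kap * c * h ^+ 2 / 2.
  apply: (@le_trans _ _ (\sum_(j : J) th)).
    by apply: ler_sum => j _; have := WS (yj y h j) _ (tj j); lra.
  rewrite sumr_const -[X in X <= _]mulr_natr -/N.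
  apply: (@le_trans _ _ (th * (N + 1))); first by rewrite ler_pM2l; lra.
  have : th <= kap * c * h ^+ 2 / (2 * (N + 1)) by rewrite ge_min lexx orbT.
  rewrite ler_pdivlMr//.
  lra.
have lb : kap * c * h ^+ 2 * (3 / 4) <= \sum_j (W (yj y h j) (t + dj h j) - W y t).
  have -> : \sum_j (W (yj y h j) (t + dj h j) - W y t) =
    \sum_j (V (yj y h j) (t + dj h j) - V y t) - M / T0 * (\sum_j dj h j)
    - kap * \sum_j ((t + dj h j) * (3 * T0 - (t + dj h j)) - t * (3 * T0 - t)).
    rewrite !mulr_sumr -!sumrB; apply: eq_bigr => j _.
    by rewrite /W /b; ring.
  have H1 : - (C * h ^+ 3) <= \sum_j (V (yj y h j) (t + dj h j) - V y t).
    by apply: Hr2; rewrite ?et.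
  have H2 : M / T0 * (\sum_j dj h j) <= 0.
    apply: mulr_ge0_le0; last by apply: (gk_dj_le0 gk).
    by apply: divr_ge0 => //; exact: ltW.
  have H3 : kap * (\sum_j ((t + dj h j) * (3 * T0 - (t + dj h j)) - t * (3 * T0 - t)))
      <= kap * - (c * h ^+ 2).
    by rewrite ler_pM2l//; apply: Hc.
  lra.
lra.
Qed.

End maximum_principle.

(** * Comparison with the extension of the boundary values, and the semigroup law *)

Section semigroup.
Context (R : realType) (n : nat).
Local Notation T := (n.-tuple R).
Variable mu : {sigma_finite_measure set T -> \bar R}.
Variables (k : T -> R -> T -> R) (J : finType).
Variables (yj : T -> R -> J -> T) (dj : R -> J -> R).
Hypothesis gk : good_kernel mu k yj dj.
Local Notation E := (kavg mu k).

Lemma bmeas_ge0 M (g : T -> R) : bmeas M g -> 0 <= M.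
Proof. by move=> [_ /(_ [tuple of nseq n 0])]; exact: le_trans. Qed.

Lemma bmeasN M (g : T -> R) : bmeas M g -> bmeas M (fun u => - g u).
Proof. by move=> [mg gM]; split=> [|u]; [exact: measurable_funN|rewrite normrN]. Qed.

Lemma bmeasB M N (f g : T -> R) : bmeas M f -> bmeas N g ->
  bmeas (M + N) (fun u => f u - g u).
Proof.
move=> [mf fM] [mg gN]; split=> [|u]; first exact: measurable_funB.
by apply: le_trans (ler_normB _ _) _; exact: lerD.
Qed.

Lemma bmeas_norm M (g : T -> R) : bmeas M g -> bmeas M (fun u => `|g u|).
Proof.
move=> [mg gM]; split=> [|u]; last by rewrite normr_id.
exact: measurableT_comp.
Qed.

Lemma bmeas_cst (c : R) : bmeas `|c| (fun _ : T => c).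
Proof. by []. Qed.

Lemma kavgN y t g M : 0 < t -> bmeas M g -> E y t (fun u => - g u) = - E y t g.
Proof.
move=> t0 gM; rewrite -mulN1r -(kavgZ gk _ _ t0 gM).
by apply: eq_Rintegral => u _; rewrite mulN1r.
Qed.

(** Near y the modulus of continuity of g acts; away from y the tail bound replaces [k y t] by a
    small multiple of [k y s], which has mass one. *)
Lemma kavg_near0 g M : bmeas M g ->
  (forall eta, 0 < eta -> exists2 r, 0 < r & forall y y', near_pt r y y' ->
    `|g y' - g y| <= eta) ->
  forall eta, 0 < eta -> exists2 r, 0 < r & forall y t, 0 < t < r ->
    `|E y t g - g y| <= eta.
Proof.
move=> gM uc eta eta0; have M0 := bmeas_ge0 gM; have e2 : 0 <= eta / 2 by lra.
have [r r0 Hr] := uc (eta / 2) ltac:(by rewrite divr_gt0).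
have om0 : 0 < eta / (4 * (M + 1)).
  by apply: divr_gt0 => //; apply: mulr_gt0 => //; lra.
have [r1 [s [r10 s0 H]]] := gk_tail gk r0 om0.
exists r1 => // y t /andP[t0 tr].
have gB : bmeas (M + `|g y|) (fun u => g u - g y) by apply: bmeasB => //; exact: bmeas_cst.
rewrite -[X in _ - X](kavg_cst gk y (g y) t0) -(kavgB gk _ t0 gM (bmeas_cst (g y))).
apply: le_trans (le_normr_Rintegral measurableT (integrable_kavg gk _ t0 gB)) _.
apply: (@le_trans _ _ (\int[mu]_u (eta / 2 * k y t u + eta / 2 * k y s u))).
  apply: le_Rintegral => //.
  - exact/integrable_norm/(integrable_kavg gk _ t0 gB).
  - under [X in integrable _ _ X]eq_fun do rewrite /= EFinD !EFinM.
    by apply: integrableD => //; apply: integrableZl => //; exact: (integrable_gk gk).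
  move=> u _; have k0 := gk_ge0 gk y u t0; have ks0 := gk_ge0 gk y u s0.
  rewrite normrM (ger0_norm k0).
  have [nu|nu] := pselect (near_pt r y u).
    have := Hr _ _ nu; have := normr_ge0 (g u - g y) => *.
    apply: (@le_trans _ _ (eta / 2 * k y t u)).
      by rewrite mulrC; apply: ler_wpM2r.
    by rewrite lerDl; apply: mulr_ge0.
  have := H y t u; rewrite t0 tr => /(_ isT nu) ku.
  apply: (@le_trans _ _ (eta / 2 * k y s u)); last first.
    by rewrite lerDr; apply: mulr_ge0.
  apply: (@le_trans _ _ (eta / (4 * (M + 1)) * k y s u * (2 * M))).
    apply: ler_pM => //; apply: le_trans (ler_normB _ _) _.
    by have := gM.2 u; have := gM.2 y; lra.
  rewrite mulrAC; apply: ler_wpM2r => //.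
  rewrite mulrAC ler_pdivrMr; last by apply: mulr_gt0 => //; lra.
  by nra.
rewrite RintegralD//; last 2 first.
- by under [X in integrable _ _ X]eq_fun do rewrite /= EFinM; apply: integrableZl => //; exact: (integrable_gk gk).
- by under [X in integrable _ _ X]eq_fun do rewrite /= EFinM; apply: integrableZl => //; exact: (integrable_gk gk).
rewrite !RintegralZl//; [|exact: (integrable_gk gk)|exact: (integrable_gk gk)].
by rewrite /Rintegral !(gk_int gk)//=; lra.
Qed.

(** The maximum principle for V = U - E (U at time 0), which is at most 2 M, gives V <= (2 M / T0) t
    on strips of any height T0; then T0 tends to infinity. The subsolution inequality is asked for
    only where V >= eta. *)
Lemma sub_le (U : T -> R -> R) M :
  (forall y t, 0 <= t -> `|U y t| <= M) ->
  measurable_fun [set: T] (U ^~ 0) ->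
  (forall eta, 0 < eta -> exists2 r, 0 < r & forall y y' t, 0 <= t < r ->
    near_pt r y y' -> `|U y' t - U y 0| <= eta) ->
  (forall eta e T0, 0 < eta -> 0 < e -> e <= T0 -> exists C r,
    [/\ 0 <= C, 0 < r & forall h y t, 0 < h < r -> e <= t <= T0 ->
     eta <= U y t - E y t (U ^~ 0) ->
     - (C * h ^+ 3) <= \sum_j (U (yj y h j) (t + dj h j) - U y t)]) ->
  forall y t, 0 < t -> U y t <= E y t (U ^~ 0).
Proof.
move=> UM mU uc mv y t t0.
have UB : bmeas M (U ^~ 0) by split=> // u; exact: UM.
have M0 := bmeas_ge0 UB.
pose V y t := U y t - E y t (U ^~ 0).
have VM y' t' : 0 < t' -> V y' t' <= 2 * M.
  move=> t'0; have := UM y' t' (ltW t'0); have := kavg_bound gk y' t'0 UB.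
  by rewrite /V !ler_norml => /andP[? ?] /andP[? ?]; lra.
suff VT T0 : t <= T0 -> V y t <= 2 * M / T0 * t.
  rewrite -subr_le0 -/(V y t) leNgt; apply/negP => V0.
  have q0 : 0 <= 4 * M * t / V y t.
    by apply: divr_ge0; [apply: mulr_ge0; [apply: mulr_ge0|]|] => //; exact: ltW.
  (* With this height for T0, the bound 2 M t / T0 falls below V y t. *)
  have tt : 0 < t + 4 * M * t / V y t by lra.
  have := VT (t + 4 * M * t / V y t); rewrite lerDl q0 => /(_ isT).
  rewrite mulrAC ler_pdivlMr// mulrDr mulrCA divff ?gt_eqF//.
  by have := mulr_gt0 V0 t0; have := mulr_ge0 M0 (ltW t0); lra.
move=> tT; have T00 : 0 < T0 by exact: lt_le_trans tT.
apply: (maximum_principle gk T00 (V := V) (M := 2 * M)); last by rewrite t0.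
- by rewrite mulr_ge0.
- by move=> y' t' /andP[? _]; exact: VM.
- move=> eta eta0.
  have [r r0 Hr] := uc (eta / 2) ltac:(by rewrite divr_gt0).
  have uc0 eta' : 0 < eta' -> exists2 r, 0 < r & forall y y', near_pt r y y' ->
    `|U y' 0 - U y 0| <= eta'.
    move=> /uc[r' r'0 Hr']; exists r' => // y1 y2 H; apply: Hr' => //.
    by rewrite lexx.
  have [r1 r10 Hr1] := kavg_near0 UB uc0 (eta := eta / 2) ltac:(by rewrite divr_gt0).
  exists (Num.min r r1); first by rewrite lt_min r0.
  move=> y' t' /andP[t'0]; rewrite lt_min => /andP[tr tr1].
  have := Hr y' y' t'; rewrite ltW// tr => /(_ isT (near_pt_refl _ r0)).
  have := Hr1 y' t'; rewrite t'0 tr1 => /(_ isT).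
  by rewrite /V !ler_norml => /andP[? ?] /andP[? ?]; lra.
move=> eta e eta0 e0 eT.
have [C [r [C0 r0 H]]] := mv _ _ _ eta0 e0 eT.
have [C' [r' [C'0 r'0 H']]] := kavg_mvp gk e0 eT.
exists (C + C' * M), (Num.min r r'); split; rewrite ?lt_min ?r0//.
  by rewrite addr_ge0// mulr_ge0.
move=> h y' t' /andP[h0]; rewrite lt_min => /andP[hr hr'] tt V0.
have := H h y' t'; rewrite h0 hr tt => /(_ isT isT V0).
have := H' h y' t' _ _ _ _ UB; rewrite h0 hr' tt => /(_ isT isT).
rewrite ler_norml => /andP[_ A1] A2.
have -> : \sum_j (V (yj y' h j) (t' + dj h j) - V y' t') =
  \sum_j (U (yj y' h j) (t' + dj h j) - U y' t') -
  \sum_j (E (yj y' h j) (t' + dj h j) (U ^~ 0) - E y' t' (U ^~ 0)).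
  by rewrite -sumrB; apply: eq_bigr => j _; rewrite /V; ring.
by lra.
Qed.

(** Uniqueness for the boundary value problem: [E y (t + e) g] is a solution with boundary values
    E_e g, and [sub_le] applied to g and to -g compares it with their extension from both sides. No
    convolution of kernels is computed. *)
Lemma kavg_semigroup g M e y t : bmeas M g -> 0 < e -> 0 < t ->
  E y (t + e) g = E y t (fun v => E v e g).
Proof.
move=> gM e0 t0.
have key h : bmeas M h -> E y (t + e) h <= E y t (fun v => E v e h).
  move=> hM; have M0 := bmeas_ge0 hM.
  have := @sub_le (fun y t => E y (t + e) h) M; rewrite add0r; apply => //.
  - by move=> y' t' t'0; apply: (kavg_bound gk) => //; lra.
  - by have [] := measurable_kavg gk e0 hM.
  - move=> eta eta0.
    have [r r0 Hr] := kavg_mod gk e0 (lexx e) (eta := eta / (M + 1)) ltac:(by rewrite divr_gt0//; lra).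
    exists r => // y1 y2 t' /andP[t'0 t'r] yy.
    have := Hr y1 y2 e (t' + e) h M; rewrite lexx addrK ger0_norm// => /(_ isT t'r yy hM).
    by move=> /le_trans; apply; rewrite mulrAC ler_pdivrMr; nra.
  - move=> eta e1 T0 eta0 e10 eT.
    have [||C [r [C0 r0 H]]] := kavg_mvp gk (e := e1 + e) (T0 := T0 + e); [lra|lra|].
    exists (C * M), r; split => //; first exact: mulr_ge0.
    move=> h' y1 t1 h'r /andP[t1e t1T] _.
    have := H h' y1 (t1 + e) h M h'r _ hM; rewrite !lerD2r t1e t1T => /(_ isT).
    rewrite ler_norml mulrAC => /andP[+ _] => /le_trans; apply.
    by under eq_bigr do rewrite addrAC.
apply/eqP; rewrite eq_le key//=.
have := key _ (bmeasN gM); rewrite (kavgN _ _ gM); last by rewrite addr_gt0.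
rewrite (_ : (fun v => E v e _) = (fun v => - E v e g)); last first.
  by apply/funext => v; rewrite (kavgN _ _ gM).
by rewrite (kavgN _ _ (measurable_kavg gk e0 gM))// lerN2.
Qed.

Lemma kavg_cvg (g_ : nat -> T -> R) g M y t : 0 < t ->
  (forall m, bmeas M (g_ m)) -> bmeas M g -> (forall u, g_ m u @[m --> \oo] --> g u) ->
  E y t (g_ m) @[m --> \oo] --> E y t g.
Proof.
move=> t0 gmM gM gmg.
have ik : mu.-integrable setT (fun u => M%:E * (k y t u)%:E)%E.
  by apply: integrableZl => //; exact: (integrable_gk gk).
apply: fine_cvg; rewrite /kavg /Rintegral fineK; last first.
  by apply: integrable_fin_num => //; exact: (integrable_kavg gk) gM.
apply: (@dominated_cvg _ _ _ mu _ measurableT _ _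
  (fun u => M%:E * (k y t u)%:E)%E _ _ _ ik).
- by move=> m; apply: (measurable_int mu); exact: (integrable_kavg gk _ _ (gmM m)).
- move=> u _; apply: cvg_EFin; first exact: nearW.
  by apply: cvgMr; exact: gmg.
- by [].
- move=> m u _ /=; rewrite lee_fin normrM mulrC; apply: ler_pM => //.
  + exact: (gmM m).2.
  + by rewrite ger0_norm// (gk_ge0 gk).
Qed.

End semigroup.

(** * Boundary values in the mean, and the one-sided comparison *)

(** Closed sets stable under intersection: closedness gives the pointwise limit off the set in
    [approximable_upper_orthant], stability serves the Dynkin argument. *)
Definition upper_orthants (R : realType) (n : nat) : set (set (n.-tuple R)) :=
  [set A | exists c : 'I_n -> R, A = [set u | forall i, c i <= tnth u i]].

Lemma measurable_upper_orthant (R : realType) n (c : 'I_n -> R) :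
  measurable [set u : n.-tuple R | forall i, c i <= tnth u i].
Proof.
rewrite (_ : [set _ | _] =
    \bigcap_(i in [set: 'I_n]) (fun u => tnth u i) @^-1` `[c i, +oo[%classic).
  apply: fin_bigcap_measurable => // i _; rewrite -[X in measurable X]setTI.
  by apply: measurable_tnth => //; exact: measurable_itv.
apply/seteqP; split => u /= H i; first by move=> _ /=; rewrite in_itv/= andbT.
by have := H i I; rewrite /= in_itv/= andbT.
Qed.

Lemma measurable_tupleE (R : realType) n :
  @measurable _ (n.-tuple R) = <<s @upper_orthants R n >>.
Proof.
apply/seteqP; split; last first.
  apply: smallest_sub; first exact: sigma_algebra_measurable.
  by move=> _ [c ->]; exact: measurable_upper_orthant.
apply: smallest_sub; first exact: smallest_sigma_algebra.
suff mt i : measurable_fun [set: g_sigma_algebraType (@upper_orthants R n)]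
    (fun u : n.-tuple R => tnth u i).
  move=> A; rewrite -bigcup_seq/= => -[i _ /= [B mB <-]].
  exact: (mt i measurableT).
move=> mT; apply: (measurability _ (RGenCInfty.measurableE R)) => //.
move=> _ [_ [x ->] <-]; rewrite setTI.
(* A half-space is the union of orthants whose other coordinates are bounded below by -m. *)
rewrite (_ : _ @^-1` _ = \bigcup_m [set u : n.-tuple R | forall j,
    (if j == i then x else - m%:R) <= tnth u j]).
  apply: bigcupT_measurable => m; apply: sub_sigma_algebra.
  by exists (fun j => if j == i then x else - m%:R).
apply/seteqP; split => u /=.
  rewrite in_itv/= andbT => xu.
  exists (Num.Def.truncn (\sum_j `|tnth u j|)).+1 => //= j.
  case: eqP => [->//|_]; rewrite lerNl.
  have H : \sum_j `|tnth u j| <= (Num.Def.truncn (\sum_j `|tnth u j|)).+1%:R.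
    by apply: ltW; exact: truncnS_gt.
  apply: le_trans H; apply: le_trans (ler_norm _) _; rewrite normrN.
  by rewrite (bigD1 j)//= lerDl sumr_ge0.
by move=> [m _ /(_ i)]; rewrite eqxx in_itv/= andbT.
Qed.


Section approximate_identity.
Context (R : realType) (n : nat).
Local Notation T := (n.-tuple R).
Variable mu : {sigma_finite_measure set T -> \bar R}.
Variables (k : T -> R -> T -> R) (J : finType).
Variables (yj : T -> R -> J -> T) (dj : R -> J -> R).
Hypothesis gk : good_kernel mu k yj dj.
Local Notation E := (kavg mu k).
Local Notation em m := (m.+1%:R^-1 : R).

(** Convergence of the extension to its boundary values in the mean, for every kernel measure. *)
Definition approximable (g : T -> R) := forall y t, 0 < t ->
  E y t (fun v => `|E v (em m) g - g v|) @[m --> \oo] --> (0 : R).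

Let em0 m : 0 < em m. Proof. by rewrite invr_gt0 ltr0n. Qed.

Lemma near_em (r : R) : 0 < r -> \forall m \near \oo, em m < r.
Proof. by move=> r0; exact: near_infty_natSinv_lt (PosNum r0). Qed.

Let bE M g m : bmeas M g -> bmeas (M + M) (fun v => E v (em m) g - g v).
Proof. by move=> gM; apply: bmeasB => //; exact: (measurable_kavg gk). Qed.

Lemma bmeasW M N (g : T -> R) : M <= N -> bmeas M g -> bmeas N g.
Proof. by move=> MN [mg gM]; split=> // u; exact: le_trans (gM u) MN. Qed.

Lemma bmeasD M N (f g : T -> R) : bmeas M f -> bmeas N g ->
  bmeas (M + N) (fun u => f u + g u).
Proof.
move=> [mf fM] [mg gN]; split=> [|u]; first exact: measurable_funD.
by apply: le_trans (ler_normD _ _) _; exact: lerD.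
Qed.

Lemma bmeasZ M c (g : T -> R) : bmeas M g -> bmeas (`|c| * M) (fun u => c * g u).
Proof.
move=> [mg gM]; split=> [|u]; first exact: measurable_funM.
by rewrite normrM ler_wpM2l.
Qed.

Lemma approximable_squeeze (g : T -> R) (q : nat -> T -> R -> R) :
  (forall y t m, 0 < t -> E y t (fun v => `|E v (em m) g - g v|) <= q m y t) ->
  (forall y t, 0 < t -> q m y t @[m --> \oo] --> (0 : R)) -> approximable g.
Proof.
move=> Eq q0 y t t0.
apply: (squeeze_cvgr _ (cvg_cst 0) (q0 y t t0)).
apply: nearW => m; rewrite Eq// andbT.
by apply: (kavg_ge0 gk).
Qed.

Lemma approximableD M N f g : bmeas M f -> bmeas N g ->
  approximable f -> approximable g -> approximable (fun u => f u + g u).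
Proof.
move=> fM gN af ag.
apply: (approximable_squeeze (q := fun m y t => E y t (fun v => `|E v (em m) f - f v|) +
  E y t (fun v => `|E v (em m) g - g v|))) => [y t m t0|y t t0]; last first.
  by rewrite -(addr0 0); apply: cvgD; [exact: af|exact: ag].
have bf := bmeas_norm (bE m fM); have bg := bmeas_norm (bE m gN).
rewrite -(kavgD gk _ t0 bf bg).
apply: (le_kavg gk _ t0 (bmeas_norm (bE m (bmeasD fM gN))) (bmeasD bf bg)) => v.
rewrite (kavgD gk _ (em0 m) fM gN); apply: le_trans (ler_normD _ _).
by rewrite le_eqVlt; apply/orP; left; apply/eqP; congr `|_|; ring.
Qed.

Lemma approximableZ M c g : bmeas M g ->
  approximable g -> approximable (fun u => c * g u).
Proof.
move=> gM ag.
apply: (approximable_squeeze (q := fun m y t => `|c| * E y t (fun v => `|E v (em m) g - g v|)))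
  => [y t m t0|y t t0]; last first.
  by rewrite -(mulr0 `|c|); apply: cvgMr; exact: ag.
have bg := bmeas_norm (bE m gM).
rewrite -(kavgZ gk _ _ t0 bg).
apply: (le_kavg gk _ t0 (bmeas_norm (bE m (bmeasZ c gM))) (bmeasZ _ bg)) => v.
by rewrite (kavgZ gk _ _ (em0 m) gM) -mulrBr normrM.
Qed.

Lemma approximable_cst c : approximable (fun=> c).
Proof.
apply: (approximable_squeeze (q := fun _ _ _ => 0)) => [y t m t0|y t t0].
  rewrite (_ : (fun v => _) = fun=> 0) ?(kavg_cst gk)//.
  by apply/funext => v; rewrite (kavg_cst gk)// subrr normr0.
exact: cvg_cst.
Qed.

Lemma approximable_sum (I : Type) (s : seq I) (g : I -> T -> R) :
  (forall i, exists M, bmeas M (g i)) -> (forall i, approximable (g i)) ->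
  approximable (fun u => \sum_(i <- s) g i u) /\
  exists M, bmeas M (fun u => \sum_(i <- s) g i u).
Proof.
move=> bg ag; elim: s => [|i s [IH [M bM]]].
  under eq_fun do rewrite big_nil; split; first exact: approximable_cst.
  by exists `|0 : R|; exact: bmeas_cst.
under eq_fun do rewrite big_cons.
have [N bN] := bg i; split; first by apply: approximableD IH; [exact: bN|exact: bM|].
by exists (N + M); exact: bmeasD.
Qed.

(* Semigroup property and domination bound the smoothed remainder
   [E y t (E (g - g_ N))] by [C * E y (2 t) |g - g_ N|] uniformly in the
   smoothing parameter. *)
Lemma approximable_lim M (g_ : nat -> T -> R) g :
  (forall N, bmeas M (g_ N)) -> bmeas M g -> (forall u, g_ N u @[N --> \oo] --> g u) ->
  (forall N, approximable (g_ N)) -> approximable g.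
Proof.
move=> gM_ gM gg ag y t t0.
have t20 : 0 < 2 * t by rewrite mulr_gt0.
have [C C0 HC] := gk_dom gk t0.
pose r N v := `|g v - g_ N v|.
have br N : bmeas (M + M) (r N) by apply: bmeas_norm; exact: bmeasB.
have r0 : E y (2 * t) (r N) @[N --> \oo] --> (0 : R).
  rewrite -(kavg_cst gk y 0 t20).
  apply: (@kavg_cvg _ _ mu k J yj dj gk r (fun=> 0) (M + M)) => //.
    apply: (bmeasW _ (bmeas_cst n (0 : R))); rewrite normr0.
    by have := bmeas_ge0 gM => ?; rewrite addr_ge0.
  move=> u; rewrite -(normr0 R) -(subrr (g u)); apply: cvg_norm.
  by apply: cvgB; [exact: cvg_cst|exact: gg].
have dom N s : t <= s <= 2 * t -> E y s (r N) <= C * E y (2 * t) (r N).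
  move=> ts; have s0 : 0 < s by have /andP[? _] := ts; exact: lt_le_trans t0 _.
  rewrite -(kavgZ gk _ _ t20 (br N)); apply: le_Rintegral => //.
  - exact: (integrable_kavg gk _ s0 (br N)).
  - exact: (integrable_kavg gk _ t20 (bmeasZ C (br N))).
  - move=> u _; rewrite mulrCA mulrA; by apply: ler_wpM2r; [exact: normr_ge0|exact: HC].
apply/cvgrPdist_le => eta eta0.
have /cvgrPdist_le/(_ (eta / (4 * (C + 1)))) := r0.
have e4 : 0 < eta / (4 * (C + 1)) by apply: divr_gt0 => //; apply: mulr_gt0 => //; lra.
move=> /(_ e4)[N _ /(_ N (leqnn _))] /=; rewrite sub0r normrN => rN.
have CrN : C * E y (2 * t) (r N) <= eta / 4.
  have := le_trans (ler_norm _) rN => H.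
  apply: le_trans (ler_wpM2l C0 H) _.
  rewrite mulrA ler_pdivrMr; last by apply: mulr_gt0 => //; lra.
  by nra.
have /cvgrPdist_le/(_ (eta / 2) ltac:(by rewrite divr_gt0)) := ag N y t t0.
have emt := near_em t0.
move=> H; near=> m.
rewrite sub0r normrN ger0_norm; last by apply: (kavg_ge0 gk).
have emm : em m < t by near: m.
have : `|0 - E y t (fun v => `|E v (em m) (g_ N) - g_ N v|)| <= eta / 2.
  by near: m.
rewrite sub0r normrN ger0_norm; last by apply: (kavg_ge0 gk).
have b1 := bmeas_norm (bE m (gM_ N)).
have b2 := measurable_kavg gk (em0 m) (br N).
have b12 := bmeasD b1 b2; have b := bmeasD b12 (br N).
have : E y t (fun v => `|E v (em m) g - g v|) <=
  E y t (fun v => `|E v (em m) (g_ N) - g_ N v| + E v (em m) (r N) + r N v).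
  apply: (le_kavg gk _ t0 (bmeas_norm (bE m gM)) b) => v.
  have : `|E v (em m) g - E v (em m) (g_ N)| <= E v (em m) (r N).
    rewrite -(kavgB gk _ (em0 m) gM (gM_ N)) ler_norml; apply/andP; split.
      rewrite lerNl -(kavgN gk _ (em0 m) (bmeasB gM (gM_ N))).
      apply: (le_kavg gk _ (em0 m) (bmeasN (bmeasB gM (gM_ N))) (br N)) => u.
      by rewrite /r -normrN ler_norm.
    apply: (le_kavg gk _ (em0 m) (bmeasB gM (gM_ N)) (br N)) => u.
    by rewrite /r ler_norm.
  rewrite /r => H1.
  have -> : E v (em m) g - g v = (E v (em m) (g_ N) - g_ N v) +
    (E v (em m) g - E v (em m) (g_ N)) + (g_ N v - g v) by ring.
  rewrite [X in _ <= _ + X]distrC.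
  apply: le_trans (ler_normD _ _) _; rewrite lerD2r.
  by apply: le_trans (ler_normD _ _) _; rewrite lerD2l.
rewrite (kavgD gk _ t0 b12 (br N)) (kavgD gk _ t0 b1 b2).
rewrite -(kavg_semigroup gk y (br N) (em0 m) t0).
have tt : t <= t <= 2 * t by rewrite lexx /=; lra.
have te : t <= t + em m <= 2 * t.
  by rewrite lerDl ltW ?em0//= mulr_natl mulr2n lerD2l ltW.
have := dom N _ tt; have := dom N _ te.
by lra.
Unshelve. all: by end_near. Qed.

Lemma bmeas_indic (A : set T) : measurable A -> bmeas 1 (\1_A : T -> R).
Proof.
move=> mA; split; first exact: measurable_indic.
by move=> u; rewrite indicE; case: (_ \in _); rewrite ?normr1 ?normr0.
Qed.

(** Write a = E_e 1_A - 1_A and |a| = -a + 2 a^+. On A one has a <= 0, and off the closed set A the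
    tail bound sends a to 0, so a^+ tends to 0 boundedly. By the semigroup law the average of -a is
    E_t 1_A - E_(t+e) 1_A, which is small by continuity in time. *)
Lemma approximable_upper_orthant (A : set T) : @upper_orthants R n A -> 
  approximable (\1_A : T -> R).
Proof.
move=> [c Ac].
have mA : measurable A by rewrite Ac; exact: measurable_upper_orthant.
have bA := bmeas_indic mA.
pose a m v := E v (em m) \1_A - \1_A v.
pose ap m v := Num.max (a m v) 0.
have ba m := bE m bA.
have bap m : bmeas 2 (ap m).
  split; first by apply: measurable_maxr => //; exact: (ba m).1.
  move=> u; have := (ba m).2 u; rewrite -/(a m u) /ap; case: (leP (a m u) 0).
    by rewrite normr0 ler0n.
  by move=> _ /le_trans; apply.
have ap0 v : ap m v @[m --> \oo] --> (0 : R).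
  have [Av|nAv] := pselect (A v).
    apply: cvg_near_cst; apply: nearW => m; rewrite /ap max_r// /a indicE mem_set//.
    rewrite subr_le0; apply: le_trans (ler_norm _) _.
    exact: (kavg_bound gk _ (em0 m) bA).
  have [eta eta0 Heta] : exists2 eta, 0 < eta & forall u, A u -> ~ near_pt eta v u.
    move: nAv; rewrite Ac => /existsNP[i /negP]; rewrite -ltNge => vi.
    exists (c i - tnth v i); first by rewrite subr_gt0.
    move=> u Au /(_ i); rewrite distrC ltNge => /negP; apply.
    by apply: le_trans (ler_norm _); have := Au i; lra.
  apply/cvgrPdist_le => om om0.
  have [r [s [r0 s0 H]]] := gk_tail gk eta0 om0.
  have emr := near_em r0; near=> m.
  rewrite sub0r normrN ger0_norm; last by rewrite /ap le_max lexx orbT.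
  rewrite /ap ge_max (ltW om0) andbT /a indicE memNset// subr0.
  have <- : \int[mu]_u (om * k v s u) = om.
    rewrite RintegralZl//; last exact: (integrable_gk gk).
    by rewrite /Rintegral (gk_int gk)//= mulr1.
  apply: le_Rintegral => //.
  - exact: (integrable_kavg gk _ (em0 m) bA).
  - under [X in integrable _ _ X]eq_fun do rewrite /= EFinM.
    by apply: integrableZl => //; exact: (integrable_gk gk).
  move=> u _; rewrite indicE; have [Au|nAu] := pselect (A u).
    rewrite mem_set// mulr1; apply: H; last exact: Heta.
    by rewrite em0; near: m.
  by rewrite memNset// mulr0; apply: mulr_ge0; [exact: ltW|exact: (gk_ge0 gk)].
move=> y t t0.
have := @kavg_cvg _ _ mu k J yj dj gk ap (fun=> 0) 2 y t t0 bap.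
rewrite (kavg_cst gk)// => /(_ _ ap0) apc.
have {apc} apc : E y t (ap m) @[m --> \oo] --> (0 : R).
  by apply: apc; split => // u; rewrite normr0 ler0n.
apply/cvgrPdist_le => eta eta0.
have [r r0 Hr] := kavg_mod gk t0 (lexx t) (eta := eta / 2) ltac:(by rewrite divr_gt0).
have emr := near_em r0.
have /cvgrPdist_le/(_ (eta / 4) ltac:(by rewrite divr_gt0)) apn := apc.
near=> m.
rewrite sub0r normrN ger0_norm; last by apply: (kavg_ge0 gk).
have -> : (fun v => `|E v (em m) \1_A - \1_A v|) =
    fun v => (\1_A v - E v (em m) \1_A) + 2 * ap m v.
  apply/funext => v; rewrite /ap /a; case: (leP (E v (em m) \1_A - \1_A v) 0) => h.
    by rewrite ler0_norm// mulr0 addr0 opprB.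
  by rewrite gtr0_norm//; ring.
have bB := bmeasB bA (measurable_kavg gk (em0 m) bA).
rewrite (kavgD gk _ t0 bB (bmeasZ 2 (bap m))) (kavgZ gk _ _ t0 (bap m)).
rewrite (kavgB gk _ t0 bA (measurable_kavg gk (em0 m) bA)).
rewrite -(kavg_semigroup gk y bA (em0 m) t0).
have : `|0 - E y t (ap m)| <= eta / 4 by near: m.
rewrite sub0r normrN => /(le_trans (ler_norm _)).
have := Hr y y t (t + em m) \1_A 1; rewrite lexx addrAC subrr add0r (ger0_norm (ltW (em0 m))).
have emr' : em m < r by near: m.
move=> /(_ isT emr' (near_pt_refl _ r0) bA); rewrite ler_norml => /andP[? ?].
by lra.
Unshelve. all: by end_near. Qed.

(** Dynkin's theorem from the orthants; countable disjoint unions pass through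
    [approximable_lim]. *)
Lemma approximable_indic (A : set T) : measurable A -> approximable (\1_A : T -> R).
Proof.
rewrite measurable_tupleE => mA.
apply: (dynkin_induction (P := fun A => approximable (\1_A : T -> R))
  (measurable_tupleE R n) _ _ _ _ _ mA).
- move=> _ _ [c ->] [c' ->]; exists (fun i => Num.max (c i) (c' i)).
  apply/seteqP; split => u /=.
    by move=> [h h'] i; rewrite ge_max h h'.
  by move=> h; split => i; have := h i; rewrite ge_max => /andP[].
- by rewrite indicT; exact: approximable_cst.
- by move=> B; exact: approximable_upper_orthant.
- move=> B mB aB.
  rewrite (_ : \1_(~` B) = fun u => 1 + -1 * \1_B u); last first.
    apply/funext => u; rewrite !indicE in_setC.
    by case: (_ \in _); rewrite /= ?mulr1 ?mulr0 ?subrr ?addr0.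
  apply: (approximableD (bmeas_cst n (1 : R)) (bmeasZ (-1) (bmeas_indic mB))).
    exact: approximable_cst.
  exact: approximableZ (bmeas_indic mB) _.
- move=> F mF tF aF.
  apply: (@approximable_lim 1 (fun N => \1_(\big[setU/set0]_(i < N) F i))).
  + by move=> N; apply: bmeas_indic; exact: bigsetU_measurable.
  + by apply: bmeas_indic; exact: bigcupT_measurable.
  + move=> u; have [[i _ Fi]|nF] := pselect ((\bigcup_i F i) u).
      apply: cvg_near_cst; near=> N.
      have H1 : (\bigcup_i F i) u by exists i.
      have H2 : (\big[setU/set0]_(i < N) F i) u.
        rewrite -bigcup_mkord; exists i => //=; near: N.
        exact: nbhs_infty_gt.
      by rewrite !indicE (mem_set H1) (mem_set H2).
    apply: cvg_near_cst; apply: nearW => N.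
    rewrite !indicE (memNset nF) memNset// -bigcup_mkord => -[i _ Fi].
    by apply: nF; exists i.
  + elim=> [|N IH]; first by rewrite big_ord0 indic0; exact: approximable_cst.
    rewrite big_ord_recr/= (_ : \1_ _ = fun u =>
      \1_(\big[setU/set0]_(i < N) F i) u + \1_(F N) u).
      have mFN : measurable (\big[setU/set0]_(i < N) F i) by exact: bigsetU_measurable.
      exact: (approximableD (bmeas_indic mFN) (bmeas_indic (mF N)) IH (aF N)).
    apply/funext => u; rewrite !indicE in_setU.
    have [uN|uN] := boolP (u \in F N); last by rewrite orbF addr0.
    rewrite orbT memNset ?add0r// -bigcup_mkord => -[i /= iN Fi].
    have : F i `&` F N !=set0 by exists u; split => //; exact: set_mem.
    by move=> /(tF i N I I) iN'; rewrite iN' ltnn in iN.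
Unshelve. all: by end_near. Qed.

(** The shift g + M is nonnegative, hence a bounded increasing limit of simple functions. *)
Lemma approximable_bmeas M g : bmeas M g -> approximable g.
Proof.
move=> gM; have M0 := bmeas_ge0 gM.
pose h u := g u + M.
have h0 u : 0 <= h u.
  by have := gM.2 u; rewrite ler_norml /h => /andP[? _]; lra.
have hM : bmeas (M + `|M|) h by apply: bmeasD gM _; exact: bmeas_cst.
have mh : measurable_fun [set: T] (EFin \o h) by apply/measurable_EFinP; exact: hM.1.
pose s_ := nnsfun_approx measurableT mh.
have sc u : s_ N u @[N --> \oo] --> h u.
  have := @cvg_nnsfun_approx _ T R _ measurableT _ mh _ u I.
  by move=> /(_ (fun x _ => h0 x)) /fine_cvg.
have sh N u : s_ N u <= h u.
  rewrite -(cvg_lim _ (sc u))//.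
  apply: (@nondecreasing_cvgn_le _ (fun N => s_ N u)) => [m p mp|].
    exact/lefP/nd_nnsfun_approx.
  by apply/cvg_ex; exists (h u); exact: sc.
have as_ N : approximable (s_ N : T -> R).
  have [s Hs] : exists s : seq R, forall u,
      s_ N u = \sum_(x <- s) (x * \1_(s_ N @^-1` [set x]) u).
    by eexists => u; rewrite fimfunE fsbig_finite.
  rewrite (_ : (s_ N : T -> R) = fun u => \sum_(x <- s) (x * \1_(s_ N @^-1` [set x]) u)).
    have b1 x : bmeas 1 (\1_(s_ N @^-1` [set x]) : T -> R) by exact: bmeas_indic.
    apply: (approximable_sum _ _ _).1 => x.
      by eexists; exact: bmeasZ (b1 x).
    by apply: approximableZ (b1 x) _; exact: approximable_indic.
  exact/funext.
have ah : approximable h.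
  apply: (approximable_lim (M := M + `|M|) _ hM sc as_) => N.
    split; first exact: measurable_funP.
    by move=> u; rewrite ger0_norm//; apply: le_trans (sh N u) _;
       apply: le_trans (ler_norm _) (hM.2 u).
rewrite (_ : g = fun u => h u + - M).
  exact: (approximableD hM (bmeas_cst n (- M)) ah (approximable_cst _)).
by apply/funext => u; rewrite /h addrK.
Qed.

(* [G = psi^+ on {rho >= g}, 0 elsewhere] is locally convex along the extension,
   hence [G (E rho, E psi)] is a subsolution vanishing on the boundary. *)
Lemma one_sided rho psi M g eta1 :
  bmeas M rho -> bmeas M psi -> (forall u, g <= rho u -> psi u <= 0) -> 0 < eta1 ->
  (forall y t, 0 < t -> g <= E y t rho -> 0 < E y t psi -> g + eta1 <= E y t rho) ->
  forall y t, 0 < t -> g <= E y t rho -> E y t psi <= 0.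
Proof.
move=> rM pM rp eta10 gap y t t0 gt; rewrite leNgt; apply/negP => kap0.
have M0 := bmeas_ge0 rM.
pose G (r p : R) := if g <= r then Num.max p 0 else 0.
have G0 r p : 0 <= G r p by rewrite /G; case: ifP; rewrite // le_max lexx orbT.
(* Starting at time e makes the initial values uniformly continuous, as [sub_le] asks; e tends to 0
   at the end. *)
pose U e v s := G (E v (s + e) rho) (E v (s + e) psi).
have UM e v s : 0 < s + e -> `|U e v s| <= M.
  move=> se; rewrite ger0_norm; last exact: G0.
  rewrite /U /G; case: ifP => // _.
  rewrite ge_max M0 andbT; apply: le_trans (ler_norm _) _.
  exact: (kavg_bound gk _ se pM).
have mU : forall e, 0 < e -> bmeas M (fun v => U e v 0).
  move=> e e0; split; last by move=> v; apply: UM; rewrite add0r.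
  rewrite /U add0r; apply: measurable_fun_ifT => //.
    by apply: measurable_fun_ler => //; exact: (measurable_kavg gk e0 rM).1.
  by apply: measurable_maxr => //; exact: (measurable_kavg gk e0 pM).1.
have key e (e0 : 0 < e) v s : 0 < s -> U e v s <= E v s (fun v => U e v 0).
  move: v s; apply: (sub_le gk (M := M)).
  - by move=> v s s0; apply: UM; rewrite ltr_wpDl.
  - exact: (mU e e0).1.
  - move=> eta eta0; pose d := Num.min eta (eta1 / 2).
    have d0 : 0 < d by rewrite lt_min eta0 divr_gt0.
    have [r r0 Hr] := kavg_mod gk e0 (lexx e) (eta := d / (M + 1))
      ltac:(by rewrite divr_gt0//; lra).
    exists r => // v v' s /andP[s0 sr] vv.
    have dM h : bmeas M h -> `|E v' (s + e) h - E v e h| <= d.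
      move=> hM; have := Hr v v' e (s + e) h M.
      rewrite lexx addrK ger0_norm// => /(_ isT sr vv hM) /le_trans; apply.
      by rewrite mulrAC ler_pdivrMr; nra.
    have := dM _ rM; have := dM _ pM; rewrite /U add0r.
    have := gap v e e0; have := gap v' (s + e) (ltr_wpDl s0 e0).
    move: (E v' _ rho) (E v' _ psi) (E v _ rho) (E v _ psi) => r' p' r2 p2 g1 g2.
    have de : d <= eta by rewrite ge_min lexx.
    have de1 : d <= eta1 / 2 by rewrite ge_min lexx orbT.
    rewrite !ler_norml => /andP[h1 h2] /andP[h3 h4]; rewrite /G.
    (* The cut at g creates no jump: by the gap, a positive average of psi forces the average of rho
       up to g + eta1, and that average moves by at most eta1 / 2. *)
    case: (lerP g r') => gr'; case: (lerP g r2) => gr2.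
    + by case: (leP p' 0) => p'0; case: (leP p2 0) => p20; apply/andP; split; lra.
    + case: (leP p' 0) => p'0; first by apply/andP; split; lra.
      by have := g1 gr' p'0; lra.
    + case: (leP p2 0) => p20; first by apply/andP; split; lra.
      by have := g2 gr2 p20; lra.
    + by apply/andP; split; lra.
  - move=> eta e1 T0 eta0 e10 eT.
    have [||C [r [C0 r0 H]]] := kavg_mvp gk (e := e1 + e) (T0 := T0 + e); [lra|lra|].
    have [r' r'0 H'] := kavg_mod gk (e := e1 + e) (T0 := T0 + e) ltac:(lra) ltac:(lra)
      (eta := eta1 / (2 * (M + 1))) ltac:(by apply: divr_gt0 => //; apply: mulr_gt0 => //; lra).
    exists (C * M), (Num.min r (Num.min 1 r')); split; [exact: mulr_ge0|by rewrite !lt_min r0 r'0 ltr01|].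
    move=> h v s /andP[h0]; rewrite !lt_min => /and3P[hr h1 hr'] /andP[se sT] etaU.
    have Uge : eta <= U e v s.
      by apply: le_trans etaU _; rewrite gerBl; apply: (kavg_ge0 gk) => [|u]; [lra|exact: G0].
    have s0 : 0 < s + e by lra.
    have [gr p0] : g <= E v (s + e) rho /\ 0 < E v (s + e) psi.
      move: Uge; rewrite /U /G; case: ifP => [gr|_]; last by lra.
      by case: (leP (E v (s + e) psi) 0) => p0; [lra|].
    have US : U e v s = E v (s + e) psi by rewrite /U /G gr max_l// ltW.
    have gr1 := gap _ _ s0 gr p0.
    (* By the gap the whole stencil stays in the region where the average of rho is at least g.
       There U dominates the average of psi, with equality at the centre, so the mean value property
       of the latter makes U a subsolution. *)
    have nb j : E (yj v h j) (s + dj h j + e) psi <= U e (yj v h j) (s + dj h j).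
      have : `|E (yj v h j) (s + e + dj h j) rho - E v (s + e) rho| <= eta1 / 2.
        have dh := gk_dj gk j (h := h); rewrite h0 (ltW h1) in dh.
        have := H' v (yj v h j) (s + e) (s + e + dj h j) rho M.
        rewrite !lerD2r se sT addrAC subrr add0r => /(_ isT).
        move=> /(_ (le_lt_trans (dh isT) hr') (gk_yj gk _ _ _) rM) /le_trans; apply.
          by rewrite h0 hr'.
        rewrite mulrAC ler_pdivrMr; last by apply: mulr_gt0 => //; lra.
        by nra.
      rewrite ler_norml => /andP[h2 _]; rewrite /U /G addrAC in h2 *.
      rewrite (_ : g <= _); last by lra.
      by rewrite le_max lexx.
    have := H h v (s + e) psi M; rewrite !lerD2r h0 hr se sT => /(_ isT isT pM).
    rewrite ler_norml mulrAC => /andP[+ _] => /le_trans; apply.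
    apply: ler_sum => j _; rewrite US addrAC lerD2r; exact: nb.
(* If rho v >= g then psi v <= 0 and the first term suffices. Otherwise, where U is positive, the
   average of rho has crossed the gap, so it differs from rho v by at least eta1 and the second term
   is at least M. *)
have small e v : 0 < e -> U e v 0 <= `|E v e psi - psi v| + M / eta1 * `|E v e rho - rho v|.
  move=> e0; rewrite /U add0r /G.
  have Me : 0 <= M / eta1 by apply: divr_ge0 => //; exact: ltW.
  have R0 : 0 <= `|E v e psi - psi v| + M / eta1 * `|E v e rho - rho v|.
    by apply: addr_ge0 => //; exact: mulr_ge0.
  case: ifP => // gr; case: (leP (E v e psi) 0) => // p0.
  have [gv|gv] := leP g (rho v).
    have := rp v gv; have := ler_norm (E v e psi - psi v).
    have : 0 <= M / eta1 * `|E v e rho - rho v| by exact: mulr_ge0.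
    lra.
  have := gap v e e0 gr p0 => H.
  have : M <= M / eta1 * `|E v e rho - rho v|.
    rewrite mulrAC ler_pdivlMr//; apply: ler_wpM2l => //.
    by apply: le_trans (ler_norm _); lra.
  have := kavg_bound gk v e0 pM; have := ler_norm (E v e psi).
  have := normr_ge0 (E v e psi - psi v); lra.
have gap0 := gap y t t0 gt kap0.
have ap := approximable_bmeas pM y t0.
have ar := approximable_bmeas rM y t0.
set kap := E y t psi in kap0.
have Me1 : 0 < M / eta1 + 1 by apply: ltr_pwDr => //; apply: divr_ge0 => //; exact: ltW.
have /cvgrPdist_le/(_ (kap / 8) ltac:(by rewrite divr_gt0)) ap1 := ap.
have /cvgrPdist_le/(_ (kap / (8 * (M / eta1 + 1))) ltac:(by apply: divr_gt0 => //; apply: mulr_gt0)) ar1 := ar.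
pose d := Num.min (kap / 2) eta1.
have d0 : 0 < d by rewrite lt_min divr_gt0.
have [r r0 Hr] := kavg_mod gk t0 (lexx t) (eta := d / (M + 1)) ltac:(by rewrite divr_gt0//; lra).
have emr := near_em r0.
(* For small e = [em m], U is at least kap / 2 at (y,t), while the average of its initial values,
   controlled by [small], is at most kap / 4. *)
near \oo => m.
have emr' : em m < r by near: m.
have dM h : bmeas M h -> `|E y (t + em m) h - E y t h| <= d.
  move=> hM; have := Hr y y t (t + em m) h M.
  rewrite lexx addrAC subrr add0r (ger0_norm (ltW (em0 m))).
  move=> /(_ isT emr' (near_pt_refl _ r0) hM) /le_trans; apply.
  by rewrite mulrAC ler_pdivrMr; nra.
have := dM _ rM; rewrite ler_norml => /andP[dr _].
have := dM _ pM; rewrite ler_norml => /andP[dp _].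
have dk : d <= kap / 2 by rewrite ge_min lexx.
have de : d <= eta1 by rewrite ge_min lexx orbT.
have : kap / 2 <= U (em m) y t.
  rewrite /U /G (_ : g <= _); last by lra.
  by rewrite le_max; apply/orP; left; rewrite -/kap in dp; lra.
have b1 := bmeas_norm (bE m pM); have b2 := bmeas_norm (bE m rM).
have b3 := bmeasZ (M / eta1) b2.
have : U (em m) y t <= E y t (fun v => `|E v (em m) psi - psi v| +
    M / eta1 * `|E v (em m) rho - rho v|).
  apply: le_trans (key _ (em0 m) y t t0) _.
  apply: (le_kavg gk _ t0 (mU _ (em0 m)) (bmeasD b1 b3)) => v.
  exact: small.
rewrite (kavgD gk _ t0 b1 b3) (kavgZ gk _ _ t0 b2).
have : `|0 - E y t (fun v => `|E v (em m) psi - psi v|)| <= kap / 8 by near: m.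
rewrite sub0r normrN => /(le_trans (ler_norm _)) H1.
have : `|0 - E y t (fun v => `|E v (em m) rho - rho v|)| <= kap / (8 * (M / eta1 + 1)).
  by near: m.
rewrite sub0r normrN => /(le_trans (ler_norm _)).
rewrite ler_pdivlMr; last exact: mulr_gt0.
have : 0 <= E y t (fun v => `|E v (em m) rho - rho v|) by apply: (kavg_ge0 gk).
by lra.
Unshelve. all: by end_near. Qed.

End approximate_identity.

(** * Taylor bounds with explicit remainders *)

Section calculus.
Context (R : realType).
Implicit Types (x y z B c : R).

(** Each Taylor remainder vanishes at 0 and has a multiple of a remainder of lower order as
    derivative, so this bound raises the order by one each time. *)
Lemma mvt_bound (g g' : R -> R) x B : g 0 = 0 ->
  (forall y, `|y| <= `|x| -> is_derive y 1 g (g' y)) ->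
  (forall y, `|y| <= `|x| -> `|g' y| <= B) -> `|g x| <= B * `|x|.
Proof.
move=> g0 dg gB.
have cg (a b : R) : (forall y, y \in `[a, b] -> `|y| <= `|x|) -> {within `[a, b], continuous g}.
  move=> H; apply: derivable_within_continuous => y yab.
  by have [] := dg y (H y yab).
have [x0|x0] := leP 0 x.
  have H y : y \in `[0, x] -> `|y| <= `|x|.
    by rewrite in_itv/= => /andP[y0 yx]; rewrite !ger0_norm.
  have [|c cx] := MVT_segment x0 _ (cg _ _ H) (df := g').
    move=> y yx; apply/dg/H; exact: subset_itv_oo_cc yx.
  by rewrite g0 !subr0 => ->; rewrite normrM; apply: ler_wpM2r => //; exact/gB/H.
have H y : y \in `[x, 0] -> `|y| <= `|x|.
  by rewrite in_itv/= => /andP[xy y0]; rewrite !ler0_norm ?lerN2// ltW.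
have [|c cx] := MVT_segment (ltW x0) _ (cg _ _ H) (df := g').
  move=> y yx; apply/dg/H; exact: subset_itv_oo_cc yx.
rewrite g0 !sub0r => /eqP; rewrite eqr_oppLR => /eqP ->; rewrite normrN normrM normrN.
by apply: ler_wpM2r => //; exact/gB/H.
Qed.

Lemma is_derive_sqr (c y : R) : is_derive y 1 (fun x => c * x ^+ 2) (c * (2 * y)).
Proof.
apply: (@is_derive_eq _ _ _ (c \*: ((@id R) ^+ 2))).
by rewrite /GRing.scale/= mulr1 expr1.
Qed.

Lemma expR_taylor0 x : `|expR x - 1| <= expR `|x| * `|x|.
Proof.
apply: (@mvt_bound (fun x => expR x - 1) expR) => [|y _|y yx].
- by rewrite expR0 subrr.
- by rewrite -[X in is_derive _ _ _ X]subr0; apply: is_deriveB.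
- by rewrite ger0_norm ?expR_ge0// ler_expR (le_trans (ler_norm _)).
Qed.

Lemma expR_taylor1 x : `|expR x - 1 - x| <= expR `|x| * `|x| ^+ 2.
Proof.
rewrite expr2 mulrA.
apply: (@mvt_bound (fun x => expR x - 1 - x) (fun x => expR x - 1)) => [|y _|y yx].
- by rewrite expR0 !subrr.
- by apply: is_deriveB; rewrite -[X in is_derive _ _ _ X]subr0; apply: is_deriveB.
- apply: le_trans (expR_taylor0 y) _.
  by apply: ler_pM => //; rewrite ?expR_ge0// ler_expR.
Qed.

Lemma expR_taylor2 x : `|expR x - 1 - x - x ^+ 2 / 2| <= expR `|x| * `|x| ^+ 3.
Proof.
rewrite [`|x| ^+ 3]exprSr [leRHS]mulrA.
apply: (@mvt_bound (fun x => expR x - 1 - x - x ^+ 2 / 2) (fun x => expR x - 1 - x)) => [|y _|y yx].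
- by rewrite expR0 expr0n/= mul0r !subrr.
- apply: is_deriveB; last first.
    rewrite (_ : (fun x => _) = fun x => 2^-1 * x ^+ 2); last by apply/funext => z; rewrite mulrC.
    by apply: is_derive_eq (is_derive_sqr _ _) _; field.
  by apply: is_deriveB; rewrite -[X in is_derive _ _ _ X]subr0; apply: is_deriveB.
- apply: le_trans (expR_taylor1 y) _; apply: ler_pM => //; rewrite ?expR_ge0 ?ler_expR//.
  by apply: lerXn2r; rewrite ?nnegrE.
Qed.

Let is_derive_powR1 a x : `|x| <= 2^-1 ->
  is_derive x 1 (fun x => (1 + x) `^ a) (a * (1 + x) `^ (a - 1)).
Proof.
rewrite ler_norml => /andP[x1 x2].
have x0 : 0 < 1 + x by lra.
have d1 : is_derive x 1 (fun x => 1 + x) 1.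
  by rewrite -[X in is_derive _ _ _ X]add0r; apply: is_deriveD.
have := @is_derive1_comp R (fun z => z `^ a) (fun x => 1 + x) x _ _ (is_derive1_powR a x0) d1.
by rewrite mulr1.
Qed.

(** The factor 2^(a + 1) bounds (1 + y)^(-a - 1), because 1 + y >= 1/2. *)
Lemma powR_taylor0 a x : 0 <= a -> `|x| <= 2^-1 ->
  `|(1 + x) `^ (- a) - 1| <= a * 2 `^ (a + 1) * `|x|.
Proof.
move=> a0 x2.
apply: (@mvt_bound (fun x => (1 + x) `^ (- a) - 1) (fun x => - a * (1 + x) `^ (- a - 1))) => [|y yx|y yx].
- by rewrite addr0 powR1 subrr.
- rewrite -[X in is_derive _ _ _ X]subr0; apply: is_deriveB.
  by apply: is_derive_powR1; exact: le_trans yx x2.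
- rewrite normrM normrN (ger0_norm a0); apply: ler_wpM2l => //.
  rewrite ger0_norm ?powR_ge0// -opprD -[- (a + 1)]mulN1r powRrM.
  have {yx x2} : `|y| <= 2^-1 by exact: le_trans yx x2.
  rewrite ler_norml => /andP[y1 y2].
  have y0 : 0 < 1 + y by lra.
  rewrite powR_inv1 ?(ltW y0)//; apply: ge0_ler_powR; rewrite ?nnegrE ?invr_ge0 ?(ltW y0) ?addr_ge0//.
  by rewrite invf_ple ?posrE//; lra.
Qed.

Lemma powR_taylor1 a x : 0 <= a -> `|x| <= 2^-1 ->
  `|(1 + x) `^ (- a) - 1 + a * x| <= a * (a + 1) * 2 `^ (a + 2) * `|x| ^+ 2.
Proof.
move=> a0 x2; rewrite expr2 mulrA.
apply: (@mvt_bound (fun x => (1 + x) `^ (- a) - 1 + a * x)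
  (fun x => - a * ((1 + x) `^ (- (a + 1)) - 1))) => [|y yx|y yx].
- by rewrite addr0 powR1 subrr mulr0 addr0.
- rewrite (_ : - a * _ = - a * (1 + y) `^ (- a - 1) - 0 + a * 1); last by rewrite opprD; ring.
  apply: is_deriveD.
  by apply: is_deriveB; apply: is_derive_powR1; exact: le_trans yx x2.
- rewrite normrM normrN (ger0_norm a0) -!mulrA; apply: ler_wpM2l => //.
  apply: le_trans (powR_taylor0 _ (le_trans yx x2)) _; first by rewrite addr_ge0.
  rewrite -mulrA; apply: ler_wpM2l; first by rewrite addr_ge0.
  have -> : a + 1 + 1 = a + 2 by ring.
  by apply: ler_wpM2l => //; exact: powR_ge0.
Qed.

Lemma powR_taylor2 a x : 0 <= a -> `|x| <= 2^-1 ->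
  `|(1 + x) `^ (- a) - 1 + a * x - a * (a + 1) / 2 * x ^+ 2|
    <= a * (a + 1) * (a + 2) * 2 `^ (a + 3) * `|x| ^+ 3.
Proof.
move=> a0 x2; rewrite [`|x| ^+ 3]exprSr [leRHS]mulrA.
apply: (@mvt_bound (fun x => (1 + x) `^ (- a) - 1 + a * x - a * (a + 1) / 2 * x ^+ 2)
  (fun x => - a * ((1 + x) `^ (- (a + 1)) - 1 + (a + 1) * x))) => [|y yx|y yx].
- by rewrite addr0 powR1 subrr mulr0 addr0 expr0n/= mulr0 subrr.
- rewrite (_ : - a * _ = - a * (1 + y) `^ (- a - 1) - 0 + a * 1 - a * (a + 1) / 2 * (y *+ 2)); last first.
    by rewrite opprD; field.
  apply: is_deriveB; last first.
    by apply: is_derive_eq (is_derive_sqr _ _) _; rewrite mulr_natl.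
  apply: is_deriveD.
  by apply: is_deriveB; apply: is_derive_powR1; exact: le_trans yx x2.
- rewrite normrM normrN (ger0_norm a0) -!mulrA; apply: ler_wpM2l => //.
  apply: le_trans (powR_taylor1 _ (le_trans yx x2)) _; first by rewrite addr_ge0.
  have -> : a + 1 + 1 = a + 2 by ring.
  have -> : a + 1 + 2 = a + 3 by ring.
  rewrite -!mulrA; apply: ler_wpM2l; first by rewrite addr_ge0.
  apply: ler_wpM2l; first by rewrite addr_ge0.
  by apply: ler_wpM2l; [exact: powR_ge0|apply: lerXn2r; rewrite ?nnegrE].
Qed.

Lemma ln_bound z : `|z| <= 2^-1 -> `|ln (1 + z)| <= 2 * `|z|.
Proof.
rewrite ler_norml => /andP[z1 z2]; have z0 : 0 < 1 + z by lra.
have l1 : ln (1 + z) <= z by apply: le_ln1Dx; lra.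
have l2 : - ln (1 + z) <= - z / (1 + z).
  rewrite -lnV ?posrE// [X in ln X](_ : _ = 1 + - z / (1 + z)); last by field; rewrite gt_eqF.
  apply: le_ln1Dx; rewrite ltr_pdivlMr//; lra.
rewrite ler_norml; apply/andP; split; last by apply: le_trans l1 _; have := ler_norm z; have := normr_ge0 z; lra.
rewrite lerNl; apply: le_trans l2 _; rewrite ler_pdivrMr//.
by have [h|h] := leP 0 z; [rewrite ger0_norm//|rewrite ltr0_norm//]; nra.
Qed.

Lemma ln1B_bound z : 0 <= z <= 2^-1 -> `|- ln (1 - z) - z| <= 2 * z ^+ 2.
Proof.
move=> /andP[z0 z2]; have z1 : 0 < 1 - z by lra.
have l1 : ln (1 - z) <= - z by apply: le_ln1Dx; lra.
have l2 : - ln (1 - z) <= z / (1 - z).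
  rewrite -lnV ?posrE// [X in ln X](_ : _ = 1 + z / (1 - z)); last by field; rewrite gt_eqF.
  by apply: le_ln1Dx; apply: lt_le_trans (_ : 0 <= _) => //; apply: divr_ge0 => //; exact: ltW.
rewrite ger0_norm; last by lra.
rewrite lerBlDr; apply: le_trans l2 _; rewrite ler_pdivrMr//; nra.
Qed.

Lemma expR_dominates_exprn m c : 0 < c -> exists2 C : R, 0 <= C &
  forall x, 0 <= x -> x ^+ m <= C * expR (c * x).
Proof.
move=> c0; case: m => [|m].
  by exists 1 => // x x0; rewrite expr0 mul1r -[leLHS]expR0 ler_expR mulr_ge0// ltW.
exists ((m.+1)`!%:R / c ^+ m.+1); first by apply: divr_ge0; rewrite ?ler0n// exprn_ge0 ?ltW.
move=> x x0; have := expR_ge1Dxn m (mulr_ge0 (ltW c0) x0).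
have cm : 0 < c ^+ m.+1 by exact: exprn_gt0.
rewrite -mulrA mulrCA ler_pdivlMl// => H.
have f0 : 0 < (m.+1)`!%:R :> R by rewrite ltr0n fact_gt0.
rewrite -exprMn -ler_pdivrMl// mulrC.
by apply: le_trans H; rewrite lerDr.
Qed.

End calculus.

(** * The finite-difference stencils and their barriers *)

Section moves.
Context (R : realType) (n : nat).
Local Notation T := (n.-tuple R).
Implicit Types (y u : T).

Definition shift y (i : 'I_n) (s : R) : T :=
  [tuple if j == i then tnth y j + s else tnth y j | j < n].

Definition axis_move (L : finType) y (h : R) (j : 'I_n * bool + L) : T :=
  match j with
  | inl ib => shift y ib.1 (if ib.2 then h else - h)
  | inr _ => y
  end.

(** With the axis moves this is the stencil of the Laplacian in the n + 1 variables (y,t). *)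
Definition poisson_step (h : R) (j : 'I_n * bool + bool) : R :=
  match j with inl _ => 0 | inr b => if b then h else - h end.

(** Parabolic scaling: with the axis moves of size h, one backward time step h^2 gives h^2 times
    (Laplacian minus time derivative) to leading order. *)
Definition heat_step (h : R) (j : 'I_n * bool + unit) : R :=
  match j with inl _ => 0 | inr _ => - h ^+ 2 end.

Lemma sum_moves (L : finType) (F : 'I_n * bool + L -> R) :
  \sum_j F j = \sum_i (F (inl (i, true)) + F (inl (i, false))) + \sum_l F (inr l).
Proof.
rewrite big_sumType/=; congr (_ + _).
transitivity (\sum_i \sum_(b : bool) F (inl (i, b))).
  by rewrite pair_big/=; apply: eq_bigr => -[].
by apply: eq_bigr => i _; rewrite big_bool.
Qed.

Lemma tnth_tsub y u i : tnth (tsub y u) i = tnth y i - tnth u i.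
Proof. by rewrite tnth_mktuple. Qed.

Lemma tnth_shift y i s j : tnth (shift y i s) j = if j == i then tnth y j + s else tnth y j.
Proof. by rewrite tnth_mktuple. Qed.

Lemma sqnorm_ge0 y : 0 <= sqnorm y.
Proof. by apply: sumr_ge0 => i _; exact: sqr_ge0. Qed.

Lemma sqr_tnth_le y i : tnth y i ^+ 2 <= sqnorm y.
Proof. by rewrite /sqnorm (bigD1 i)//= lerDl sumr_ge0// => j _; exact: sqr_ge0. Qed.

Lemma sqnorm_shift y u i s :
  sqnorm (tsub (shift y i s) u) =
  sqnorm (tsub y u) + (2 * s * tnth (tsub y u) i + s ^+ 2).
Proof.
rewrite /sqnorm (bigD1 i)//= [in RHS](bigD1 i)//= !tnth_tsub tnth_shift eqxx.
rewrite (eq_bigr (fun j => tnth (tsub y u) j ^+ 2)).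
  by ring.
by move=> j ji; rewrite !tnth_tsub tnth_shift (negbTE ji).
Qed.

Lemma sqnorm_far eta y u : 0 < eta -> ~ near_pt eta y u -> eta ^+ 2 <= sqnorm (tsub y u).
Proof.
move=> eta0 /existsNP[i /negP]; rewrite -leNgt => H.
apply: le_trans (sqr_tnth_le _ i); rewrite tnth_tsub -[leRHS]real_normK ?num_real//.
by apply: lerXn2r; rewrite ?nnegrE ?(ltW eta0).
Qed.

Lemma sqnorm_near r y y' u : r <= 1 -> near_pt r y y' ->
  `|sqnorm (tsub y' u) - sqnorm (tsub y u)| <= n%:R * (2 * r * (1 + sqnorm (tsub y u))).
Proof.
move=> r1 yy; rewrite /sqnorm -sumrB.
apply: le_trans (ler_norm_sum _ _ _) _.
rewrite -[n in n%:R]card_ord -sum1_card natr_sum mulr_suml.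
apply: ler_sum => i _; rewrite mul1r.
have := sqr_tnth_le (tsub y u) i; rewrite -/(sqnorm (tsub y u)) !tnth_tsub.
move: (sqnorm _) (yy i) => q; rewrite distrC.
set x := tnth y i - tnth u i; set v := tnth y' i - tnth y i => vr xq.
have -> : tnth y' i - tnth u i = x + v by rewrite /x /v; ring.
have -> : (x + v) ^+ 2 - x ^+ 2 = 2 * x * v + v ^+ 2 by ring.
have r0 : 0 <= r by exact: le_trans (normr_ge0 v) (ltW vr).
have v2 : `|v ^+ 2| <= r.
  rewrite normrX; apply: le_trans (_ : r ^+ 2 <= _).
    by apply: lerXn2r; rewrite ?nnegrE// ltW.
  by rewrite expr2; nra.
have xv : `|2 * x * v| <= r * (1 + x ^+ 2).
  rewrite normrM mulrC; apply: ler_pM => //; first exact: ltW.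
  rewrite ler_norml; apply/andP; split.
    by have := sqr_ge0 (x + 1); rewrite sqrrD1; lra.
  by have := sqr_ge0 (x - 1); rewrite sqrrB1; lra.
apply: le_trans (ler_normD _ _) _.
have : r * x ^+ 2 <= r * q by exact: ler_wpM2l.
by have := mulr_ge0 r0 (sqr_ge0 x); lra.
Qed.

Lemma near_axis_move (L : finType) h r y (j : 'I_n * bool + L) :
  0 < h < r -> near_pt r y (axis_move y h j).
Proof.
move=> /andP[h0 hr]; have r0 : 0 < r by exact: lt_trans hr.
case: j => [[i b]|l] k /=; last by rewrite subrr normr0.
rewrite tnth_shift; case: ifP => _; last by rewrite subrr normr0.
by rewrite opprD addNKr normrN; case: b; rewrite ?normrN gtr0_norm.
Qed.

Lemma measurable_sqnorm_tsub :
  measurable_fun [set: (T * T)%type] (fun yu => sqnorm (tsub yu.1 yu.2)).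
Proof.
rewrite /sqnorm; apply: measurable_fun_sumr => i.
under eq_fun do rewrite tnth_tsub.
apply: measurable_funX; apply: measurable_funB.
  exact: (measurableT_comp (measurable_tnth i) measurable_fst).
exact: (measurableT_comp (measurable_tnth i) measurable_snd).
Qed.

Lemma poisson_step_barrier T0 : 0 < T0 -> exists2 c, 0 < c & forall h t,
    0 < h <= 1 -> 0 < t <= T0 ->
    \sum_j ((t + poisson_step h j) * (3 * T0 - (t + poisson_step h j)) - t * (3 * T0 - t))
      <= - (c * h ^+ 2).
Proof.
move=> T00; exists 2 => // h t _ _; rewrite sum_moves big_bool/=.
rewrite big1 => [|i _]; last by ring.
by rewrite le_eqVlt; apply/orP; left; apply/eqP; ring.
Qed.

(** With s = h^2 the backward step changes t (3 T0 - t) by -s (3 T0 - 2 t) - s^2, which is at most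
    -T0 s. *)
Lemma heat_step_barrier T0 : 0 < T0 -> exists2 c, 0 < c & forall h t,
    0 < h <= 1 -> 0 < t <= T0 ->
    \sum_j ((t + heat_step h j) * (3 * T0 - (t + heat_step h j)) - t * (3 * T0 - t))
      <= - (c * h ^+ 2).
Proof.
move=> T00; exists T0 => // h t _ /andP[t0 tT]; rewrite sum_moves.
rewrite big1 => [|i _]; last by rewrite /=; ring.
rewrite (big_pred1 tt) => [/=|[]//].
have := sqr_ge0 h; have := sqr_ge0 (h ^+ 2).
move: (h ^+ 2) => s s2 s0; nra.
Qed.

End moves.

(** * The Poisson kernel satisfies the kernel axioms *)

Section poisson.
Context (R : realType) (n : nat).
Local Notation T := (n.-tuple R).
Local Notation a := (n.+1%:R / 2 : R).
Local Notation J := ('I_n * bool + bool)%type.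
Local Notation P t q := (t / (t ^+ 2 + q) `^ a : R).

Let a0 : 0 < a. Proof. by rewrite divr_gt0// ltr0n. Qed.

Let P_gt0 t q : 0 < t -> 0 <= q -> 0 < P t q.
Proof.
move=> t0 q0; apply: divr_gt0 => //; apply: powR_gt0.
by rewrite ltr_pwDl// exprn_gt0.
Qed.

Lemma poisson_le t s q : 0 < t -> t <= s -> 0 <= q ->
  P t q <= ((s / t) ^+ 2) `^ a * P s q.
Proof.
move=> t0 ts q0; have s0 : 0 < s by exact: lt_le_trans ts.
have A0 : 0 < t ^+ 2 + q by rewrite ltr_pwDl// exprn_gt0.
have B0 : 0 < s ^+ 2 + q by rewrite ltr_pwDl// exprn_gt0.
rewrite mulrA ler_pdivlMr ?powR_gt0// mulrAC ler_pdivrMr ?powR_gt0//.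
rewrite [leRHS]mulrAC -powRM ?sqr_ge0 ?(ltW A0)// [leLHS]mulrC.
apply: ler_pM => //; [exact: powR_ge0|exact: ltW|].
apply: ge0_ler_powR; rewrite ?nnegrE ?(ltW a0) ?(ltW B0)//.
  by apply: mulr_ge0; [exact: sqr_ge0|exact: ltW].
have st : 1 <= (s / t) ^+ 2 by apply: exprn_ege1; rewrite ler_pdivlMr ?mul1r.
rewrite mulrDr -exprMn divfK ?gt_eqF// lerD2l.
by apply: ler_peMl.
Qed.

(** In terms of the relative increments of t and of t^2 + q, all errors become relative to the
    kernel itself, hence integrable. *)
Lemma poisson_ratio t q t' q' : 0 < t -> 0 <= q -> 0 < t' -> 0 <= q' ->
  P t' q' = P t q * ((1 + (t' - t) / t) *
    (1 + (t' ^+ 2 + q' - (t ^+ 2 + q)) / (t ^+ 2 + q)) `^ (- a)).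
Proof.
move=> t0 q0 t'0 q'0.
have A0 : 0 < t ^+ 2 + q by rewrite ltr_pwDl// exprn_gt0.
have B0 : 0 < t' ^+ 2 + q' by rewrite ltr_pwDl// exprn_gt0.
have -> : 1 + (t' ^+ 2 + q' - (t ^+ 2 + q)) / (t ^+ 2 + q) = (t' ^+ 2 + q') / (t ^+ 2 + q).
  by field; rewrite gt_eqF.
have D0 : 0 < (t' ^+ 2 + q') / (t ^+ 2 + q) by exact: divr_gt0.
have BE : t' ^+ 2 + q' = (t' ^+ 2 + q') / (t ^+ 2 + q) * (t ^+ 2 + q).
  by rewrite divfK// gt_eqF.
set D := (X in (X `^ (- a))) in D0 BE *.
rewrite BE powRM ?(ltW A0) ?(ltW D0)// powRN.
have := powR_gt0 a A0; have := powR_gt0 a D0.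
move: (D `^ a) ((t ^+ 2 + q) `^ a) => D' A D1 A1; field.
by rewrite !gt_eqF.
Qed.

Let step_bound (e A v s h : R) : 0 < e -> e ^+ 2 <= A -> v ^+ 2 <= A -> `|s| = h -> h <= e ->
  `|(2 * s * v + s ^+ 2) / A| <= 3 * h / e.
Proof.
move=> e0 eA vA sh he; have A0 : 0 < A by apply: lt_le_trans eA; exact: exprn_gt0.
have h0 : 0 <= h by rewrite -sh.
rewrite normrM normfV (gtr0_norm A0) ler_pdivrMr// [leRHS]mulrAC ler_pdivlMr//.
apply: le_trans (_ : (2 * h * `|v| + h ^+ 2) * e <= _).
  apply: ler_wpM2r; first exact: ltW.
  apply: le_trans (ler_normD _ _) _.
  by rewrite normrX !normrM sh ger0_norm.
have ev : e * `|v| <= A.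
  have := sqr_ge0 (e - `|v|); rewrite sqrrB real_normK ?num_real//; lra.
have : h * h * e <= h * e * e by rewrite -mulrA -[leRHS]mulrA ler_wpM2l// ler_wpM2r// ltW.
have : h * e * e <= h * A by rewrite -mulrA ler_wpM2l// -expr2.
have : h * (e * `|v|) <= h * A by exact: ler_wpM2l.
by rewrite expr2; lra.
Qed.

(** Expand (1 + z)^(-a) to second order in the relative increment z. The h^2 terms add up to a
    multiple of 2 a - (n + 1), which is 0: the kernel is harmonic. There remain b (2 n + 10) h^4 /
    A^2 and 2 n + 2 Taylor remainders of order h^3. *)
Lemma poisson_mvp (e : R) : 0 < e -> exists C r, [/\ 0 <= C, 0 < r &
  forall h t (y u : T), 0 < h < r -> e <= t ->
  `|\sum_j (P (t + poisson_step h j) (sqnorm (tsub (axis_move y h j) u))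
            - P t (sqnorm (tsub y u)))| <= C * h ^+ 3 * P t (sqnorm (tsub y u))].
Proof.
move=> e0; pose b := a * (a + 1) / 2.
have b0 : 0 <= b by apply: divr_ge0 => //; apply: mulr_ge0; rewrite ?addr_ge0 ?ltW.
pose C3 := a * (a + 1) * (a + 2) * 2 `^ (a + 3).
have C30 : 0 <= C3.
  by rewrite /C3; do ?[apply: mulr_ge0]; rewrite ?powR_ge0 ?addr_ge0 ?ltW.
have e3 : 0 <= (3 / e) ^+ 3 by apply: exprn_ge0; apply: divr_ge0 => //; exact: ltW.
exists (b * (2 * n%:R + 10) / e ^+ 4 + (2 * n%:R + 2) * (2 * (C3 * (3 / e) ^+ 3))).
(* Below e / 6 the bound |z| <= 3 h / e stays under 1/2, the range of the Taylor estimates. *)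
exists (Num.min 1 (e / 6)); split.
- apply: addr_ge0; first by apply: divr_ge0; [apply: mulr_ge0 => //; rewrite addr_ge0// mulr_ge0|exact: exprn_ge0 (ltW e0)].
  apply: mulr_ge0; first by rewrite addr_ge0// mulr_ge0.
  by apply: mulr_ge0 => //; exact: mulr_ge0.
- by rewrite lt_min ltr01 divr_gt0.
move=> h t y u /andP[h0]; rewrite lt_min => /andP[h1 he] et.
have t0 : 0 < t by exact: lt_le_trans et.
set q := sqnorm (tsub y u); set A := t ^+ 2 + q.
have q0 : 0 <= q by exact: sqnorm_ge0.
have et2 : e ^+ 2 <= t ^+ 2 by apply: lerXn2r; rewrite ?nnegrE ?(ltW e0) ?(ltW t0).
have eA : e ^+ 2 <= A by rewrite /A; lra.
have A0 : 0 < A by apply: lt_le_trans eA; exact: exprn_gt0.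
pose d (j : J) := poisson_step h j / t.
pose qj (j : J) := sqnorm (tsub (axis_move y h j) u) : R.
pose z (j : J) := ((t + poisson_step h j) ^+ 2 + qj j - A) / A.
have zi i c : z (inl (i, c)) = (2 * (if c then h else - h) * tnth (tsub y u) i + (if c then h else - h) ^+ 2) / A.
  rewrite /z /qj/= sqnorm_shift /A /q; congr (_ / _).
  by move: (if c then h else - h) => s; ring.
have zt c : z (inr c) = (2 * (if c then h else - h) * t + (if c then h else - h) ^+ 2) / A.
  rewrite /z /qj/= /A /q; congr (_ / _).
  by move: (if c then h else - h) => s; ring.
have hn (c : bool) : `|if c then h else - h| = h by case: c; rewrite ?normrN gtr0_norm.
have zb j : `|z j| <= 3 * h / e.
  case: j => [[i c]|c]; [rewrite zi|rewrite zt]; apply: step_bound => //; try lra.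
    by apply: le_trans (sqr_tnth_le _ i) _; rewrite /A -/q; have := sqr_ge0 t; lra.
  by rewrite /A; lra.
have zb2 j : `|z j| <= 2^-1.
  apply: le_trans (zb j) _; rewrite ler_pdivrMr//; lra.
pose r (j : J) := (1 + z j) `^ (- a) - 1 + a * z j - b * z j ^+ 2.
have rb j : `|r j| <= C3 * (3 / e) ^+ 3 * h ^+ 3.
  apply: le_trans (powR_taylor2 (ltW a0) (zb2 j)) _.
  rewrite -/C3 -[leRHS]mulrA -exprMn; apply: ler_wpM2l => //.
  apply: lerXn2r; rewrite ?nnegrE//; last by rewrite mulrAC.
  by apply: mulr_ge0; [apply: divr_ge0 => //|]; exact: ltW.
have dj0 (j : J) : `|poisson_step h j| <= h.
  by case: j => [ic|c] /=; rewrite ?normr0 ?hn// ltW.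
have db j : `|1 + d j| <= 2.
  apply: le_trans (ler_normD _ _) _; rewrite normr1 /d normrM normfV (gtr0_norm t0).
  have : `|poisson_step h j| / t <= 1 by rewrite ler_pdivrMr// mul1r; have := dj0 j; lra.
  lra.
pose main (j : J) := (1 + d j) * (1 - a * z j + b * z j ^+ 2) - 1.
have E j : P (t + poisson_step h j) (qj j) - P t q = P t q * (main j + (1 + d j) * r j).
  rewrite (poisson_ratio (t' := t + poisson_step h j) (q' := qj j) t0 q0); [|have := dj0 j; rewrite ler_norml => /andP[]; lra|exact: sqnorm_ge0].
  by rewrite -/A -/(z j) [t + _ - t]addrAC subrr add0r -/(d j) /main /r; ring.
under eq_bigr do rewrite E.
rewrite -mulr_sumr normrM (gtr0_norm (P_gt0 t0 q0)) mulrC.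
apply: ler_wpM2r; first exact/ltW/P_gt0.
rewrite big_split/=; apply: le_trans (ler_normD _ _) _.
rewrite mulrDl; apply: lerD.
  (* The cancellation of the h^2 terms; it uses a = (n + 1) / 2 and A = t^2 + q. *)
  have -> : \sum_j main j = b * (2 * n%:R + 10) * h ^+ 4 / A ^+ 2.
    rewrite sum_moves big_bool/=.
    have -> : \sum_i (main (inl (i, true)) + main (inl (i, false))) =
        n%:R * (- 2 * a * h ^+ 2 / A + 2 * b * h ^+ 4 / A ^+ 2) + 8 * b * h ^+ 2 / A ^+ 2 * q.
      rewrite /q [in RHS]/sqnorm [in RHS]mulr_sumr -[X in X%:R * _](card_ord n) -sum1_card natr_sum mulr_suml.
      rewrite -big_split/=; apply: eq_bigr => i _.
      rewrite /main !zi /d/= mul0r; field; rewrite ?gt_eqF//.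
    rewrite /main !zt /d/=; move: (q0) A0; rewrite /A => _ A0.
    rewrite /b -[n.+1%:R]natr1.
    by field; rewrite !gt_eqF//.
  have bn : 0 <= b * (2 * n%:R + 10) by apply: mulr_ge0 => //; rewrite addr_ge0// mulr_ge0.
  rewrite ger0_norm; last first.
    by apply: divr_ge0; [apply: mulr_ge0 => //; exact: exprn_ge0 (ltW h0)|exact: sqr_ge0].
  move: bn; move: (b * _) => cb cb0.
  rewrite -[leLHS]mulrA -[leRHS]mulrA; apply: ler_wpM2l => //.
  rewrite [leLHS]mulrC; apply: ler_pM.
  + by rewrite invr_ge0 sqr_ge0.
  + exact: exprn_ge0 (ltW h0).
  + rewrite lef_pV2 ?posrE ?exprn_gt0// (exprM e 2 2).
    by apply: lerXn2r; rewrite ?nnegrE ?sqr_ge0// ltW.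
  + by rewrite exprSr; apply: ler_piMr; [exact: exprn_ge0 (ltW h0)|exact: ltW].
apply: le_trans (ler_norm_sum _ _ _) _.
apply: le_trans (_ : \sum_(j : J) 2 * (C3 * (3 / e) ^+ 3 * h ^+ 3) <= _).
  by apply: ler_sum => j _; rewrite normrM; apply: ler_pM.
rewrite sumr_const card_sum card_prod card_ord card_bool -[leLHS]mulr_natl natrD natrM.
by rewrite le_eqVlt; apply/orP; left; apply/eqP; ring.
Qed.

Lemma poisson_le_bnd (e T0 t q : R) : 0 < e -> e <= t -> t <= T0 -> 0 <= q ->
  P t q <= ((T0 / e) ^+ 2) `^ a * P T0 q.
Proof.
move=> e0 et tT q0; have t0 : 0 < t by exact: lt_le_trans et.
have T00 : 0 < T0 by exact: lt_le_trans tT.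
apply: le_trans (poisson_le t0 tT q0) _.
apply: ler_wpM2r; first exact/ltW/P_gt0.
apply: ge0_ler_powR; rewrite ?nnegrE ?sqr_ge0// ?(ltW a0)//.
apply: lerXn2r; rewrite ?nnegrE; try by apply: divr_ge0; exact: ltW.
by apply: ler_wpM2l; [exact: ltW|rewrite lef_pV2].
Qed.

Lemma poisson_mod (e T0 eta : R) : 0 < e -> e <= T0 -> 0 < eta ->
  exists2 r, 0 < r & forall (y y' u : T) t t', e <= t <= T0 -> `|t' - t| < r ->
  near_pt r y y' -> `|P t' (sqnorm (tsub y' u)) - P t (sqnorm (tsub y u))|
    <= eta * P T0 (sqnorm (tsub y u)).
Proof.
move=> e0 eT eta0; have T00 : 0 < T0 by exact: lt_le_trans eT.
(* Within distance r, r Z bounds the relative change of t^2 + |y - u|^2 and, below, r D that of the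
   kernel; B passes from time t to time T0. *)
pose Z := (2 * T0 + 1) / e ^+ 2 + n%:R * (2 * (1 / e ^+ 2 + 1)).
have e20 : 0 < e ^+ 2 by exact: exprn_gt0.
have ie2 : 0 < 1 / e ^+ 2 by exact: divr_gt0.
have Z0 : 0 <= Z.
  apply: addr_ge0; first by apply: divr_ge0; lra.
  by apply: mulr_ge0 => //; lra.
pose C1 := a * 2 `^ (a + 1).
have C10 : 0 <= C1 by rewrite mulr_ge0 ?powR_ge0 ?(ltW a0).
pose B := ((T0 / e) ^+ 2) `^ a.
have B0 : 0 <= B by exact: powR_ge0.
pose D := 1 / e + 2 * (C1 * Z).
have D0 : 0 <= D.
  by apply: addr_ge0; [apply: divr_ge0 => //; exact: ltW|apply: mulr_ge0 => //; exact: mulr_ge0].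
have BD0 : 0 < D * B + 1 by apply: ltr_wpDl => //; exact: mulr_ge0.
have Z1 : 0 < 2 * (Z + 1) by lra.
exists (Num.min (Num.min 1 (e / 2)) (Num.min (1 / (2 * (Z + 1))) (eta / (D * B + 1)))).
  by rewrite !lt_min ltr01 !divr_gt0.
move=> y y' u t t' /andP[et tT] tr yy.
set r := Num.min _ _ in tr yy.
have : r <= r by [].
rewrite {2}/r !le_min -andbA => /and4P[r1 re rZ rD].
have r0 : 0 <= r by apply: le_trans (ltW tr).
have t0 : 0 < t by exact: lt_le_trans et.
have q0 := sqnorm_ge0 (tsub y u); have q'0 := sqnorm_ge0 (tsub y' u).
have qq := sqnorm_near u r1 yy.
move: (sqnorm (tsub y u)) (sqnorm (tsub y' u)) q0 q'0 qq => q q' q0 q'0 qq.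
clearbody r.
move: (tr); rewrite ltr_norml => /andP[tr1 tr2].
have t'0 : 0 < t' by lra.
set A := t ^+ 2 + q.
have et2 : e ^+ 2 <= t ^+ 2 by apply: lerXn2r; rewrite ?nnegrE ?(ltW e0) ?(ltW t0).
have eA : e ^+ 2 <= A by rewrite /A; lra.
have qA : q <= A by rewrite /A; have := sqr_ge0 t; lra.
have A0 : 0 < A by exact: lt_le_trans eA.
have A1 : 1 + q <= (1 / e ^+ 2 + 1) * A.
  by rewrite mulrDl !mul1r lerD// mulrC ler_pdivlMr// mul1r.
have tt : `|t' ^+ 2 - t ^+ 2| <= r * ((2 * T0 + 1) / e ^+ 2 * A).
  rewrite subr_sqr normrM; apply: ler_pM => //; first exact: ltW.
  apply: (@le_trans _ _ (2 * T0 + 1)).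
    by rewrite ger0_norm; lra.
  rewrite mulrAC ler_pdivlMr//; apply: ler_wpM2l => //; lra.
set z := (t' ^+ 2 + q' - A) / A.
have zZ : `|z| <= r * Z.
  rewrite /z normrM normfV (gtr0_norm A0) ler_pdivrMr//.
  have -> : t' ^+ 2 + q' - A = (t' ^+ 2 - t ^+ 2) + (q' - q) by rewrite /A; ring.
  apply: le_trans (ler_normD _ _) _.
  apply: le_trans (lerD tt qq) _.
  have -> : r * Z * A = r * ((2 * T0 + 1) / e ^+ 2 * A) +
    n%:R * (2 * r * ((1 / e ^+ 2 + 1) * A)) by rewrite /Z; ring.
  rewrite lerD2l; apply: ler_wpM2l => //; apply: ler_wpM2l => //; exact: mulr_ge0.
have z2 : `|z| <= 2^-1.
  apply: le_trans zZ _; move: rZ; rewrite ler_pdivlMr//.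
  have := mulr_ge0 r0 Z0; lra.
set d := (t' - t) / t.
have dD : `|d| <= r * (1 / e).
  rewrite /d normrM normfV (gtr0_norm t0); apply: ler_pM => //; rewrite ?invr_ge0 ?(ltW t0) ?(ltW tr)//.
  by rewrite div1r lef_pV2.
have d1 : `|1 + d| <= 2.
  apply: le_trans (ler_normD _ _) _; rewrite normr1.
  have : r * (1 / e) <= 1 by rewrite mulrA mulr1 ler_pdivrMr//; lra.
  lra.
rewrite (poisson_ratio t0 q0 t'0 q'0) -/A -/z -/d -{2}[P t q]mulr1 -mulrBr normrM.
rewrite (gtr0_norm (P_gt0 t0 q0)) mulrC.
apply: (@le_trans _ _ (r * D * P t q)).
  apply: ler_wpM2r; first exact/ltW/P_gt0.
  have -> : (1 + d) * (1 + z) `^ (- a) - 1 = d + (1 + d) * ((1 + z) `^ (- a) - 1) by ring.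
  apply: le_trans (ler_normD _ _) _.
  rewrite /D [leRHS]mulrDr; apply: lerD => //.
  rewrite normrM [leRHS]mulrCA; apply: ler_pM => //.
  apply: le_trans (powR_taylor0 (ltW a0) z2) _.
  by rewrite -/C1 [leRHS]mulrCA; apply: ler_wpM2l.
apply: le_trans (_ : r * D * (B * P T0 q) <= _).
  by apply: ler_wpM2l; [exact: mulr_ge0|exact: poisson_le_bnd].
have PT := P_gt0 T00 q0; move: (P T0 q) PT => p p0.
rewrite mulrA; apply: ler_wpM2r; first exact: ltW.
move: rD; rewrite ler_pdivlMr// => rD; rewrite -mulrA; lra.
Qed.

Lemma poisson_tail (eta om : R) : 0 < eta -> 0 < om ->
  exists2 r, 0 < r & forall (y u : T) t, 0 < t < r -> ~ near_pt eta y u ->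
  P t (sqnorm (tsub y u)) <= om * P 1 (sqnorm (tsub y u)).
Proof.
(* Away from y one has q >= eta^2, so 1 + q <= (1 + 1 / eta^2) q; the factor t of the kernel then
   supplies the smallness. *)
move=> eta0 om0; pose C := (1 + 1 / eta ^+ 2) `^ a.
have eta2 : 0 < eta ^+ 2 by exact: exprn_gt0.
have C10 : 0 < 1 + 1 / eta ^+ 2 by apply: ltr_pwDl => //; apply: divr_ge0 => //; exact: ltW.
have C0 : 0 < C by exact: powR_gt0.
exists (om / C); first exact: divr_gt0.
move=> y u t /andP[t0 tr] /(sqnorm_far eta0).
move: (sqnorm _) => q eq; have q0 : 0 < q by exact: lt_le_trans eq.
have A0 : 0 < t ^+ 2 + q by apply: ltr_wpDl => //; exact: sqr_ge0.
have B0 : 0 < 1 ^+ 2 + q by apply: ltr_wpDl => //; exact: sqr_ge0.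
rewrite ler_pdivrMr ?powR_gt0// mul1r mulrAC ler_pdivlMr ?powR_gt0//.
apply: (@le_trans _ _ (t * (C * (t ^+ 2 + q) `^ a))).
  apply: ler_wpM2l; first exact: ltW.
  rewrite -powRM ?(ltW A0) ?(ltW C10)//; apply: ge0_ler_powR.
  - exact: ltW.
  - by rewrite nnegrE ltW.
  - by rewrite nnegrE mulr_ge0// ltW.
  rewrite expr1n; apply: (@le_trans _ _ ((1 + 1 / eta ^+ 2) * q)).
    by rewrite mulrDl mul1r addrC lerD2l mulrAC mul1r ler_pdivlMr// mul1r.
  by apply: ler_wpM2l; [exact: ltW|rewrite lerDr sqr_ge0].
rewrite [leLHS]mulrA; apply: ler_wpM2r; first exact: powR_ge0.
by move: tr; rewrite ltr_pdivlMr// => /ltW.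
Qed.

Lemma Gamma_ge0 (x : R) : 0 <= Gamma x.
Proof.
by apply/fine_ge0/integral_ge0 => s _; rewrite lee_fin mulr_ge0 ?powR_ge0 ?expR_ge0.
Qed.

Lemma poisson_good (mu : {sigma_finite_measure set T -> \bar R}) :
  (forall (y : T) t, 0 < t -> (\int[mu]_u (Defs.kernel Poisson t (tsub y u))%:E = 1)%E) ->
  good_kernel mu (fun y t u => Defs.kernel Poisson t (tsub y u))
    (@axis_move R n bool) (@poisson_step R n).
Proof.
move=> int1; have c0 : 0 <= Gamma (n.+1%:R / 2) / (pi `^ (n.+1%:R / 2)) :> R.
  by apply: divr_ge0; [exact: Gamma_ge0|exact: powR_ge0].
(* From here on the normalizing constant is any c >= 0; its value enters only through [int1]. *)
move: int1; rewrite /Defs.kernel; move: (Gamma _ / _) c0 => c c0 int1.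
have P0 t (y u : T) : 0 < t -> 0 <= P t (sqnorm (tsub y u)).
  by move=> t0; apply/ltW/P_gt0 => //; exact: sqnorm_ge0.
split => //.
- by move=> y t u t0; apply: mulr_ge0 => //; exact: P0.
- move=> t t0; apply: measurable_funM => //; apply: measurable_funM => //.
  rewrite [X in measurable_fun _ X](_ : _ = (@powR R ^~ (- a)) \o
    (fun yu : T * T => t ^+ 2 + sqnorm (tsub yu.1 yu.2))).
    apply: measurableT_comp; first exact: measurable_powR.
    by apply: measurable_funD => //; exact: measurable_sqnorm_tsub.
  by apply/funext => yu /=; rewrite powRN.
- move=> e T0 e0 eT; exists T0; first exact: lt_le_trans eT.
  move=> eta eta0; have [r r0 H] := poisson_mod e0 eT eta0.
  exists r => // y y' t t' u et tr yy.
  rewrite -mulrBr normrM (ger0_norm c0) mulrCA; apply: ler_wpM2l => //.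
  exact: H.
- move=> e T0 e0 eT; have [C [r [C0 r0 H]]] := poisson_mvp e0.
  exists T0, (C * ((T0 / e) ^+ 2) `^ a), r; split => //.
  + exact: lt_le_trans eT.
  + by apply: mulr_ge0 => //; exact: powR_ge0.
  move=> h y t u hr /andP[et tT].
  under eq_bigr do rewrite -mulrBr.
  rewrite -mulr_sumr normrM (ger0_norm c0) mulrCA; apply: ler_wpM2l => //.
  apply: le_trans (H _ _ _ _ hr et) _.
  have -> : C * ((T0 / e) ^+ 2) `^ a * h ^+ 3 * P T0 (sqnorm (tsub y u)) =
    C * h ^+ 3 * (((T0 / e) ^+ 2) `^ a * P T0 (sqnorm (tsub y u))) by ring.
  apply: ler_wpM2l; last by apply: poisson_le_bnd => //; exact: sqnorm_ge0.
  by apply: mulr_ge0 => //; apply: exprn_ge0; have /andP[/ltW] := hr.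
- move=> eta om eta0 om0; have [r r0 H] := poisson_tail eta0 om0.
  exists r, 1; split => // y t u tr yu.
  by rewrite [leRHS]mulrCA; apply: ler_wpM2l => //; exact: H.
- move=> t t0; exists (((2 * t / t) ^+ 2) `^ a); first exact: powR_ge0.
  move=> t' y u /andP[tt t2]; rewrite [leRHS]mulrCA; apply: ler_wpM2l => //.
  by apply: poisson_le_bnd => //; exact: sqnorm_ge0.
- by move=> h r y j; exact: near_axis_move.
- move=> h j /andP[h0 h1]; case: j => [ic|[]] /=; rewrite ?normr0 ?normrN ?gtr0_norm//.
  exact: ltW.
- move=> h h0; rewrite sum_moves big_bool/= big1 => [|i _]; last by rewrite addr0.
  by rewrite add0r subrr.
- exact: poisson_step_barrier.
Qed.

End poisson.

(** * The heat kernel satisfies the kernel axioms *)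

Section heat.
Context (R : realType) (n : nat).
Local Notation T := (n.-tuple R).
Local Notation J := ('I_n * bool + unit)%type.
Local Notation H t q := ((4 * pi * t) `^ (- (n%:R / 2)) * expR (- q / (4 * t)) : R).

Let pi4 t : 0 < t -> 0 < 4 * pi * t :> R.
Proof. by move=> t0; rewrite !mulr_gt0// pi_gt0. Qed.

Let H_gt0 t q : 0 < t -> 0 < H t q.
Proof. by move=> t0; rewrite mulr_gt0 ?expR_gt0// powR_gt0// pi4. Qed.

Lemma heat_ratio t q t' q' : 0 < t -> 0 < t' ->
  H t' q' = H t q * expR (- (n%:R / 2) * ln (t' / t) + q / (4 * t) - q' / (4 * t')).
Proof.
move=> t0 t'0; rewrite /powR !gt_eqF ?pi4// -!expRD; congr expR.
rewrite ln_div ?posrE// !(@lnM _ (4 * pi)) ?posrE ?mulr_gt0 ?pi_gt0//.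
by rewrite !mulNr; ring.
Qed.

Lemma heat_le e t s q : 0 < e -> e <= t -> t <= s -> 0 <= q ->
  H t q <= (s / e) `^ (n%:R / 2) * H s q.
Proof.
move=> e0 et ts q0; have t0 : 0 < t by exact: lt_le_trans et.
have s0 : 0 < s by exact: lt_le_trans ts.
rewrite mulrA; apply: ler_pM; rewrite ?powR_ge0 ?expR_ge0//.
  rewrite !powRN -[leLHS]div1r ler_pdivrMr ?powR_gt0 ?pi4//.
  rewrite mulrAC ler_pdivlMr ?powR_gt0 ?pi4// mul1r.
  have se : 0 <= s / e by apply: divr_ge0; exact: ltW.
  rewrite -powRM ?(ltW (pi4 t0))//.
  apply: ge0_ler_powR; rewrite ?nnegrE ?(ltW (pi4 s0))// ?divr_ge0//.
    by apply: mulr_ge0 => //; exact/ltW/pi4.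
  have -> : s / e * (4 * pi * t) = (4 * pi * s) * (t / e) by ring.
  by apply: ler_peMr; [exact/ltW/pi4|rewrite ler_pdivlMr// mul1r].
rewrite ler_expR !mulNr lerN2 ler_wpM2l// lef_pV2 ?posrE ?mulr_gt0//.
by rewrite ler_pM2l.
Qed.

(** Relative increments of the heat kernel grow with q = |y - u|^2. The Gaussian room between times
    t <= T0 and 2 T0 absorbs both a power of 1 + q and a small exponential of it. *)
Lemma heat_absorb e T0 m : 0 < e -> e <= T0 -> exists2 C, 0 <= C & forall t q,
  e <= t <= T0 -> 0 <= q ->
  (1 + q) ^+ m * expR ((1 + q) / (16 * T0)) * H t q <= C * H (2 * T0) q.
Proof.
move=> e0 eT; have T00 : 0 < T0 by exact: lt_le_trans eT.
have c0 : 0 < (16 * T0)^-1 by rewrite invr_gt0 mulr_gt0.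
have [C' C'0 HC] := expR_dominates_exprn m c0.
exists (C' * expR (8 * T0)^-1 * (2 * T0 / e) `^ (n%:R / 2)).
  by rewrite !mulr_ge0 ?expR_ge0 ?powR_ge0.
move=> t q /andP[et tT] q0; have t0 : 0 < t by exact: lt_le_trans et.
have h1 : (1 + q) ^+ m <= C' * expR ((1 + q) / (16 * T0)).
  by rewrite mulrC; have := HC (1 + q) (addr_ge0 ler01 q0); rewrite mulrC [X in expR X]mulrC.
apply: (@le_trans _ _ (C' * expR ((1 + q) / (16 * T0)) * expR ((1 + q) / (16 * T0)) * H t q)).
  by apply: ler_wpM2r; [exact/ltW/H_gt0|apply: ler_wpM2r => //; exact: expR_ge0].
have -> : C' * expR ((1 + q) / (16 * T0)) * expR ((1 + q) / (16 * T0)) * H t q =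
  C' * (4 * pi * t) `^ (- (n%:R / 2)) * expR ((1 + q) / (8 * T0) - q / (4 * t)).
  have -> : (1 + q) / (8 * T0) - q / (4 * t) =
    (1 + q) / (16 * T0) + (1 + q) / (16 * T0) + - q / (4 * t).
    by field; rewrite !gt_eqF.
  by rewrite !expRD; ring.
apply: (@le_trans _ _ (C' * ((2 * T0 / e) `^ (n%:R / 2) * (4 * pi * (2 * T0)) `^ (- (n%:R / 2)))
  * expR ((8 * T0)^-1 + - q / (4 * (2 * T0))))); last first.
  by rewrite expRD le_eqVlt; apply/orP; left; apply/eqP; ring.
apply: ler_pM; rewrite ?mulr_ge0 ?powR_ge0 ?expR_ge0//.
  apply: ler_wpM2l => //.
  have := @heat_le e t (2 * T0) 0 e0 et _ (lexx 0).
  rewrite oppr0 !mul0r expR0 !mulr1; apply.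
  by apply: le_trans tT _; lra.
rewrite ler_expR.
have -> : (8 * T0)^-1 + - q / (4 * (2 * T0)) = (1 + q) / (8 * T0) - q / (4 * T0).
  by field; rewrite gt_eqF.
rewrite lerD2l lerN2 ler_wpM2l// lef_pV2 ?posrE ?mulr_gt0//.
by rewrite ler_pM2l.
Qed.

Let Q q : R := 1 + q.

(** Let dl be the increment of the logarithm of the kernel. Spatial moves (dl of order h) are
    expanded to second order, the time move (dl of order h^2) to first, and the h^2 terms cancel by
    the heat equation. What remains is O(h^3) times at most (1 + q)^3 exp((1 + q) / (16 T0)), which
    [heat_absorb] takes care of. *)
Lemma heat_mvp (e T0 : R) : 0 < e -> e <= T0 -> exists C r, [/\ 0 <= C, 0 < r &
  forall h t (y u : T), 0 < h < r -> e <= t <= T0 ->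
  `|\sum_j (H (t + heat_step h j) (sqnorm (tsub (axis_move y h j) u))
            - H t (sqnorm (tsub y u)))| <= C * h ^+ 3 * H (2 * T0) (sqnorm (tsub y u))].
Proof.
move=> e0 eT; have T00 : 0 < T0 by exact: lt_le_trans eT.
have [K K0 HK] := heat_absorb 3 e0 eT.
pose c2 : R := n%:R / e + 1 / e ^+ 2.
have e20 : 0 < e ^+ 2 by exact: exprn_gt0.
have ie2 : 0 < 1 / e ^+ 2 by exact: divr_gt0.
have ie : 0 < 1 / e by exact: divr_gt0.
have c20 : 0 <= c2 by apply: addr_ge0; apply: divr_ge0 => //; exact: ltW.
pose c : R := c2 + 1 / e.
have c0 : 0 < c by exact: ltr_wpDl.
pose D : R := n%:R / (16 * e ^+ 2) + (n%:R / e ^+ 2 + 1 / e ^+ 3) + 2 * n%:R * c ^+ 3 + c ^+ 2.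
have e30 : 0 < e ^+ 3 by exact: exprn_gt0.
have D0 : 0 <= D.
  apply: addr_ge0; last exact: sqr_ge0.
  apply: addr_ge0; last by apply: mulr_ge0; [exact: mulr_ge0|exact: exprn_ge0 (ltW c0)].
  apply: addr_ge0; first by apply: divr_ge0 => //; apply: mulr_ge0 => //; exact: ltW.
  by apply: addr_ge0; apply: divr_ge0 => //; exact: ltW.
(* The last bound on h keeps exp |dl| below W, given |dl| <= c h (1 + q). *)
exists (D * K); exists (Num.min (Num.min 1 (e / 2)) (1 / (16 * T0 * c))); split.
- exact: mulr_ge0.
- by rewrite !lt_min ltr01 !divr_gt0// !mulr_gt0.
move=> h t y u /andP[h0]; rewrite !lt_min => /andP[/andP[h1 he] hc] /andP[et tT].
have t0 : 0 < t by exact: lt_le_trans et.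
set q := sqnorm (tsub y u); have q0 : 0 <= q by exact: sqnorm_ge0.
have Q1 : 1 <= Q q by rewrite lerDl.
have Q0 : 0 < Q q by exact: lt_le_trans Q1.
have hh : h ^+ 2 <= h by rewrite expr2; apply: ler_piMr; exact: ltW.
have h20 : 0 < h ^+ 2 by exact: exprn_gt0.
have th : t / 2 <= t - h ^+ 2 by lra.
have th0 : 0 < t - h ^+ 2 by lra.
pose tj (j : J) := t + heat_step h j.
pose qj (j : J) : R := sqnorm (tsub (axis_move y h j) u).
pose dl j : R := - (n%:R / 2) * ln (tj j / t) + q / (4 * t) - qj j / (4 * tj j).
have tj0 j : 0 < tj j by rewrite /tj; case: j => [ic|[]] /=; rewrite ?addr0.
have E j : H (tj j) (qj j) - H t q = H t q * (expR (dl j) - 1).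
  by rewrite (heat_ratio q (qj j) t0 (tj0 j)) mulrBr mulr1.
under eq_bigr do rewrite -/(qj _) -/(tj _) E.
pose W := expR (Q q / (16 * T0)).
have W1 : 1 <= W.
  by rewrite /W -[leLHS]expR0 ler_expR; apply: divr_ge0; [exact: ltW|apply: mulr_ge0 => //; exact: ltW].
have W0 : 0 <= W by exact: expR_ge0.
rewrite -mulr_sumr normrM (gtr0_norm (H_gt0 q t0)) mulrC.
suff S : `|\sum_j (expR (dl j) - 1)| <= D * h ^+ 3 * (Q q ^+ 3 * W).
  apply: le_trans (ler_wpM2r (ltW (H_gt0 q t0)) S) _.
  rewrite -[leLHS]mulrA.
  have -> : D * K * h ^+ 3 * H (2 * T0) q = D * h ^+ 3 * (K * H (2 * T0) q) by ring.
  apply: ler_wpM2l; last by apply: HK; rewrite ?et.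
  by apply: mulr_ge0 => //; exact: exprn_ge0 (ltW h0).
have sx i : `|tnth (tsub y u) i| <= Q q / 2.
  have := sqr_tnth_le (tsub y u) i; rewrite -/q /Q => xq.
  have := sqr_ge0 (`|tnth (tsub y u) i| - 1); rewrite sqrrB1 real_normK ?num_real//.
  lra.
have di i b : dl (inl (i, b)) =
    - (2 * (if b then h else - h) * tnth (tsub y u) i + h ^+ 2) / (4 * t).
  rewrite /dl /tj /qj/= sqnorm_shift addr0 divff ?gt_eqF// ln1 mulr0 add0r -/q -mulrBl.
  by case: b; congr (_ / _); ring.
have dlc i b : `|dl (inl (i, b))| <= c * (h * Q q).
  have t4 : 0 < 4 * t by exact: mulr_gt0.
  rewrite di normrM normfV normrN (gtr0_norm t4) ler_pdivrMr//.
  apply: (@le_trans _ _ (2 * (h * Q q))).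
    apply: le_trans (ler_normD _ _) _; rewrite (ger0_norm (ltW h20)) !normrM.
    have -> : `|if b then h else - h| = h by case: b; rewrite ?normrN gtr0_norm.
    rewrite ger0_norm//.
    have : h * `|tnth (tsub y u) i| <= h * (Q q / 2) by apply: ler_wpM2l => //; exact: ltW.
    have : h <= h * Q q by apply: ler_peMr => //; exact: ltW.
    lra.
  have hQ : 0 <= h * Q q by apply: mulr_ge0; exact: ltW.
  rewrite mulrAC; apply: ler_wpM2r => //.
  apply: (@le_trans _ _ (1 / e * (4 * e))).
    by rewrite mulrCA div1r mulVf ?gt_eqF// mulr1; lra.
  by apply: ler_pM; rewrite /c; lra.
(* What is left of the time increment after its h^2 part; it is of order h^4. *)
pose rho : R := n%:R / 2 * (- ln (1 - h ^+ 2 / t) - h ^+ 2 / t)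
  - q / 4 * (h ^+ 4 / (t ^+ 2 * (t - h ^+ 2))).
have dt : dl (inr tt) = n%:R / 2 * (h ^+ 2 / t) - q * h ^+ 2 / (4 * t ^+ 2) + rho.
  rewrite /dl /tj /qj/= /rho -/q.
  have -> : (t - h ^+ 2) / t = 1 - h ^+ 2 / t by field; rewrite gt_eqF.
  by move: (ln _) => l; field; rewrite !gt_eqF.
have zz : 0 <= h ^+ 2 / t <= 2^-1.
  apply/andP; split; first by apply: divr_ge0; exact: ltW.
  by rewrite ler_pdivrMr//; lra.
have te2 : 1 / t ^+ 2 <= 1 / e ^+ 2.
  by rewrite !div1r lef_pV2 ?posrE ?exprn_gt0//; apply: lerXn2r; rewrite ?nnegrE ?(ltW e0) ?(ltW t0).
have te1 : 1 / t <= 1 / e by rewrite !div1r lef_pV2.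
have tth : h ^+ 4 / (t ^+ 2 * (t - h ^+ 2)) <= 2 / e ^+ 3 * h ^+ 4.
  rewrite mulrC; apply: ler_wpM2r; first exact: exprn_ge0 (ltW h0).
  rewrite -[leLHS]div1r ler_pdivrMr; last by apply: mulr_gt0 => //; exact: exprn_gt0.
  rewrite mulrAC ler_pdivlMr// mul1r.
  apply: (@le_trans _ _ (t ^+ 3)); first by apply: lerXn2r; rewrite ?nnegrE ?(ltW e0) ?(ltW t0).
  rewrite exprSr mulrCA; apply: ler_wpM2l; [exact: sqr_ge0|lra].
have tth0 : 0 <= h ^+ 4 / (t ^+ 2 * (t - h ^+ 2)).
  apply: divr_ge0; first exact: exprn_ge0 (ltW h0).
  by apply: mulr_ge0; [exact: sqr_ge0|exact: ltW].
have rhob : `|rho| <= h ^+ 4 * Q q * (n%:R / e ^+ 2 + 1 / e ^+ 3).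
  apply: le_trans (ler_normB _ _) _; rewrite [leRHS]mulrDr; apply: lerD.
    have n2 : 0 <= n%:R / 2 :> R by exact: divr_ge0.
    rewrite normrM (ger0_norm n2).
    apply: (@le_trans _ _ (n%:R / 2 * (2 * (h ^+ 2 / t) ^+ 2))).
      by apply: ler_wpM2l; [exact: divr_ge0|exact: ln1B_bound].
    have -> : n%:R / 2 * (2 * (h ^+ 2 / t) ^+ 2) = h ^+ 4 * n%:R * (1 / t ^+ 2).
      by field; rewrite gt_eqF.
    have -> : h ^+ 4 * Q q * (n%:R / e ^+ 2) = h ^+ 4 * n%:R * (1 / e ^+ 2) * Q q by ring.
    have h4n : 0 <= h ^+ 4 * n%:R :> R by apply: mulr_ge0 => //; exact: exprn_ge0 (ltW h0).
    apply: le_trans (ler_wpM2l h4n te2) _.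
    by apply: ler_peMr => //; apply: mulr_ge0 => //; exact: ltW.
  rewrite ger0_norm; last by apply: mulr_ge0 => //; exact: divr_ge0.
  apply: (@le_trans _ _ (q / 4 * (2 / e ^+ 3 * h ^+ 4))).
    by apply: ler_wpM2l => //; exact: divr_ge0.
  have -> : q / 4 * (2 / e ^+ 3 * h ^+ 4) = h ^+ 4 * (q / 2) * (1 / e ^+ 3).
    by field; rewrite gt_eqF.
  apply: ler_wpM2r; first by apply: divr_ge0 => //; exact: ltW.
  by apply: ler_wpM2l; [exact: exprn_ge0 (ltW h0)|rewrite /Q; lra].
have h4 : h ^+ 4 <= h ^+ 3 by rewrite exprSr; apply: ler_piMr; [exact: exprn_ge0 (ltW h0)|exact: ltW].
have dtc : `|dl (inr tt)| <= c2 * (h ^+ 2 * Q q).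
  rewrite /dl /tj /qj/= -/q.
  have -> : (t - h ^+ 2) / t = 1 + - (h ^+ 2 / t) by field; rewrite gt_eqF.
  rewrite -addrA.
  have -> : q / (4 * t) - q / (4 * (t - h ^+ 2)) = - (q / 4 * (h ^+ 2 / (t * (t - h ^+ 2)))).
    by field; rewrite !gt_eqF.
  apply: le_trans (ler_normB _ _) _.
  rewrite /c2 [leRHS]mulrDl; apply: lerD.
    have n2 : 0 <= n%:R / 2 :> R by exact: divr_ge0.
    rewrite normrM normrN (ger0_norm n2).
    have hz : `|- (h ^+ 2 / t)| <= 2^-1 by rewrite normrN ger0_norm; case/andP: zz.
    apply: (@le_trans _ _ (n%:R / 2 * (2 * `|- (h ^+ 2 / t)|))).
      by apply: ler_wpM2l; [exact: divr_ge0|exact: ln_bound].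
    rewrite normrN ger0_norm; last by case/andP: zz.
    have -> : n%:R / 2 * (2 * (h ^+ 2 / t)) = n%:R * h ^+ 2 * (1 / t) by field; rewrite gt_eqF.
    have -> : n%:R / e * (h ^+ 2 * Q q) = n%:R * h ^+ 2 * (1 / e) * Q q by ring.
    have nh : 0 <= n%:R * h ^+ 2 :> R by apply: mulr_ge0 => //; exact: ltW.
    apply: le_trans (ler_wpM2l nh te1) _.
    by apply: ler_peMr => //; apply: mulr_ge0 => //; exact: ltW.
  have tt0 : 0 < t * (t - h ^+ 2) by exact: mulr_gt0.
  rewrite ger0_norm; last by apply: mulr_ge0; apply: divr_ge0 => //; exact: ltW.
  have : h ^+ 2 / (t * (t - h ^+ 2)) <= 2 / e ^+ 2 * h ^+ 2.
    rewrite mulrC; apply: ler_wpM2r; first exact: ltW.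
    rewrite -[leLHS]div1r ler_pdivrMr// mulrAC ler_pdivlMr// mul1r.
    apply: (@le_trans _ _ (t ^+ 2)); first by apply: lerXn2r; rewrite ?nnegrE ?(ltW e0) ?(ltW t0).
    by rewrite expr2 mulrCA; apply: ler_wpM2l; [exact: ltW|lra].
  move=> Hq; apply: le_trans (ler_wpM2l _ Hq) _; first exact: divr_ge0.
  have -> : q / 4 * (2 / e ^+ 2 * h ^+ 2) = 1 / e ^+ 2 * (h ^+ 2 * (q / 2)) by field; rewrite gt_eqF.
  apply: ler_wpM2l; first exact: ltW.
  by apply: ler_wpM2l; [exact: ltW|rewrite /Q; lra].
have hQ : 0 <= h * Q q by apply: mulr_ge0; exact: ltW.
have dW (x : R) : `|x| <= c * (h * Q q) -> expR `|x| <= W.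
  move=> xc; rewrite ler_expR; apply: le_trans xc _.
  rewrite mulrA mulrC; apply: ler_wpM2l; first exact: ltW.
  move: hc; rewrite ltr_pdivlMr; last by rewrite !mulr_gt0.
  rewrite -[leRHS]div1r ler_pdivlMr ?mulr_gt0//; lra.
have dtc' : `|dl (inr tt)| <= c * (h * Q q).
  apply: le_trans dtc _; apply: ler_pM => //.
  - by apply: mulr_ge0; exact: ltW.
  - by rewrite /c lerDl ltW.
  - by apply: ler_wpM2r => //; exact: ltW.
rewrite sum_moves (big_pred1 tt) => [|[]//].
pose r3 i b := expR (dl (inl (i, b))) - 1 - dl (inl (i, b)) - dl (inl (i, b)) ^+ 2 / 2.
pose r2 := expR (dl (inr tt)) - 1 - dl (inr tt).
(* The h^2 terms n h^2 / (2 t) and q h^2 / (4 t^2) of the time move cancel against the spatial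
   ones. *)
have -> : \sum_i (expR (dl (inl (i, true))) - 1 + (expR (dl (inl (i, false))) - 1)) +
    (expR (dl (inr tt)) - 1) =
    n%:R * h ^+ 4 / (16 * t ^+ 2) + rho + \sum_i (r3 i true + r3 i false) + r2.
  have -> : expR (dl (inr tt)) - 1 = dl (inr tt) + r2 by rewrite /r2; ring.
  have -> : \sum_i (expR (dl (inl (i, true))) - 1 + (expR (dl (inl (i, false))) - 1)) =
     (n%:R * (- (h ^+ 2 / (2 * t)) + h ^+ 4 / (16 * t ^+ 2)) + h ^+ 2 / (4 * t ^+ 2) * q)
     + \sum_i (r3 i true + r3 i false).
    rewrite /q /sqnorm mulr_sumr -[X in X%:R * _](card_ord n) -sum1_card natr_sum mulr_suml.
    rewrite -!big_split/=; apply: eq_bigr => i _.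
    have E1 b : expR (dl (inl (i, b))) - 1 = dl (inl (i, b)) + dl (inl (i, b)) ^+ 2 / 2 + r3 i b.
      by rewrite /r3; ring.
    by rewrite !E1 !di/=; field; rewrite gt_eqF.
  by rewrite dt; field; rewrite gt_eqF.
have QQ m : 1 <= Q q ^+ m by exact: exprn_ege1.
have h3 : 0 <= h ^+ 3 by exact: exprn_ge0 (ltW h0).
have Q3 : 0 <= Q q ^+ 3 by exact: exprn_ge0 (ltW Q0).
have QW : 1 <= Q q ^+ 3 * W by rewrite -[1]mulr1; apply: ler_pM.
have QW' : Q q <= Q q ^+ 3 * W.
  rewrite -[leLHS]mulr1; apply: ler_pM => //; first exact: ltW.
  by rewrite exprS; apply: ler_peMr; [exact: ltW|exact: QQ].
have B1 : `|n%:R * h ^+ 4 / (16 * t ^+ 2)| <= n%:R / (16 * e ^+ 2) * h ^+ 3 * (Q q ^+ 3 * W).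
  rewrite ger0_norm; last first.
    apply: divr_ge0; first by apply: mulr_ge0 => //; exact: exprn_ge0 (ltW h0).
    by apply: mulr_ge0 => //; exact: sqr_ge0.
  have -> : n%:R * h ^+ 4 / (16 * t ^+ 2) = n%:R / 16 * h ^+ 4 * (1 / t ^+ 2) by field; rewrite gt_eqF.
  have -> : n%:R / (16 * e ^+ 2) * h ^+ 3 * (Q q ^+ 3 * W) =
    n%:R / 16 * h ^+ 3 * (1 / e ^+ 2) * (Q q ^+ 3 * W) by field; rewrite gt_eqF.
  have A : 0 <= n%:R / 16 * h ^+ 3 * (1 / e ^+ 2) :> R.
    by apply: mulr_ge0; [apply: mulr_ge0 => //; exact: divr_ge0|exact: ltW].
  apply: le_trans (ler_peMr A QW); apply: ler_pM => //.
  + by apply: mulr_ge0; [exact: divr_ge0|exact: exprn_ge0 (ltW h0)].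
  + by apply: divr_ge0 => //; exact: sqr_ge0.
  + by apply: ler_wpM2l => //; exact: divr_ge0.
have B2 : `|rho| <= (n%:R / e ^+ 2 + 1 / e ^+ 3) * h ^+ 3 * (Q q ^+ 3 * W).
  apply: le_trans rhob _; rewrite mulrC -[leRHS]mulrA; apply: ler_wpM2l.
    by apply: addr_ge0; apply: divr_ge0 => //; exact: ltW.
  by apply: ler_pM => //; [exact: exprn_ge0 (ltW h0)|exact: ltW].
have B3 i b : `|r3 i b| <= c ^+ 3 * h ^+ 3 * (Q q ^+ 3 * W).
  apply: le_trans (expR_taylor2 _) _.
  have -> : c ^+ 3 * h ^+ 3 * (Q q ^+ 3 * W) = W * (c * (h * Q q)) ^+ 3 by ring.
  apply: ler_pM => //; rewrite ?expR_ge0//; first by apply: dW; exact: dlc.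
  have chQ : 0 <= c * (h * Q q) by apply: mulr_ge0 => //; exact: ltW.
  by apply: lerXn2r; rewrite ?nnegrE//; exact: dlc.
have B4 : `|r2| <= c ^+ 2 * h ^+ 3 * (Q q ^+ 3 * W).
  apply: le_trans (expR_taylor1 _) _.
  apply: (@le_trans _ _ (W * (c * (h ^+ 2 * Q q)) ^+ 2)).
    apply: ler_pM => //; rewrite ?expR_ge0//; first exact: dW.
    have hQ2 : 0 <= h ^+ 2 * Q q by apply: mulr_ge0; exact: ltW.
    apply: lerXn2r; rewrite ?nnegrE//; first by apply: mulr_ge0 => //; exact: ltW.
    by apply: le_trans dtc _; apply: ler_wpM2r => //; rewrite /c lerDl ltW.
  have -> : W * (c * (h ^+ 2 * Q q)) ^+ 2 = c ^+ 2 * (h ^+ 4 * (Q q ^+ 2 * W)) by ring.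
  rewrite -[leRHS]mulrA; apply: ler_wpM2l; first exact: sqr_ge0.
  apply: ler_pM => //.
  - exact: exprn_ge0 (ltW h0).
  - by apply: mulr_ge0 => //; exact: sqr_ge0.
  - by apply: ler_wpM2r => //; rewrite [leRHS]exprSr; apply: ler_peMr => //; exact: sqr_ge0.
have B3s : `|\sum_i (r3 i true + r3 i false)| <= 2 * n%:R * c ^+ 3 * h ^+ 3 * (Q q ^+ 3 * W).
  apply: le_trans (ler_norm_sum _ _ _) _.
  apply: (@le_trans _ _ (\sum_(i < n) 2 * (c ^+ 3 * h ^+ 3 * (Q q ^+ 3 * W)))).
    by apply: ler_sum => i _; apply: le_trans (ler_normD _ _) _; have := B3 i true; have := B3 i false; lra.
  rewrite sumr_const card_ord -[leLHS]mulr_natl.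
  by rewrite le_eqVlt; apply/orP; left; apply/eqP; ring.
have -> : D * h ^+ 3 * (Q q ^+ 3 * W) =
    n%:R / (16 * e ^+ 2) * h ^+ 3 * (Q q ^+ 3 * W)
    + (n%:R / e ^+ 2 + 1 / e ^+ 3) * h ^+ 3 * (Q q ^+ 3 * W)
    + 2 * n%:R * c ^+ 3 * h ^+ 3 * (Q q ^+ 3 * W) + c ^+ 2 * h ^+ 3 * (Q q ^+ 3 * W).
  by rewrite /D; ring.
apply: le_trans (ler_normD _ _) _; apply: lerD B4.
apply: le_trans (ler_normD _ _) _; apply: lerD B3s.
by apply: le_trans (ler_normD _ _) _; exact: lerD.
Qed.

Lemma heat_mod (e T0 : R) : 0 < e -> e <= T0 -> forall eta, 0 < eta ->
  exists2 r, 0 < r & forall (y y' u : T) t t', e <= t <= T0 -> `|t' - t| < r ->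
  near_pt r y y' -> `|H t' (sqnorm (tsub y' u)) - H t (sqnorm (tsub y u))|
    <= eta * H (2 * T0) (sqnorm (tsub y u)).
Proof.
move=> e0 eT eta eta0; have T00 : 0 < T0 by exact: lt_le_trans eT.
have [K K0 HK] := heat_absorb 1 e0 eT.
have e20 : 0 < e ^+ 2 by exact: exprn_gt0.
pose c : R := n%:R / e + (1 + 2 * n%:R * T0) / (2 * e ^+ 2) + 1.
have nT : 0 <= 2 * n%:R * T0 by apply: mulr_ge0; [exact: mulr_ge0|exact: ltW].
have c1 : 0 <= n%:R / e by apply: divr_ge0 => //; exact: ltW.
have c2 : 0 <= (1 + 2 * n%:R * T0) / (2 * e ^+ 2).
  by apply: divr_ge0; [lra|apply: mulr_ge0 => //; exact: ltW].
have c0 : 0 < c by rewrite /c; lra.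
have cK : 0 < c * K + 1 by apply: ltr_wpDl => //; apply: mulr_ge0 => //; exact: ltW.
exists (Num.min (Num.min 1 (e / 2)) (Num.min (1 / (16 * T0 * c)) (eta / (c * K + 1)))).
  by rewrite !lt_min ltr01 !divr_gt0// !mulr_gt0.
move=> y y' u t t' /andP[et tT] tr yy.
set r := Num.min _ _ in tr yy.
have : r <= r by [].
rewrite {2}/r !le_min -andbA => /and4P[r1 re rc rK].
have r0 : 0 <= r by apply: le_trans (ltW tr).
have t0 : 0 < t by exact: lt_le_trans et.
have q0 := sqnorm_ge0 (tsub y u); have qq := sqnorm_near u r1 yy.
move: (sqnorm (tsub y u)) (sqnorm (tsub y' u)) q0 qq => q q' q0 qq.
clearbody r.
have /andP[tr1 tr2] : - r < t' - t < r by rewrite -ltr_norml.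
have t'0 : 0 < t' by lra.
have Q1 : 1 <= Q q by rewrite lerDl.
have Q0 : 0 < Q q by exact: lt_le_trans Q1.
rewrite (heat_ratio q q' t0 t'0).
set D := _ + _ - _.
have DB : `|D| <= c * (r * Q q).
  have -> : D = - (n%:R / 2 * ln (1 + (t' - t) / t)) + (q * (t' - t) - t * (q' - q)) / (4 * t * t').
    have -> : 1 + (t' - t) / t = t' / t by field; rewrite gt_eqF.
    by rewrite /D; move: (ln _) => l; field; rewrite !gt_eqF.
  have tt : `|(t' - t) / t| <= r * (1 / e).
    rewrite normrM normfV (gtr0_norm t0); apply: ler_pM => //; rewrite ?invr_ge0 ?(ltW t0) ?(ltW tr)//.
    by rewrite div1r lef_pV2.
  have re2 : r * (1 / e) <= 2^-1 by rewrite mulrA mulr1 ler_pdivrMr//; lra.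
  apply: le_trans (ler_normD _ _) _.
  rewrite normrN /c -addrA [leRHS]mulrDl; apply: lerD.
    have n2 : 0 <= n%:R / 2 :> R by exact: divr_ge0.
    rewrite normrM (ger0_norm n2).
    apply: (@le_trans _ _ (n%:R / 2 * (2 * (r * (1 / e))))).
      apply: ler_wpM2l => //; apply: le_trans (ln_bound (le_trans tt re2)) _.
      exact: ler_wpM2l.
    have -> : n%:R / 2 * (2 * (r * (1 / e))) = n%:R / e * r by field; rewrite gt_eqF.
    by apply: ler_wpM2l => //; exact: ler_peMr.
  apply: (@le_trans _ _ ((1 + 2 * n%:R * T0) / (2 * e ^+ 2) * (r * Q q))); last first.
    by apply: ler_wpM2r; [apply: mulr_ge0 => //; exact: ltW|lra].
  have tt4 : 0 < 4 * t * t' by rewrite !mulr_gt0.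
  rewrite normrM normfV (gtr0_norm tt4) ler_pdivrMr//.
  have N : `|q * (t' - t) - t * (q' - q)| <= (1 + 2 * n%:R * T0) * (r * Q q).
    apply: le_trans (ler_normB _ _) _; rewrite !normrM (ger0_norm q0) (gtr0_norm t0).
    have h1 : q * `|t' - t| <= Q q * r by apply: ler_pM => //; rewrite /Q; lra.
    have h2 : t * `|q' - q| <= T0 * (n%:R * (2 * r * Q q)) by apply: ler_pM => //; exact: ltW.
    lra.
  apply: le_trans N _.
  have -> : (1 + 2 * n%:R * T0) / (2 * e ^+ 2) * (r * Q q) * (4 * t * t') =
    (1 + 2 * n%:R * T0) * (r * Q q) * ((2 * t * t') / e ^+ 2) by field; rewrite gt_eqF.
  apply: ler_peMr; first by apply: mulr_ge0; [lra|apply: mulr_ge0 => //; exact: ltW].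
  rewrite ler_pdivlMr// mul1r expr2.
  have : e * e <= t * (2 * t') by apply: ler_pM; lra.
  by lra.
rewrite -{2}[H t q]mulr1 -mulrBr normrM (gtr0_norm (H_gt0 q t0)) mulrC.
have rQ : 0 <= r * Q q by apply: mulr_ge0 => //; exact: ltW.
have EW : expR `|D| <= expR ((1 + q) / (16 * T0)).
  rewrite ler_expR; apply: le_trans DB _.
  rewrite mulrA mulrC; apply: ler_wpM2l; first exact: ltW.
  have Tc : 0 < 16 * T0 * c by rewrite !mulr_gt0.
  have T16 : 0 < 16 * T0 by rewrite mulr_gt0.
  rewrite ler_pdivlMr// in rc.
  rewrite -[leRHS]div1r ler_pdivlMr//; lra.
apply: (@le_trans _ _ (c * r * ((1 + q) ^+ 1 * expR ((1 + q) / (16 * T0)) * H t q))).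
  rewrite [leRHS]mulrA; apply: ler_wpM2r; first exact/ltW/H_gt0.
  apply: le_trans (expR_taylor0 D) _.
  have -> : c * r * ((1 + q) ^+ 1 * expR ((1 + q) / (16 * T0))) =
    expR ((1 + q) / (16 * T0)) * (c * (r * Q q)) by rewrite /Q; ring.
  by apply: ler_pM => //; exact: expR_ge0.
apply: (@le_trans _ _ (c * r * (K * H (2 * T0) q))).
  apply: ler_wpM2l; first by apply: mulr_ge0 => //; exact: ltW.
  by apply: HK; rewrite ?et.
have T20 : 0 < 2 * T0 by exact: mulr_gt0.
have := H_gt0 q T20; move: (H (2 * T0) q) => p p0.
rewrite mulrA; apply: ler_wpM2r; first exact: ltW.
move: rK; rewrite ler_pdivlMr// => rK; lra.
Qed.

(** Half of the exponent q / (4 t) leaves the Gaussian of time 2, since t <= 1. The other half is at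
    least eta^2 / (8 t) and beats the factor (2 / t)^(n/2). *)
Lemma heat_tail (eta om : R) : 0 < eta -> 0 < om ->
  exists2 r, 0 < r & forall (y u : T) t, 0 < t < r -> ~ near_pt eta y u ->
  H t (sqnorm (tsub y u)) <= om * H 2 (sqnorm (tsub y u)).
Proof.
move=> eta0 om0; have eta2 : 0 < eta ^+ 2 by exact: exprn_gt0.
have c0 : 0 < eta ^+ 2 / 16 by exact: divr_gt0.
have [C C0 HC] := expR_dominates_exprn n.+1 c0.
have C1 : 0 < C + 1 by lra.
exists (Num.min 1 (2 * om / (C + 1))); first by rewrite lt_min ltr01 divr_gt0// mulr_gt0.
move=> y u t /andP[t0]; rewrite lt_min => /andP[t1 tr] /(sqnorm_far eta0).
move: (sqnorm _) => q eq; have q0 : 0 < q by exact: lt_le_trans eq.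
have t2 : t <= 2 by lra.
apply: (@le_trans _ _ ((2 / t) `^ (n%:R / 2) * (4 * pi * 2) `^ (- (n%:R / 2)) *
    (expR (- q / (4 * 2)) * expR (- (eta ^+ 2 / 16 * (2 / t)))))).
  apply: ler_pM; rewrite ?powR_ge0 ?expR_ge0//.
    have := heat_le t0 (lexx t) t2 (lexx 0).
    by rewrite oppr0 !mul0r expR0 !mulr1.
  rewrite -expRD ler_expR.
  have -> : - q / (4 * t) = - (q / (8 * t) + q / (8 * t)) by field; rewrite gt_eqF.
  rewrite -[leRHS]opprK lerN2 opprD !opprK.
  have h1 : q / 8 <= q / (8 * t).
    by apply: ler_wpM2l; [exact: ltW|rewrite lef_pV2 ?posrE ?mulr_gt0//; lra].
  have h2 : eta ^+ 2 / 16 * (2 / t) <= q / (8 * t).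
    have -> : eta ^+ 2 / 16 * (2 / t) = eta ^+ 2 / (8 * t) by field; rewrite gt_eqF.
    by apply: ler_wpM2r => //; rewrite invr_ge0; lra.
  lra.
have H2 : 0 <= H 2 q by exact/ltW/H_gt0.
have -> : (2 / t) `^ (n%:R / 2) * (4 * pi * 2) `^ (- (n%:R / 2)) *
    (expR (- q / (4 * 2)) * expR (- (eta ^+ 2 / 16 * (2 / t)))) =
  ((2 / t) `^ (n%:R / 2) * expR (- (eta ^+ 2 / 16 * (2 / t)))) * H 2 q by ring.
apply: ler_wpM2r => //.
have tt0 : 0 < 2 / t by exact: divr_gt0.
have tt1 : 1 <= 2 / t by rewrite ler_pdivlMr ?mul1r.
rewrite expRN ler_pdivrMr ?expR_gt0//.
apply: (@le_trans _ _ ((2 / t) ^+ n)).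
  rewrite -powR_mulrn ?(ltW tt0)//; apply: ler_powR => //.
  by rewrite ler_pdivrMr//; have := ler0n R n; lra.
have := HC _ (ltW tt0); rewrite exprSr -ler_pdivlMr// => /le_trans; apply.
rewrite mulrAC; apply: ler_wpM2r; first exact: expR_ge0.
rewrite ler_pdivrMr// mulrA ler_pdivlMr//.
move: tr; rewrite ltr_pdivlMr// => tr; nra.
Qed.

Lemma heat_good (mu : {sigma_finite_measure set T -> \bar R}) :
  (forall (y : T) t, 0 < t -> (\int[mu]_u (Defs.kernel Heat t (tsub y u))%:E = 1)%E) ->
  good_kernel mu (fun y t u => Defs.kernel Heat t (tsub y u))
    (@axis_move R n unit) (@heat_step R n).
Proof.
move=> int1; split => //.
- by move=> y t u t0; exact/ltW/H_gt0.
- move=> t t0; apply: measurable_funM => //.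
  apply: (measurableT_comp (@measurable_expR R)).
  apply: measurable_funM => //; apply: measurable_funN.
  exact: measurable_sqnorm_tsub.
- move=> e T0 e0 eT; exists (2 * T0).
    by apply: mulr_gt0 => //; exact: lt_le_trans eT.
  move=> eta eta0; have [r r0 Hr] := heat_mod e0 eT eta0.
  by exists r => // y y' t t' u et tr yy; exact: Hr.
- move=> e T0 e0 eT; have [C [r [C0 r0 Hr]]] := heat_mvp e0 eT.
  exists (2 * T0), C, r; split => //.
    by apply: mulr_gt0 => //; exact: lt_le_trans eT.
  by move=> h y t u hr et; exact: Hr.
- move=> eta om eta0 om0; have [r r0 Hr] := heat_tail eta0 om0.
  by exists r, 2; split => // y t u tr yu; exact: Hr.
- move=> t t0; exists ((2 * t / t) `^ (n%:R / 2)); first exact: powR_ge0.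
  move=> t' y u /andP[tt t2]; apply: heat_le => //; exact: sqnorm_ge0.
- by move=> h r y j; exact: near_axis_move.
- move=> h j /andP[h0 h1]; case: j => [ic|[]] /=; rewrite ?normr0 ?(ltW h0)//.
  by rewrite normrN ger0_norm ?sqr_ge0// expr2; apply: ler_piMr => //; exact: ltW.
- move=> h h0; rewrite sum_moves (big_pred1 tt) => [|[]//].
  by rewrite big1 => [|i _] /=; rewrite ?addr0// add0r oppr_le0 sqr_ge0.
- exact: heat_step_barrier.
Qed.

End heat.

(** * Both kernels have total mass one *)

Definition lebT (R : realType) (n : nat) :
    {sigma_finite_measure set (n.-tuple R) -> \bar R} :=
  sval (cid (lebT_ex R n)).

Lemma intRnE (R : realType) (n : nat) (g : n.-tuple R -> \bar R) :
  measurable_fun [set: n.-tuple R] g -> (forall u, 0 <= g u)%E ->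
  intRn g = (\int[lebT R n]_u g u)%E.
Proof. exact: (svalP (cid (lebT_ex R n))). Qed.

Section normalization.
Context (R : realType).
Local Notation leb := (@lebesgue_measure R).

Lemma integral_gauss (s y : R) : 0 < s ->
  (\int[leb]_x (expR (- (s * (y - x) ^+ 2)))%:E = (Num.sqrt (pi / s))%:E)%E.
Proof.
move=> s0; pose sg := Num.sqrt (2 * s)^-1.
have s20 : 0 < (2 * s)^-1 by rewrite invr_gt0 mulr_gt0.
have sg0 : sg != 0 by rewrite gt_eqF// sqrtr_gt0.
have sg2 : sg ^+ 2 = (2 * s)^-1 by rewrite sqr_sqrtr// ltW.
have pk : normal_peak sg = (Num.sqrt (pi / s))^-1.
  rewrite /normal_peak sg2; congr (Num.sqrt _)^-1.
  by rewrite -mulr_natr; field; rewrite gt_eqF.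
have pk0 : 0 < Num.sqrt (pi / s) by rewrite sqrtr_gt0 divr_gt0// pi_gt0.
transitivity (\int[leb]_x ((Num.sqrt (pi / s))%:E * (normal_pdf y sg x)%:E))%E.
  apply: eq_integral => x _; have -> : normal_pdf y sg x = normal_peak sg * normal_fun y sg x by rewrite normal_pdfE.
  rewrite pk /normal_fun sg2.
  rewrite -EFinM mulVKf ?gt_eqF//; congr (expR _)%:E.
  rewrite -mulr_natr; field; rewrite gt_eqF//.
rewrite ge0_integralZl//.
- by rewrite integral_normal_pdf mule1.
- by apply/measurable_EFinP; exact: measurable_normal_pdf.
- by move=> x _; rewrite lee_fin normal_pdf_ge0.
Qed.

Lemma sqnorm_cons n (y : n.+1.-tuple R) (x : R) (v : n.-tuple R) :
  sqnorm (tsub y (cons_tuple x v)) =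
  (thead y - x) ^+ 2 + sqnorm (tsub [tuple of behead y] v).
Proof.
rewrite /sqnorm big_ord_recl !tnth_tsub tnth0; congr ((_ - _) ^+ 2 + _).
apply: eq_bigr => i _; rewrite !tnth_tsub tnthS; congr ((_ - _) ^+ 2).
by rewrite [in LHS](tuple_eta y) tnthS.
Qed.

Lemma measurable_sqnorm_tsubr n (y : n.-tuple R) :
  measurable_fun [set: n.-tuple R] (fun u => sqnorm (tsub y u)).
Proof. exact: (measurableT_comp (@measurable_sqnorm_tsub R n) (measurable_pair1 y)). Qed.

Lemma intRn_gauss n (y : n.-tuple R) (s : R) : 0 < s ->
  intRn (fun u => (expR (- (s * sqnorm (tsub y u))))%:E) = ((Num.sqrt (pi / s)) ^+ n)%:E.
Proof.
move=> s0; elim: n y => [|n IH] y.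
  by rewrite /= /sqnorm big_ord0 mulr0 oppr0 expR0.
rewrite /=.
under eq_integral => x _.
  rewrite (_ : intRn _ = ((expR (- (s * (thead y - x) ^+ 2)))%:E *
     ((Num.sqrt (pi / s)) ^+ n)%:E)%E); last first.
    rewrite -(IH [tuple of behead y]).
    have mg : measurable_fun [set: n.-tuple R]
        (fun v => (expR (- (s * sqnorm (tsub [tuple of behead y] v))))%:E).
      apply/measurable_EFinP; apply: measurableT_comp; first exact: measurable_expR.
      by apply: measurable_funN; apply: measurable_funM => //; exact: measurable_sqnorm_tsubr.
    have g0 v : (0 <= (expR (- (s * sqnorm (tsub [tuple of behead y] v))))%:E)%E.
      by rewrite lee_fin expR_ge0.
    rewrite (intRnE mg g0).
    rewrite -ge0_integralZl//.
    rewrite -intRnE; last 2 first.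
    - by apply: emeasurable_funM => //; exact: measurable_cst.
    - by move=> v; apply: mule_ge0; rewrite lee_fin expR_ge0.
    congr intRn; apply/funext => v; rewrite sqnorm_cons -EFinM -expRD.
    by congr (expR _)%:E; ring.
  over.
rewrite ge0_integralZr//.
- by rewrite integral_gauss// -EFinM exprS.
- apply/measurable_EFinP; apply: measurableT_comp; first exact: measurable_expR.
  apply: measurable_funN; apply: measurable_funM => //; apply: measurable_funX.
  exact: measurable_funB.
Qed.

Lemma heat_int n (y : n.-tuple R) t : 0 < t ->
  (\int[lebT R n]_u (Defs.kernel Heat t (tsub y u))%:E = 1)%E.
Proof.
move=> t0; have pt : 0 < 4 * pi * t by rewrite !mulr_gt0// pi_gt0.
have t4 : 0 < (4 * t)^-1 by rewrite invr_gt0 mulr_gt0.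
rewrite /Defs.kernel; under eq_integral do rewrite EFinM.
have mg : measurable_fun [set: n.-tuple R]
    (fun v => (expR (- ((4 * t)^-1 * sqnorm (tsub y v))))%:E).
  apply/measurable_EFinP; apply: measurableT_comp; first exact: measurable_expR.
  by apply: measurable_funN; apply: measurable_funM => //; exact: measurable_sqnorm_tsubr.
have E u : (expR (- sqnorm (tsub y u) / (4 * t)))%:E =
    (expR (- ((4 * t)^-1 * sqnorm (tsub y u))))%:E.
  by congr (expR _)%:E; rewrite mulNr mulrC.
under eq_integral do rewrite E.
rewrite ge0_integralZl//; last by rewrite lee_fin powR_ge0.
rewrite -intRnE//.
rewrite intRn_gauss// invrK -EFinM (_ : pi * _ = 4 * pi * t); last by ring.
rewrite -powR12_sqrt ?(ltW pt)// -powR_mulrn ?powR_ge0// -powRrM -powRD.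
  rewrite (_ : - (n%:R / 2) + 2^-1 * n%:R = 0) ?powRr0//; ring.
by rewrite (gt_eqF pt) implybT.
Qed.

Let xexp n (q x : R) : R := x ^+ n * expR (- (x ^+ 2 * q)).

Let continuous_xexp n q : continuous (xexp n q).
Proof.
move=> x; apply: cvgM; first exact: exprn_continuous.
apply: (cvg_comp _ expR); last exact: continuous_expR.
by apply: cvgN; apply: cvgMl; exact: sqr_continuous.
Qed.

(** For q > 0 and n >= 1 this is Gamma((n + 1) / 2) / (2 q^((n + 1) / 2)). At q = t^2 + |y - u|^2 it
    exhibits the Poisson kernel as a superposition of Gaussians in u. *)
Let I n q : \bar R := (\int[leb]_(x in `[0%R, +oo[) (xexp n q x)%:E)%E.

Lemma integral_scale (G : R -> R) (c : R) : 0 < c -> continuous G ->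
  (forall x, 0 < x -> 0 <= G x) ->
  (\int[leb]_(x in `[0%R, +oo[) (G x)%:E = \int[leb]_(x in `[0%R, +oo[) (G (c * x) * c)%:E)%E.
Proof.
move=> c0 cG G0.
have dF (x : R) : is_derive x 1 (fun z => c * z) c.
  by rewrite -[X in is_derive _ _ _ X]mulr1; exact: (is_deriveZ c (is_derive_id x (1 : R))).
have F' : derive1 (fun z : R => c * z) = cst c.
  by apply/funext => x; rewrite derive1E; exact: derive_val.
have := @increasing_ge0_integration_by_substitutiony R (fun z => c * z) G 0.
rewrite mulr0 F'; apply.
- by move=> x y _ _ xy; rewrite ltr_pM2l.
- by move=> x _; exact: cvg_cst.
- exact: is_cvg_cst.
- exact: is_cvg_cst.
- split=> [x _|]; first by have [] := dF x.
  by apply: cvg_at_right_filter; apply: cvgMr; exact: cvg_id.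
- by apply: gt0_cvgMry => //; exact: cvg_id.
- exact: continuous_subspaceT.
- by move=> x; rewrite in_itv/= andbT => /G0.
Qed.

Let I_ge0 n q : (0 <= I n q)%E.
Proof.
apply: integral_ge0 => x; rewrite /= in_itv/= andbT => x0.
by rewrite lee_fin mulr_ge0 ?exprn_ge0 ?expR_ge0.
Qed.

Let measurable_xexp n q : measurable_fun setT (xexp n q).
Proof. by apply: continuous_measurable_fun; exact: continuous_xexp. Qed.

Let I_scale n q : 0 < q -> (I n 1 = (Num.sqrt q ^+ n.+1)%:E * I n q)%E.
Proof.
move=> q0; have sq0 : 0 < Num.sqrt q by rewrite sqrtr_gt0.
rewrite /I (integral_scale sq0); [|exact: continuous_xexp|]; last first.
  by move=> x x0; rewrite mulr_ge0 ?expR_ge0// exprn_ge0// ltW.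
rewrite -ge0_integralZl//.
- apply: eq_integral => x _; rewrite -EFinM /xexp; congr (_%:E).
  have -> : (Num.sqrt q * x) ^+ 2 * 1 = x ^+ 2 * q.
    by rewrite mulr1 exprMn sqr_sqrtr ?(ltW q0)// mulrC.
  by move: (expR _) => E; rewrite exprMn exprS; ring.
- by apply: measurable_funTS; apply/measurable_EFinP; exact: measurable_xexp.
- move=> x; rewrite /= in_itv/= andbT => x0.
  by rewrite lee_fin mulr_ge0 ?exprn_ge0 ?expR_ge0.
Qed.

Let I_gauss t : 0 < t -> I 0 (t ^+ 2) = (Num.sqrt pi / (2 * t))%:E.
Proof.
move=> t0; have := I_scale 0 (exprn_gt0 2 t0).
have -> : I 0 1 = (Num.sqrt pi / 2)%:E.
  rewrite -integral0y_gauss; apply: eq_integral => x _.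
  by rewrite /xexp /gauss_fun expr0 mul1r mulr1.
rewrite sqrtr_sqr gtr0_norm// expr1.
case: (I 0 _) (I_ge0 0 (t ^+ 2)) => [r _|_|//]; last by rewrite gt0_muley// lte_fin.
by rewrite -EFinM => -[E]; congr (_%:E); rewrite invfM mulrA E mulrAC divff ?mul1r ?gt_eqF.
Qed.


Let gam m (s : R) : R := Num.sqrt s ^+ m * expR (- s).

Let continuous_gam m : continuous (gam m).
Proof.
move=> x; apply: cvgM; last by apply: (cvg_comp _ expR); [by apply: cvgN; exact: cvg_id|exact: continuous_expR].
by apply: (cvg_comp _ (fun z => z ^+ m)); [exact: sqrt_continuous|exact: exprn_continuous].
Qed.

(** Substitution s = x^2. The absolute value makes the new integrand nonnegative on the whole line,
    which the monotone passage k -> oo uses. *)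
Let integral_gam m (k : nat) :
  (\int[leb]_(s in `[0%R, (k ^ 2)%N%:R]) (gam m s)%:E =
   \int[leb]_(x in `[0%R, k%:R]) (2 * (`|x| ^+ m.+1 * expR (- (x ^+ 2 * 1))))%:E)%E.
Proof.
have dF (x : R) : is_derive x 1 (fun z => z ^+ 2) (2 * x).
  have := is_derive_sqr 1 x; rewrite mul1r.
  by rewrite (_ : (fun z : R => 1 * z ^+ 2) = (fun z => z ^+ 2))//; apply/funext => z; rewrite mul1r.
have F' : derive1 (fun z : R => z ^+ 2) = (fun x => 2 * x).
  by apply/funext => x; rewrite derive1E; exact: derive_val.
have cF : continuous (fun z : R => z ^+ 2) by exact: sqr_continuous.
have c2 : continuous (fun x : R => 2 * x) by move=> x; apply: cvgMr; exact: cvg_id.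
have := @integration_by_substitution_increasing R (fun z => z ^+ 2) (gam m) 0 k%:R.
rewrite expr0n/= F' natrX => ->.
- apply: eq_integral => x; rewrite inE/= in_itv/= => /andP[x0 _].
  congr (_%:E); transitivity (gam m (x ^+ 2) * (2 * x)) => //.
  rewrite /gam sqrtr_sqr ger0_norm// mulr1.
  by move: (expR _) => e; rewrite exprS; ring.
- exact: ler0n.
- move=> x y; rewrite !in_itv/= => /andP[x0 _] _ xy.
  by rewrite ltr_pXn2r// nnegrE// (le_trans x0)// ltW.
- by move=> x _; exact: c2.
- by apply/cvg_ex; exists (2 * 0); apply: cvg_at_right_filter; exact: c2.
- by apply/cvg_ex; exists (2 * k%:R); apply: cvg_at_left_filter; exact: c2.
- split=> [x _| |]; first by have [] := dF x.
  + by apply: cvg_at_right_filter; exact: cF.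
  + by apply: cvg_at_left_filter; exact: cF.
- by apply: continuous_subspaceT; exact: continuous_gam.
Qed.

(** For n >= 1 the exponent (n + 1) / 2 - 1 is nonnegative, so the integrand is continuous at 0: it
    is a power of the square root of s times an exponential. *)
Lemma ge0_integral_Gamma n : (0 < n)%N ->
  (\int[leb]_(s in `]0%R, +oo[) ((s `^ (n.+1%:R / 2 - 1)) * expR (- s))%:E
   = 2%:E * I n 1)%E.
Proof.
case: n => // m _.
have E (s : R) : 0 < s -> s `^ (m.+2%:R / 2 - 1) * expR (- s) = gam m s.
  move=> s0; congr (_ * _).
  rewrite -powR12_sqrt ?(ltW s0)// -powR_mulrn ?powR_ge0// -powRrM; congr (_ `^ _).
  by rewrite -[m.+2%:R]natr1 -[m.+1%:R]natr1; field.
have mgam : measurable_fun setT (gam m) by apply: continuous_measurable_fun; exact: continuous_gam.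
transitivity (\int[leb]_(s in `[0%R, +oo[) (gam m s)%:E)%E.
  rewrite -integral_itv_obnd_cbnd; last by apply: measurable_funTS; exact/measurable_EFinP.
  by apply: eq_integral => s; rewrite inE/= in_itv/= andbT => /E ->.
pose h (x : R) := 2 * (`|x| ^+ m.+1 * expR (- (x ^+ 2 * 1))).
have mh : measurable_fun setT h.
  apply: measurable_funM => //; apply: measurable_funM.
    by apply: measurable_funX; exact: normr_measurable.
  apply: measurableT_comp; first exact: measurable_expR.
  apply: measurable_funN; apply: measurable_funM => //.
have h0 x : 0 <= h x by rewrite !mulr_ge0 ?exprn_ge0 ?expR_ge0.
have g0 x : 0 <= gam m x by rewrite mulr_ge0 ?exprn_ge0 ?expR_ge0 ?sqrtr_ge0.
transitivity (\int[leb]_(x in `[0%R, +oo[) (h x)%:E)%E.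
  have c1 := @ge0_cvgn_integral R leb (gam m) g0 mgam.
  have c2 := @ge0_cvgn_integral R leb h h0 mh.
  have ksq : (fun k => (k ^ 2)%N) n @[n --> \oo] --> \oo.
    apply/cvgnyPge => A; exists A => // k /= Ak.
    by rewrite (leq_trans Ak)// -mulnn; case: (k) => // k'; rewrite leq_pmulr.
  have c3 := cvg_comp _ _ ksq c1.
  have c4 : (fun k : nat => \int[leb]_(x in `[0%R, k%:R]) (h x)%:E)%E @ \oo -->
    (\int[leb]_(x in `[0%R, +oo[) (gam m x)%:E)%E.
    apply: cvg_trans c3; apply: near_eq_cvg; apply: nearW => k /=.
    by rewrite integral_gam.
  exact: (cvg_unique _ c4 c2).
rewrite -ge0_integralZl//.
- apply: eq_integral => x; rewrite inE/= in_itv/= andbT => x0.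
  by rewrite -EFinM /h ger0_norm.
- by apply: measurable_funTS; apply/measurable_EFinP; exact: measurable_xexp.
- move=> x; rewrite /= in_itv/= andbT => x0.
  by rewrite lee_fin mulr_ge0 ?exprn_ge0 ?expR_ge0.
Qed.


(** For fixed x the integral over u is Gaussian and yields (sqrt pi / x)^n, which cancels the factor
    x^n. *)
Let tonelli_gauss n (y : n.-tuple R) t : 0 < t ->
  (\int[lebT R n]_u I n (t ^+ 2 + sqnorm (tsub y u)) =
   (Num.sqrt pi ^+ n)%:E * I 0 (t ^+ 2))%E.
Proof.
move=> t0; pose D : set R := `]0%R, +oo[%classic.
pose h (z : R * n.-tuple R) : R :=
  \1_D z.1 * xexp n (t ^+ 2 + sqnorm (tsub y z.2)) z.1.
have h0 z : 0 <= h z.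
  rewrite /h indicE; case: (boolP (z.1 \in D)); rewrite ?mul0r// mul1r inE /D /= in_itv/= andbT => x0.
  by rewrite mulr_ge0 ?exprn_ge0 ?expR_ge0// ltW.
have mI : measurable_fun setT (\1_D : R -> R) by apply: measurable_indic; exact: measurable_itv.
have mq : measurable_fun setT (fun z : R * n.-tuple R => t ^+ 2 + sqnorm (tsub y z.2)).
  apply: measurable_funD => //.
  exact: (measurableT_comp (measurable_sqnorm_tsubr y) measurable_snd).
have mh : measurable_fun setT (EFin \o h).
  apply/measurable_EFinP; apply: measurable_funM; first exact: (measurableT_comp mI measurable_fst).
  apply: measurable_funM; first by apply: measurable_funX.
  apply: measurableT_comp; first exact: measurable_expR.
  apply: measurable_funN; apply: measurable_funM => //.
  by apply: measurable_funX.
have ID k q : I k q = (\int[leb]_(x in D) (xexp k q x)%:E)%E.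
  rewrite integral_itv_obnd_cbnd//; apply: measurable_funTS; apply/measurable_EFinP.
  exact: measurable_xexp.
have mk (g : R -> \bar R) :
    (\int[leb]_(x in D) g x = \int[leb]_x ((\1_D x)%:E * g x))%E.
  rewrite integral_mkcond; apply: eq_integral => x _.
  by rewrite patchE indicE; case: (x \in D); rewrite ?mul1e ?mul0e.
have ft := @fubini_tonelli _ _ _ _ R leb (lebT R n) (EFin \o h) mh (fun z => h0 z).
transitivity (\int[lebT R n]_u \int[leb]_x (EFin \o h) (x, u))%E.
  by apply: eq_integral => u _; rewrite ID mk; apply: eq_integral => x _; rewrite /= EFinM.
rewrite -ft ID -ge0_integralZl//; last 3 first.
- exact: measurable_itv.
- by apply: measurable_funTS; apply/measurable_EFinP; exact: measurable_xexp.
- by move=> x; rewrite /D /= in_itv/= andbT => x0; rewrite lee_fin mulr_ge0 ?exprn_ge0 ?expR_ge0// ltW.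
rewrite mk; apply: eq_integral => x _.
rewrite indicE; case: (boolP (x \in D)); rewrite ?mul1e ?mul0e; last first.
  by move=> xD; apply: integral0_eq => u _; rewrite /= /h indicE (negbTE xD) mul0r.
move=> xD; have x0 : 0 < x by move: xD; rewrite inE /D /= in_itv/= andbT.
transitivity (\int[lebT R n]_u ((x ^+ n * expR (- (x ^+ 2 * t ^+ 2)))%:E *
    (expR (- (x ^+ 2 * sqnorm (tsub y u))))%:E))%E.
  apply: eq_integral => u _; rewrite /= /h indicE xD mul1r /xexp -EFinM -[X in _ = X%:E]mulrA -expRD /=.
  by congr (_ * expR _)%:E; ring.
have mg : measurable_fun [set: n.-tuple R]
    (fun v => (expR (- (x ^+ 2 * sqnorm (tsub y v))))%:E).
  apply/measurable_EFinP; apply: measurableT_comp; first exact: measurable_expR.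
  by apply: measurable_funN; apply: measurable_funM => //; exact: measurable_sqnorm_tsubr.
rewrite ge0_integralZl//; last first.
  by rewrite lee_fin mulr_ge0 ?exprn_ge0 ?expR_ge0// ltW.
rewrite -intRnE// intRn_gauss ?exprn_gt0// -!EFinM; congr (_%:E).
rewrite /xexp expr0 mul1r.
have -> : Num.sqrt (pi / x ^+ 2) = Num.sqrt pi / x.
  by rewrite sqrtrM ?pi_ge0// sqrtrV ?exprn_ge0 ?(ltW x0)// sqrtr_sqr gtr0_norm.
rewrite exprMn exprVn; move: (expR _) => e; field.
by rewrite expf_neq0// gt_eqF.
Qed.

(** With J the integral of (t^2 + |y - u|^2)^(-(n + 1) / 2), integrating [I n] at t^2 + |y - u|^2
    over u in two ways gives I n 1 times J = pi^((n + 1) / 2) / (2 t), while Gamma((n + 1) / 2) = 2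
    I n 1. *)
Lemma poisson_int n (y : n.-tuple R) t : (0 < n)%N -> 0 < t ->
  (\int[lebT R n]_u (Defs.kernel Poisson t (tsub y u))%:E = 1)%E.
Proof.
move=> n0 t0; pose q u := t ^+ 2 + sqnorm (tsub y u).
have q0 u : 0 < q u by rewrite ltr_wpDr ?exprn_gt0// sumr_ge0// => i _; exact: sqr_ge0.
have sq0 u : 0 < Num.sqrt (q u) ^+ n.+1 by rewrite exprn_gt0// sqrtr_gt0.
have mq : measurable_fun setT q by apply: measurable_funD => //; exact: measurable_sqnorm_tsubr.
pose F u : \bar R := ((Num.sqrt (q u) ^+ n.+1)^-1)%:E.
have half (x : R) : 0 <= x -> x `^ (n.+1%:R / 2) = Num.sqrt x ^+ n.+1.
  by move=> x0; rewrite mulrC powRrM powR12_sqrt// powR_mulrn ?sqrtr_ge0.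
have mF : measurable_fun setT F.
  rewrite (_ : F = EFin \o (fun u => q u `^ (- (n.+1%:R / 2)))).
    by apply/measurable_EFinP; exact: (measurableT_comp (measurable_powR _) mq).
  by apply/funext => u; rewrite /F /= powRN half// ltW.
have F0 u : (0 <= F u)%E by rewrite lee_fin invr_ge0 ltW.
set J := (\int[lebT R n]_u F u)%E.
have EJ : (I n 1 * J = ((Num.sqrt pi ^+ n.+1) / (2 * t))%:E)%E.
  rewrite -ge0_integralZl//; transitivity (\int[lebT R n]_u I n (q u))%E.
    apply: eq_integral => u _; rewrite (I_scale n (q0 u)) muleAC -EFinM.
    by rewrite divff ?mul1e// gt_eqF.
  by rewrite tonelli_gauss// I_gauss// -EFinM exprS; congr (_%:E); field; rewrite gt_eqF.
have rhs : 0 < Num.sqrt pi ^+ n.+1 / (2 * t) :> R.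
  by rewrite divr_gt0 ?mulr_gt0// exprn_gt0// sqrtr_gt0 pi_gt0.
have J0 : (0 <= J)%E by exact: integral_ge0.
(* Finiteness is read off from [EJ]: an infinite factor would make the product 0 or infinite. *)
have [r Ir] : exists r, I n 1 = r%:E.
  case: (I n 1) (I_ge0 n 1) EJ => [r _ _|_|//]; first by exists r.
  move: J0; rewrite le_eqVlt => /predU1P[<-|J0]; last by rewrite gt0_mulye.
  by rewrite mule0 => -[E]; move: rhs; rewrite -E ltxx.
have G : Gamma (n.+1%:R / 2) = 2 * r.
  by rewrite /Gamma ge0_integral_Gamma// Ir.
rewrite /Defs.kernel.
transitivity (\int[lebT R n]_u ((2 * t / Num.sqrt pi ^+ n.+1)%:E * (r%:E * F u)))%E.
  apply: eq_integral => u _; rewrite /F -!EFinM G !half ?pi_ge0 ?(ltW (q0 u))//.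
  congr (_%:E); rewrite -/(q u); field.
  by rewrite !gt_eqF// ?sq0// exprn_gt0// sqrtr_gt0 pi_gt0.
have r0 : (0 <= r%:E)%E by rewrite -Ir I_ge0.
rewrite ge0_integralZl//; last 3 first.
- by apply: emeasurable_funM => //; exact: measurable_cst.
- by move=> u _; apply: mule_ge0.
- by rewrite lee_fin divr_ge0 ?exprn_ge0 ?sqrtr_ge0// mulr_ge0// ltW.
rewrite ge0_integralZl// -/J -Ir EJ -EFinM; congr (_%:E); field.
by rewrite !gt_eqF// ?exprn_gt0// sqrtr_gt0 pi_gt0.
Qed.

End normalization.

Lemma kernel_good (R : realType) (n : nat) (K : kernel_kind) : (0 < n)%N ->
  exists (J : finType) (yj : n.-tuple R -> R -> J -> n.-tuple R) (dj : R -> J -> R),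
  good_kernel (lebT R n) (fun y t u => Defs.kernel K t (tsub y u)) yj dj.
Proof.
move=> n0; case: K.
- by do 3 eexists; apply: poisson_good => y t t0; exact: poisson_int.
- by do 3 eexists; apply: heat_good => y t t0; exact: heat_int.
Qed.

(** * The probability measure with a given density *)

Section density.
Context d (T : measurableType d) (R : realType) (mu : {measure set T -> \bar R}).
Variables (h : T -> R) (h0 : forall x, 0 <= h x) (mh : measurable_fun [set: T] h)
  (h1 : (\int[mu]_x (h x)%:E = 1)%E).

(** The proofs are arguments so that the probability structure can be attached to the definition. *)
Definition density_prob of (forall x, 0 <= h x) & measurable_fun [set: T] h &
    (\int[mu]_x (h x)%:E = 1)%E : set T -> \bar R :=
  fun A => (\int[mu]_(x in A) (h x)%:E)%E.

Local Notation P := (density_prob h0 mh h1).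

Let dens0 : P set0 = 0%E.
Proof. by rewrite /density_prob integral_set0. Qed.

Let dens_ge0 A : (0 <= P A)%E.
Proof. by apply: integral_ge0 => x _; rewrite lee_fin. Qed.

Let dens_sigma_additive : semi_sigma_additive P.
Proof.
move=> /= F mF tF mUF; rewrite /density_prob; apply: cvg_toP.
  apply: ereal_nondecreasing_is_cvgn => m n mn.
  by apply: lee_sum_nneg_natr => // k _ _; exact: dens_ge0.
rewrite ge0_integral_bigcup//=.
- by apply: measurable_funTS; exact/measurable_EFinP.
- by move=> x _; rewrite lee_fin.
Qed.

HB.instance Definition _ := isMeasure.Build _ _ _ P dens0 dens_ge0 dens_sigma_additive.
HB.instance Definition _ := @Measure_isProbability.Build _ _ R P h1.

Lemma integral_density_prob (g : T -> \bar R) :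
  measurable_fun [set: T] g -> (forall x, 0 <= g x)%E ->
  (\int[P]_x g x = \int[mu]_x ((h x)%:E * g x))%E.
Proof.
move=> mg g0; pose s := nnsfun_approx measurableT mg.
have gE x : g x = (limn (fun n => (s n x)%:E))%E.
  by apply/esym/cvg_lim => //; exact: cvg_nnsfun_approx.
transitivity (limn (fun n => \int[P]_x (s n x)%:E))%E.
  under eq_integral do rewrite gE.
  apply: monotone_convergence => //.
  - by move=> n; apply/measurable_EFinP.
  - by move=> n x _; rewrite lee_fin.
  - by move=> x _ a b ab; rewrite lee_fin; exact/lefP/nd_nnsfun_approx.
transitivity (limn (fun n => \int[mu]_x ((h x)%:E * (s n x)%:E)))%E; last first.
  have hgE x : ((h x)%:E * g x = limn (fun n => (h x)%:E * (s n x)%:E))%E.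
    apply/esym/cvg_lim => //; apply: cvgeZl => //.
    by have := @cvg_nnsfun_approx _ _ _ _ measurableT _ mg (fun x _ => g0 x) x I.
  under [RHS]eq_integral do rewrite hgE.
  apply/esym/monotone_convergence => //.
  - by move=> n; apply: emeasurable_funM; exact/measurable_EFinP.
  - by move=> n x _; rewrite mule_ge0 ?lee_fin.
  - move=> x _ a b ab; rewrite lee_wpmul2l ?lee_fin//; exact/lefP/nd_nnsfun_approx.
congr (limn _); apply/funext => n.
have sE x : (s n x)%:E = (\sum_(y \in range (s n)) (y * \1_(s n @^-1` [set y]) x)%:E)%E.
  by rewrite [in LHS]fimfunE fsumEFin.
transitivity (\int[P]_x (\sum_(y \in range (s n)) (y * \1_(s n @^-1` [set y]) x)%:E))%E.
  by apply: eq_integral => x _; exact: sE.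
have indich r : measurable_fun setT (fun x => (r * \1_(s n @^-1` [set r]) x)%:E).
  by apply/measurable_EFinP; exact: measurable_funM.
rewrite ge0_integral_fsum//; last by move=> r y _; exact: nnfun_muleindic_ge0.
transitivity (\int[mu]_x (\sum_(y \in range (s n))
    (h x)%:E * (y * \1_(s n @^-1` [set y]) x)%:E))%E; last first.
  apply: eq_integral => x _; rewrite sE ge0_mule_fsumr// => r.
  exact: nnfun_muleindic_ge0.
rewrite ge0_integral_fsum//; last 2 first.
- by move=> r; apply: emeasurable_funM => //; exact/measurable_EFinP.
- by move=> r x _; rewrite mule_ge0 ?lee_fin// -lee_fin; exact: nnfun_muleindic_ge0.
apply: eq_fsbigr => r /[!inE] -[x0 _ <-]; set A := s n @^-1` _.
have mA : measurable A by exact: measurable_sfunP.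
under eq_integral do rewrite EFinM.
rewrite ge0_integralZl//; last 2 first.
- by apply/measurable_EFinP; exact: measurable_indic.
- by rewrite lee_fin.
rewrite integral_indic// setIT /=.
transitivity ((s n x0)%:E * \int[mu]_x ((h x)%:E * (\1_A x)%:E))%E.
  congr (_ * _)%E; rewrite /density_prob integral_mkcond; apply: eq_integral => x _.
  by rewrite patchE indicE; case: (x \in A); rewrite ?mule1 ?mule0.
rewrite -ge0_integralZl//.
- by apply: eq_integral => x _; rewrite EFinM muleCA.
- apply: emeasurable_funM; first exact/measurable_EFinP.
  by apply/measurable_EFinP; exact: measurable_indic.
- by move=> x _; rewrite mule_ge0 ?lee_fin.
- by rewrite lee_fin.
Qed.

Lemma integral_density_prob_EFin (g : T -> R) : measurable_fun [set: T] g ->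
  (\int[P]_x (g x)%:E = \int[mu]_x (h x * g x)%:E)%E.
Proof.
move=> mg; have mgE : measurable_fun setT (EFin \o g) by exact/measurable_EFinP.
pose hg x := (h x * g x)%:E.
have -> : (\int[mu]_x (h x * g x)%:E = \int[mu]_x hg^\+ x - \int[mu]_x hg^\- x)%E.
  by rewrite -integralE.
have -> : (\int[P]_x (g x)%:E = \int[P]_x (EFin \o g)^\+ x - \int[P]_x (EFin \o g)^\- x)%E.
  by rewrite -integralE.
rewrite (integral_density_prob (measurable_funepos mgE) (funepos_ge0 _)).
rewrite (integral_density_prob (measurable_funeneg mgE) (funeneg_ge0 _)).
congr (_ - _)%E; apply: eq_integral => x _; rewrite /hg.
- by rewrite !funeposE -EFin_max -EFinM maxr_pMr// mulr0 EFin_max.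
- by rewrite !funenegE -!EFinN -!EFin_max -EFinM maxr_pMr// mulr0 mulrN EFin_max.
Qed.

End density.

(** * Quantile functions and monotone rearrangement *)

Lemma finite_measure_rays (R : realType) (m1 m2 : {measure set (measurableTypeR R) -> \bar R}) :
  (forall x, m1 `]x, +oo[%classic = m2 `]x, +oo[%classic) ->
  (m1 setT < +oo)%E ->
  forall A, measurable A -> m1 A = m2 A.
Proof.
move=> m12 moo A mA.
apply: (@measure_unique _ R (measurableTypeR R) (@RGenOInfty.G R) (fun k => `](- k%:R)%R, +oo[%classic)) => //.
- exact: RGenOInfty.measurableE.
- move=> _ _ [x ->] [y ->]; exists (Num.max x y); apply/seteqP; split => z /=;
    rewrite !in_itv/= !andbT gt_max.
  + by move=> [-> ->].
  + by move=> /andP[].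
- by move=> i; exists (- i%:R).
- apply/seteqP; split => // x _; exists (Num.truncn (- x)).+1 => //=.
  by rewrite in_itv/= andbT ltrNl truncnS_gt.
- by move=> _ [x ->].
- by move=> k; apply: le_lt_trans moo; apply: le_measure; rewrite ?inE//; exact: measurable_itv.
Qed.

Section quantile.
Context d (T : measurableType d) (R : realType) (P : probability T R) (X : {RV P >-> R}).
Variable x0 : R.

(** [x0] is the value outside ]0,1[, where the infimum may be that of an empty or unbounded set. *)
Definition quantile (s : R) : R :=
  if 0 < s < 1 then inf [set x | (s%:E <= cdf X x)%E] else x0.

Let F (x : R) : R := fine (cdf X x).

Let FE x : (F x)%:E = cdf X x.
Proof. by rewrite fineK// /cdf fin_num_measure. Qed.

Let F_nd x y : x <= y -> F x <= F y.
Proof. by move=> xy; rewrite -lee_fin !FE cdf_nondecreasing. Qed.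

(** The Galois connection between quantile and distribution function; the forward direction comes
    from right continuity of the latter. *)
Lemma quantile_le s x : 0 < s < 1 -> (quantile s <= x) = (s%:E <= cdf X x)%E.
Proof.
move=> s01; rewrite /quantile s01; move/andP: s01 => [s0 s1].
set S := [set x | _]; have SE y : S y <-> s <= F y by rewrite /S /= -FE lee_fin.
have [y0 y0s] : exists y, F y < s.
  have : F y @[y --> -oo] --> (0 : R).
    by apply: fine_cvg; exact: cvg_cdfNy0.
  move/cvgr_lt => /(_ _ s0) [M [_ FM]]; exists (M - 1); apply: FM.
  by rewrite gtrBl.
have [y1 y1s] : exists y, s <= F y.
  have : F y @[y --> +oo] --> (1 : R).
    by apply: fine_cvg; exact: cvg_cdfy1.
  move/cvgr_gt => /(_ _ s1) [M [_ FM]]; exists (M + 1); apply/ltW/FM.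
  by rewrite ltrDl.
have lbS : has_lbound S.
  exists y0 => y /SE sy; rewrite leNgt; apply/negP => /ltW /F_nd.
  by rewrite leNgt (lt_le_trans y0s).
have neS : S !=set0 by exists y1; apply/SE.
apply/idP/idP => [le|sF]; last by apply: ge_inf.
rewrite -FE lee_fin; apply/ler_addgt0Pl => e e0; rewrite -lerBlDl.
have : F y @[y --> x^'+] --> F x.
  by apply: fine_cvg; rewrite FE; exact: cdf_right_continuous.
move/cvgr_lt => /(_ (F x + e)); rewrite ltrDl => /(_ e0) [h /= h0 hF].
have [y Sy yx] := inf_adherent (divr_gt0 h0 (ltr0n R 2)) (conj neS lbS).
rewrite lerBlDl addrC; apply/ltW; apply: le_lt_trans (hF (x + h / 2) _ _).
- apply: le_trans (F_nd _); [exact/SE/Sy|].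
  by apply/ltW/(lt_le_trans yx); rewrite lerD2r.
- by rewrite /ball_/= opprD addNKr normrN gtr0_norm ?divr_gt0// ltr_pdivrMr// ltr_pMr// ltr1n.
- by rewrite /= ltrDl divr_gt0.
Qed.

Lemma quantile_nd : {in `]0, 1[ &, nondecreasing quantile}.
Proof.
move=> s t /[!in_itv]/= s01 t01 st.
have := lexx (quantile t); rewrite !quantile_le// => /(le_trans _); apply.
by rewrite lee_fin.
Qed.

Let quantile_gt x : quantile @^-1` `]x, +oo[ `&` `]0, 1[%classic = `]F x, 1[%classic `&` `]0, 1[%classic.
Proof.
have qE s : 0 < s < 1 -> (x < quantile s) = (F x < s).
  by move=> s01; rewrite ltNge quantile_le// -FE lee_fin -ltNge.
apply/seteqP; split => s /=; rewrite !in_itv/= andbT => -[+ s01]; rewrite qE//.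
- by move=> h; split => //; rewrite h; case/andP: s01.
- by case/andP.
Qed.

Lemma measurable_quantile : measurable_fun [set: measurableTypeR R] quantile.
Proof.
apply: (measurability (@RGenOInfty.G R)) => [|_ [_ [x ->] <-]].
  exact: RGenOInfty.measurableE.
rewrite setTI.
pose I := `]0%R, 1%R[%classic : set R.
rewrite -[X in measurable X]setIT -(setUv I) setIUr; apply: measurableU.
  by rewrite quantile_gt; apply: measurableI; exact: measurable_itv.
have mI : measurable (~` I) by apply: measurableC; exact: measurable_itv.
have [xx0|xx0] := ltP x x0.
- rewrite (_ : _ `&` _ = ~` I)//; apply/seteqP; split => s /=; rewrite !in_itv/=; first by case.
  by move=> sI; split => //; rewrite /quantile; case: ifP => // _; rewrite xx0.
- rewrite (_ : _ `&` _ = set0)//; apply/seteqP; split => s //=; rewrite !in_itv/= => -[+ sI].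
  by rewrite /quantile; case: ifP => // _; rewrite andbT ltNge xx0.
Qed.

(* Inverse transform sampling. *)
Lemma integral_quantile (g : R -> \bar R) :
  measurable_fun [set: R] g -> (forall x, 0 <= g x)%E ->
  (\int[P]_u g (X u) = \int[lebesgue_measure]_(s in `[0%R, 1%R]) g (quantile s))%E.
Proof.
move=> mg g0; have lt01 : (0 < 1 :> R) by [].
pose U := uniform_prob lt01.
have UE h : measurable_fun [set: R] h -> (forall x, 0 <= h x)%E ->
   (\int[U]_s h s = \int[lebesgue_measure]_(s in `[0%R, 1%R]) h s)%E.
  by move=> mh h0; rewrite integral_uniform// subr0 invr1 mul1e.
have mX : measurable_fun [set: T] (X : T -> measurableTypeR R) by have := @measurable_funPT _ _ _ _ X.
pose m10 : {measure set (measurableTypeR R) -> \bar R} :=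
  pushforward P (X : T -> measurableTypeR R).
pose m1 := m10 mX.
pose m20 : {measure set (measurableTypeR R) -> \bar R} :=
  pushforward U (quantile : measurableTypeR R -> measurableTypeR R).
pose m2 := m20 measurable_quantile.
(* Both laws give the ray the mass 1 - F x, and rays determine a finite measure. *)
have m12 x : m1 `]x, +oo[%classic = m2 `]x, +oo[%classic.
  rewrite /m1 /m10 /m2 /m20 /= /pushforward.
  set A := quantile @^-1` _.
  have mA : measurable A.
    by rewrite -[A]setTI; apply: measurable_quantile => //; exact: measurable_itv.
  have -> : P (X @^-1` `]x, +oo[) = (1 - F x)%:E.
    rewrite (_ : _ @^-1` _ = ~` (X @^-1` `]-oo, x])); last first.
      by apply/seteqP; split => u /=; rewrite !in_itv/= andbT ltNge => /negP.
    rewrite probability_setC; last by have := mX measurableT _ (measurable_itv `]-oo, x]); rewrite setTI.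
    by rewrite EFinB FE.
  transitivity (\int[U]_s (\1_A s)%:E)%E; last by rewrite integral_indic// setIT.
  rewrite UE; last 2 first.
  - by apply/measurable_EFinP; exact: (measurable_indic mA).
  - by move=> s; rewrite lee_fin.
  rewrite integral_itv_bndoo; last first.
    by apply: measurable_funTS; apply/measurable_EFinP; exact: (measurable_indic mA).
  rewrite integral_indic//.
  rewrite quantile_gt setIidl; last first.
    move=> s /=; rewrite !in_itv/= => /andP[Fs ->]; rewrite andbT.
    by apply: le_lt_trans Fs; rewrite -lee_fin FE cdf_ge0.
  rewrite /= lebesgue_measure_itv/= lte_fin; case: ltP => [//|F1].
  have /eqP-> : F x == 1 by rewrite eq_le F1 andbT -lee_fin FE cdf_le1.
  by rewrite subrr.
have m1oo : (m1 setT < +oo)%E by rewrite /m1 /m10 /= /pushforward preimage_setT probability_setT ltry.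
transitivity (\int[m1]_x g x)%E.
  by rewrite /m1 /m10 /= ge0_integral_pushforward.
transitivity (\int[m2]_x g x)%E.
  by apply: eq_measure_integral => A mA _; exact: finite_measure_rays.
transitivity (\int[U]_s g (quantile s))%E.
  by rewrite /m2 /m20 /= ge0_integral_pushforward//; exact: measurable_quantile.
apply: (UE (g \o quantile)); last by move=> s; exact: g0.
by apply: measurableT_comp => //; exact: measurable_quantile.
Qed.

End quantile.

(* [subgrad D phi] is convexity of [phi] on [D], in the form Jensen's inequality uses. *)
Definition subgrad (R : realType) (D : set R) (phi : R -> R) : Prop :=
  forall y, D y -> exists c, forall x, D x -> phi y + c * (x - y) <= phi x.

(** * Convexity through supporting lines *)

Section convexity.
Context (R : realType) (D : set R) (phi : R -> R).
Hypothesis cphi : subgrad D phi.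

Lemma subgrad_chord x y z : D y -> D x -> D z -> x <= y -> y <= z ->
  (z - x) * phi y <= (z - y) * phi x + (y - x) * phi z.
Proof.
move=> Dy Dx Dz xy yz; have [c cP] := cphi Dy.
have h1 : 0 <= (z - y) * (phi x - (phi y + c * (x - y))).
  by rewrite mulr_ge0 ?subr_ge0 ?cP.
have h2 : 0 <= (y - x) * (phi z - (phi y + c * (z - y))).
  by rewrite mulr_ge0 ?subr_ge0 ?cP.
rewrite -subr_ge0; apply: le_trans (addr_ge0 h1 h2) _.
by rewrite le_eqVlt; apply/orP; left; apply/eqP; ring.
Qed.

(** Both slopes are compared with that of the chord from x1 to y2; denominators are cleared. *)
Lemma subgrad_slope x1 y1 x2 y2 : D x1 -> D y1 -> D x2 -> D y2 ->
  x1 <= x2 -> y1 <= y2 -> x1 < y1 -> x2 < y2 ->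
  (phi y1 - phi x1) * (y2 - x2) <= (phi y2 - phi x2) * (y1 - x1).
Proof.
move=> Dx1 Dy1 Dx2 Dy2 x12 y12 xy1 xy2.
have L : 0 < y2 - x1 by rewrite subr_gt0 (lt_le_trans xy1).
have c1 := subgrad_chord Dy1 Dx1 Dy2 (ltW xy1) y12.
have c2 := subgrad_chord Dx2 Dx1 Dy2 x12 (ltW xy2).
rewrite -(ler_pM2l L).
have k1 : 0 <= (y2 - x2) * ((y2 - y1) * phi x1 + (y1 - x1) * phi y2 - (y2 - x1) * phi y1).
  by rewrite mulr_ge0 ?subr_ge0// ltW.
have k2 : 0 <= (y1 - x1) * ((y2 - x2) * phi x1 + (x2 - x1) * phi y2 - (y2 - x1) * phi x2).
  by rewrite mulr_ge0 ?subr_ge0// ltW.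
rewrite -subr_ge0; apply: le_trans (addr_ge0 k1 k2) _.
by rewrite le_eqVlt; apply/orP; left; apply/eqP; ring.
Qed.

End convexity.

Lemma expR_tangent (R : realType) (y x : R) :
  expR y + expR y * (x - y) <= expR x.
Proof.
have -> : expR x = expR y * expR (x - y) by rewrite -expRD; congr expR; ring.
rewrite -[X in X + _]mulr1 -mulrDr ler_pM2l ?expR_gt0//.
exact: expR_ge1Dx.
Qed.

(** Homogeneity reduces to y = 1, where x^(-q) = exp(-q ln x) >= 1 - q ln x >= 1 - q (x - 1). *)
Lemma powRN_tangent (R : realType) (q y x : R) : 0 <= q -> 0 < y -> 0 < x ->
  y `^ (- q) + (- q * y `^ (- q) / y) * (x - y) <= x `^ (- q).
Proof.
move=> q0 y0 x0.
have -> : x `^ (- q) = y `^ (- q) * (x / y) `^ (- q).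
  rewrite -powRM ?(ltW y0) ?divr_ge0 ?(ltW x0) ?(ltW y0)//; congr (_ `^ _).
  by field; rewrite gt_eqF.
have -> : y `^ (- q) + - q * y `^ (- q) / y * (x - y) = y `^ (- q) * (1 - q * (x / y - 1)).
  by field; rewrite gt_eqF.
rewrite ler_pM2l ?powR_gt0//.
have xy0 : 0 < x / y by rewrite divr_gt0.
rewrite /powR gt_eqF//.
apply: le_trans (expR_ge1Dx _); rewrite lerD2l mulNr lerN2 ler_wpM2l//.
rewrite -ler_expR lnK ?posrE//; apply: le_trans (expR_ge1Dx _).
by rewrite addrC subrK.
Qed.

(** * Truncating a function under a probability measure *)

Section truncation.
Context d (T : measurableType d) (R : realType) (P : probability T R).
Implicit Types g : T -> R.
Local Notation intg g := (P.-integrable setT (EFin \o g)).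
Local Notation E g := (\int[P]_u g u).

Lemma Rintegral_prob_cst (c : R) : E (fun=> c) = c.
Proof. by rewrite Rintegral_cst//= probability_setT mulr1. Qed.

Lemma integrable_prob_cst (c : R) : intg (fun=> c).
Proof. by apply: finite_measure_integrable_cst. Qed.

Lemma Rintegral_prob_ge (c : R) g : intg g -> (forall u, c <= g u) -> c <= E g.
Proof.
move=> ig cg; rewrite -[leLHS]Rintegral_prob_cst; apply: le_Rintegral => //.
exact: integrable_prob_cst.
Qed.

Lemma Rintegral_prob_le (c : R) g : intg g -> (forall u, g u <= c) -> E g <= c.
Proof.
move=> ig cg; rewrite -[leRHS]Rintegral_prob_cst; apply: le_Rintegral => //.
exact: integrable_prob_cst.
Qed.

Lemma Rintegral_gt0 (mu : {measure set T -> \bar R}) (B A : set T) g :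
  measurable B -> measurable A -> A `<=` B -> mu.-integrable B (EFin \o g) ->
  (forall u, B u -> 0 <= g u) -> (forall u, A u -> 0 < g u) -> (0 < mu A)%E ->
  0 < \int[mu]_(u in B) g u.
Proof.
move=> mB mA AB ig g0 gA PA; rewrite lt_neqAle Rintegral_ge0 ?andbT//.
apply/eqP => /esym Eg0.
have Eg : (\int[mu]_(u in B) `|(g u)%:E| = 0)%E.
  rewrite (eq_integral (EFin \o g)); last first.
    by move=> u /[!inE] Bu; rewrite gee0_abs ?lee_fin// g0.
  by rewrite -[LHS]fineK ?(integrable_fin_num mB ig)//; congr (_%:E).
have /(ae_eq_integral_abs mu mB) := Eg.
case; first exact: measurable_int ig.
move=> N [mN PN sN].
suff : (mu A <= mu N)%E by rewrite PN leNgt PA.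
apply: le_measure; rewrite ?inE// => u Au; apply: sN => /= /(_ (AB _ Au)) [] /eqP.
by rewrite gt_eqF ?gA.
Qed.

(* Replacing [rho] on [A] by the constant [c], in terms of the conditional mean [r] of [rho]
   given [A]. *)
Lemma trunc_jensen (phi : R -> R) (rho rho' : T -> R) (A : set T) (c r k : R) :
  measurable A -> intg rho -> intg rho' -> intg (phi \o rho) -> intg (phi \o rho') ->
  (forall u, A u -> rho' u = c) -> (forall u, ~ A u -> rho' u = rho u) ->
  fine (P A) * (c - r) = E rho' - E rho ->
  (forall u, phi r + k * (rho u - r) <= phi (rho u)) ->
  fine (P A) * (phi r - phi c) <= E (phi \o rho) - E (phi \o rho').
Proof.
move=> mA i1 i2 i3 i4 rA rN Er tg; set th := fine (P A).
have iA : intg (\1_A : T -> R) by exact: integrable_indic.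
have EA : E (\1_A : T -> R) = th by rewrite /Rintegral integral_indic// setIT.
pose s := phi r - phi c + k * (c - r).
have i5 : intg (fun u => s * \1_A u) by exact: (integrableZl measurableT s iA).
have i6 : intg (fun u => rho u - rho' u) by exact: (integrableB measurableT i1 i2).
have i7 : intg (fun u => k * (rho u - rho' u)) by exact: (integrableZl measurableT k i6).
have -> : th * (phi r - phi c) = E (fun u => s * \1_A u + k * (rho u - rho' u)).
  rewrite RintegralD// RintegralZl// RintegralZl// RintegralB// EA.
  have -> : E rho - E rho' = - (th * (c - r)) by rewrite Er; ring.
  by rewrite /s; ring.
rewrite -RintegralB//; apply: le_Rintegral => //.
- by have := integrableD measurableT i5 i7.
- exact: (integrableB measurableT i3 i4).
move=> u _; rewrite indicE; case: (pselect (A u)) => Au.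
- by rewrite mem_set// mulr1 /= rA// /s; have := tg u; lra.
- by rewrite memNset// mulr0 add0r /= rN// !subrr mulr0.
Qed.

End truncation.

(** One domain for both cases: [true] is finite p, with powers on the half-line; [false] is p = oo,
    with logarithms on the whole line. *)
Definition dom (R : realType) (pos : bool) : set R := [set x : R | pos -> 0 < x].

Section truncation_mean.
Context d (T : measurableType d) (R : realType) (P : probability T R) (pos : bool).
Local Notation intg g := (P.-integrable setT (EFin \o g)).
Local Notation E g := (\int[P]_u g u).
Local Notation D := (@dom R pos).

(** Here th = P(A), and r is the conditional mean of rho given A, or c when A is null. *)
Lemma trunc_mean (phi : R -> R) (rho rho' : T -> R) (A : set T) (c : R) :
  subgrad D phi -> D c -> (forall u, D (rho u)) ->
  measurable A -> intg rho -> intg rho' -> intg (phi \o rho) -> intg (phi \o rho') ->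
  (forall u, A u -> rho' u = c) -> (forall u, ~ A u -> rho' u = rho u) ->
  exists r th, [/\ D r, 0 <= th <= 1, th * (c - r) = E rho' - E rho &
    th * (phi r - phi c) <= E (phi \o rho) - E (phi \o rho')].
Proof.
move=> cphi Dc Drho mA i1 i2 i3 i4 rA rN; pose th := fine (P A).
have th01 : 0 <= th <= 1.
  by rewrite -!lee_fin fineK ?fin_num_measure// probability_le1// andbT.
have iA : intg (\1_A : T -> R) by exact: integrable_indic.
have EA : E (\1_A : T -> R) = th by rewrite /Rintegral integral_indic// setIT.
have mI : measurable_fun setT (\1_A : T -> R) by exact: measurable_indic.
have m1 : measurable_fun setT rho by apply/measurable_EFinP; exact: measurable_int i1.
pose g u := \1_A u * rho u.
have ig : intg g.
  apply: le_integrable i1 => //.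
    by apply/measurable_EFinP; exact: measurable_funM.
  move=> u _; rewrite /g /= lee_fin indicE; case: (_ \in _); rewrite ?mul1r// mul0r normr0//.
have icA : intg (fun u => c * \1_A u) by exact: (integrableZl measurableT c iA).
have EB : E rho' - E rho = c * th - E g.
  rewrite -RintegralB// -EA -RintegralZl// -RintegralB//; apply: eq_Rintegral => u _.
  rewrite /g indicE; case: (pselect (A u)) => Au.
  - by rewrite mem_set// mulr1 mul1r rA.
  - by rewrite memNset// mulr0 mul0r rN// !subrr.
have [th0|th0] := eqVneq th 0.
  have PA0 : P A = 0%E by rewrite -[LHS]fineK ?fin_num_measure// -/th th0.
  have Eg : E g = 0.
    rewrite (_ : E g = \int[P]_(u in A) rho u).
      rewrite /Rintegral null_set_integral//.
      by apply/measurable_EFinP; exact: measurable_funTS.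
    rewrite [RHS]Rintegral_mkcond; apply: eq_Rintegral => u _.
    by rewrite /g patchE indicE; case: (_ \in _); rewrite ?mul1r ?mul0r.
  have [k kP] := cphi _ Dc.
  exists c, th; split => //; first by rewrite EB th0 Eg; ring.
  apply: (@trunc_jensen _ _ _ P phi rho rho' A c c k) => //; last by move=> u; exact: kP.
  by rewrite -/th EB th0 Eg; ring.
have th_gt0 : 0 < th by rewrite lt_neqAle eq_sym th0; case/andP: th01.
pose r := E g / th.
have Dr : D r.
  move=> ps; rewrite divr_gt0//.
  have PA : (0 < P A)%E by rewrite -[ltRHS]fineK ?fin_num_measure// lte_fin.
  apply: (Rintegral_gt0 measurableT mA (@subsetT _ _) ig _ _ PA) => u; rewrite /g indicE.
    by rewrite mulr_ge0// ltW// Drho.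
  by move=> Au; rewrite mem_set// mul1r; exact: Drho.
have [k kP] := cphi _ Dr.
have Er : th * (c - r) = E rho' - E rho by rewrite EB /r; field.
exists r, th; split => //.
by apply: (@trunc_jensen _ _ _ P phi rho rho' A c r k) => // u; exact: kP.
Qed.

End truncation_mean.

Section truncation_curves.
Context (R : realType).
Implicit Types th a c r m delta q : R.

Let slope_pos (D : set R) phi x1 y1 x2 y2 th : subgrad D phi ->
  D x1 -> D y1 -> D x2 -> D y2 -> x1 <= x2 -> y1 <= y2 -> x2 < y2 ->
  x1 < y1 -> y2 - x2 = th * (y1 - x1) ->
  th * (phi y1 - phi x1) <= phi y2 - phi x2.
Proof.
move=> cphi Dx1 Dy1 Dx2 Dy2 x12 y12 xy2 xy1 eth.
have L : 0 < y1 - x1 by rewrite subr_gt0.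
have := subgrad_slope cphi Dx1 Dy1 Dx2 Dy2 x12 y12 xy1 xy2.
by rewrite eth mulrA ler_pM2r// mulrC.
Qed.

Let slope_pos2 (D : set R) phi x1 y1 x2 y2 th : subgrad D phi ->
  D x1 -> D y1 -> D x2 -> D y2 -> x1 <= x2 -> y1 <= y2 -> x1 < y1 ->
  x2 < y2 -> y1 - x1 = th * (y2 - x2) ->
  phi y1 - phi x1 <= th * (phi y2 - phi x2).
Proof.
move=> cphi Dx1 Dy1 Dx2 Dy2 x12 y12 xy1 xy2 eth.
have L : 0 < y2 - x2 by rewrite subr_gt0.
have := subgrad_slope cphi Dx1 Dy1 Dx2 Dy2 x12 y12 xy1 xy2.
by rewrite eth mulrA ler_pM2r// mulrC.
Qed.

Let D0 := @dom R true.
Let D1 := @dom R false.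

Lemma subgrad_powRN q : 0 < q -> subgrad D0 (fun x => x `^ (- q)).
Proof.
move=> q0 y /(_ isT) y0; exists (- q * y `^ (- q) / y) => x /(_ isT) x0.
by apply: powRN_tangent => //; exact: ltW.
Qed.

Lemma subgrad_expR : subgrad D1 (@expR R).
Proof. by move=> y _; exists (expR y) => x _; exact: expR_tangent. Qed.

Lemma powRN_nincr q x y : 0 < q -> 0 < x -> x <= y -> y `^ (- q) <= x `^ (- q).
Proof.
move=> q0 x0 xy; have y0 := lt_le_trans x0 xy.
rewrite !powRN lef_pV2 ?posrE ?powR_gt0//; apply: ge0_ler_powR => //; rewrite ?nnegrE ltW//.
Qed.

(** The delicate side for powers: raising the mean from m to m' lowers the right-hand side
    [delta phi(m')]. Scaling by l = m' / a carries [r,a] to [l r, m'], whose slope is compared with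
    that of [m,m']; the last hypothesis says delta l^(-q) < 1 and so absorbs delta. *)
Lemma trunc_lo_powR q delta th a r m m' : 0 < q -> 1 <= delta -> 0 < th <= 1 ->
  0 < r -> r < a -> 0 < m -> a <= m' -> th * (a - r) = m' - m ->
  delta * m' `^ (- q) < a `^ (- q) ->
  delta * (m `^ (- q) - m' `^ (- q)) <= th * (r `^ (- q) - a `^ (- q)).
Proof.
move=> q0 d1 /andP[th0 th1] r0 ra m0 am' em dl.
have a0 := lt_trans r0 ra; have m'0 := lt_le_trans a0 am'.
pose l := m' / a; have l1 : 1 <= l by rewrite ler_pdivlMr// mul1r.
have l0 := lt_le_trans ltr01 l1.
have m'E : m' = l * a by rewrite /l divfK// gt_eqF.
pose Q := l `^ (- q); have Q0 : 0 < Q by exact: powR_gt0.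
have pE x : 0 < x -> (l * x) `^ (- q) = Q * x `^ (- q).
  by move=> x0; rewrite powRM// ltW.
have dQ : delta * Q < 1.
  by move: dl; rewrite m'E pE// mulrA -[ltRHS]mul1r ltr_pM2r ?powR_gt0.
have mm' : m < m' by rewrite -subr_gt0 -em mulr_gt0// subr_gt0.
have lrm : l * r <= m.
  have -> : m = m' - th * (a - r) by rewrite em; ring.
  rewrite m'E -subr_ge0 (_ : _ - _ = (l - th) * (a - r)); last by ring.
  by rewrite mulr_ge0 ?subr_ge0 ?(ltW ra)// (le_trans th1).
have S : m' - m = th / l * (m' - l * r).
  by rewrite -em m'E; field; rewrite gt_eqF.
have := @slope_pos D0 (fun x => x `^ (- q)) (l * r) m' m m' (th / l)
  (subgrad_powRN q0).
move=> /(_ (fun _ => mulr_gt0 l0 r0) (fun _ => m'0) (fun _ => m0) (fun _ => m'0) lrm (lexx _) mm').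
have lrm' : l * r < m' by rewrite m'E ltr_pM2l.
move=> /(_ lrm' S) /=; rewrite pE//.
have -> : m' `^ (- q) = Q * a `^ (- q) by rewrite m'E pE.
rewrite -mulrBr => H.
have k0 : 0 <= r `^ (- q) - a `^ (- q) by rewrite subr_ge0 powRN_nincr// ltW.
apply: (@le_trans _ _ (delta * (th / l * (Q * (r `^ (- q) - a `^ (- q)))))).
  rewrite ler_pM2l ?(lt_le_trans ltr01)//; move: H.
  rewrite -[_ - a `^ _]opprB mulrN mulrN; move: (th / l * _) => X H; lra.
rewrite (_ : delta * _ = (delta * Q / l) * (th * (r `^ (- q) - a `^ (- q)))); last first.
  by field; rewrite gt_eqF.
rewrite -[leRHS]mul1r; apply: ler_wpM2r; first by rewrite mulr_ge0// ltW.
by rewrite ler_pdivrMr// mul1r (le_trans (ltW dQ)).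
Qed.

(** The easy side: phi(m) - phi(m') <= 0, so the factor delta >= 1 only helps and slopes are
    compared directly. *)
Lemma trunc_hi_powR q delta th b r m m' : 0 < q -> 1 <= delta -> 0 < th <= 1 ->
  0 < b -> b < r -> 0 < m' -> m' <= b -> th * (b - r) = m' - m ->
  delta * (m `^ (- q) - m' `^ (- q)) <= th * (r `^ (- q) - b `^ (- q)).
Proof.
move=> q0 d1 /andP[th0 th1] b0 br m'0 mb' em.
have r0 := lt_trans b0 br.
have em2 : m - m' = th * (r - b) by rewrite -(opprB m') -em; ring.
have mm' : m' < m by rewrite -subr_gt0 em2 mulr_gt0// subr_gt0.
have mr : m <= r.
  have -> : m = m' + th * (r - b) by rewrite -em2; ring.
  rewrite -subr_ge0 (_ : _ - _ = (b - m') + (1 - th) * (r - b)); last by ring.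
  by rewrite addr_ge0 ?mulr_ge0 ?subr_ge0// ltW.
have m0 := lt_trans m'0 mm'.
have H := @slope_pos2 D0 (fun x => x `^ (- q)) m' m b r th (subgrad_powRN q0)
  (fun _ => m'0) (fun _ => m0) (fun _ => b0) (fun _ => r0) mb' mr mm' br em2.
apply: le_trans H; rewrite -[leRHS]mul1r ler_wnM2r// subr_le0.
by apply: powRN_nincr => //; exact: ltW.
Qed.

Lemma trunc_lo_expR delta th a r m m' : 1 <= delta -> 0 < th <= 1 ->
  r < a -> a <= m' -> th * (a - r) = m' - m ->
  delta * (expR m - expR m') <= th * (expR r - expR a).
Proof.
move=> d1 /andP[th0 th1] ra am' em.
have mm' : m < m' by rewrite -subr_gt0 -em mulr_gt0// subr_gt0.
have rm : r <= m.
  have -> : m = m' - th * (a - r) by rewrite em; ring.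
  rewrite -subr_ge0 (_ : _ - _ = (m' - a) + (1 - th) * (a - r)); last by ring.
  by rewrite addr_ge0 ?mulr_ge0 ?subr_ge0// ltW.
have triv x : D1 x by [].
have H := @slope_pos D1 expR r a m m' th subgrad_expR (triv _) (triv _) (triv _) (triv _)
  rm am' mm' ra (esym em).
apply: (@le_trans _ _ (expR m - expR m')).
  by rewrite -[leRHS]mul1r ler_wnM2r// subr_le0 ler_expR ltW.
rewrite -lerN2 opprB; apply: le_trans H.
by rewrite le_eqVlt; apply/orP; left; apply/eqP; ring.
Qed.

(** For the increasing exponential the delicate side is the upper one, and translation by l = b - m'
    takes the place of scaling. *)
Lemma trunc_hi_expR delta th b r m m' : 0 < delta -> 0 < th <= 1 ->
  b < r -> m' <= b -> th * (b - r) = m' - m -> delta * expR m' < expR b ->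
  delta * (expR m - expR m') <= th * (expR r - expR b).
Proof.
move=> d0 /andP[th0 th1] br mb' em dl.
have em2 : m - m' = th * (r - b) by rewrite -(opprB m') -em; ring.
have mm' : m' < m by rewrite -subr_gt0 em2 mulr_gt0// subr_gt0.
pose l := b - m'.
have mr : m <= r - l.
  have -> : m = m' + th * (r - b) by rewrite -em2; ring.
  rewrite -subr_ge0 (_ : _ - _ = (1 - th) * (r - b)); last by rewrite /l; ring.
  by rewrite mulr_ge0 ?subr_ge0// ltW.
have triv x : D1 x by [].
have m'E : m' = b - l by rewrite /l; ring.
have S : m - m' = th * (r - l - (b - l)) by rewrite em2; ring.
have brl : b - l < r - l by rewrite ltrD2r.
have := @slope_pos2 D1 expR m' m (b - l) (r - l) th subgrad_expR
  (triv _) (triv _) (triv _) (triv _).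
rewrite -{1}m'E lexx => /(_ isT mr mm' brl S).
rewrite !expRD -mulrBl => H.
apply: (@le_trans _ _ (delta * (th * ((expR r - expR b) * expR (- l))))).
  by rewrite ler_pM2l.
rewrite (_ : delta * _ = delta * expR (- l) * (th * (expR r - expR b))); last by ring.
rewrite -[leRHS]mul1r ler_wpM2r ?mulr_ge0 ?(ltW th0) ?subr_ge0 ?ler_expR ?(ltW br)//.
rewrite -(ler_pM2r (expR_gt0 b)) mul1r -mulrA -expRD (_ : - l + b = m'); last by rewrite /l; ring.
exact: ltW.
Qed.

End truncation_curves.

(** * Clipping preserves the reverse Jensen inequality *)

Definition clip (R : realType) (a b x : R) : R := Num.min (Num.max x a) b.

Section clip.
Context d (T : measurableType d) (R : realType) (P : probability T R).
Local Notation intg g := (P.-integrable setT (EFin \o g)).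
Local Notation E g := (\int[P]_u g u).

(** By contradiction: [trunc_mean] reduces the claim to an inequality between th, r and the two
    means, for which the failure of the conclusion is available as a hypothesis. *)
Let trunc_ineq pos (phi : R -> R) (rho rho' : T -> R) (A : set T) (c delta : R) :
  subgrad (@dom R pos) phi -> dom pos c -> (forall u, dom pos (rho u)) ->
  measurable A -> intg rho -> intg rho' -> intg (phi \o rho) -> intg (phi \o rho') ->
  (forall u, A u -> rho' u = c) -> (forall u, ~ A u -> rho' u = rho u) ->
  (forall th r, 0 < th <= 1 -> dom pos r -> r != c -> th * (c - r) = E rho' - E rho ->
    delta * phi (E rho') < E (phi \o rho') ->
    delta * (phi (E rho) - phi (E rho')) <= th * (phi r - phi c)) ->
  E (phi \o rho) <= delta * phi (E rho) -> E (phi \o rho') <= delta * phi (E rho').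
Proof.
move=> cphi Dc Drho mA i1 i2 i3 i4 rA rN step le; rewrite leNgt; apply/negP => lt.
have [r [th [Dr /andP[th0 th1] em J]]] := trunc_mean cphi Dc Drho mA i1 i2 i3 i4 rA rN.
have [z|nz] := eqVneq (th * (r - c)) 0.
  have mE : E rho' = E rho.
    by apply/eqP; rewrite -subr_eq0 -em -opprB mulrN z oppr0.
  have : 0 <= E (phi \o rho) - E (phi \o rho').
    move: J z => /[swap] /eqP; rewrite mulf_eq0 subr_eq0 => /orP[/eqP ->|/eqP ->].
      by rewrite mul0r.
    by rewrite subrr mulr0.
  by rewrite subr_ge0 leNgt (le_lt_trans le)// -mE.
move: nz; rewrite mulf_eq0 subr_eq0 negb_or => /andP[thn rc].
have th01 : 0 < th <= 1 by rewrite th1 andbT lt_neqAle eq_sym thn.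
by have := step _ _ th01 Dr rc em lt; lra.
Qed.

Variables (rho : T -> R).
Hypothesis mrho : measurable_fun setT rho.

Let int_trunc (phi : R -> R) (rho' : T -> R) (c : R) : measurable_fun setT (phi \o rho') ->
  intg (phi \o rho) -> (forall u, rho' u = c \/ rho' u = rho u) -> intg (phi \o rho').
Proof.
move=> m i h; have i' : intg (fun u => `|phi (rho u)| + `|phi c|).
  have := integrableD measurableT (integrable_abse i) (integrable_prob_cst P `|phi c|).
  by [].
apply: le_integrable i' => //; first exact/measurable_EFinP.
move=> u _; rewrite /= lee_fin [leRHS]ger0_norm ?addr_ge0//.
by case: (h u) => ->; rewrite ?lerDl ?lerDr.
Qed.

Let maxE a u : Num.max (rho u) a = a \/ Num.max (rho u) a = rho u.
Proof. by rewrite /Num.max; case: ifP; [left|right]. Qed.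

Let minE a u : Num.min (rho u) a = a \/ Num.min (rho u) a = rho u.
Proof. by rewrite /Num.min; case: ifP; [right|left]. Qed.

(** If phi <= phi(a) on [a,+oo[, then the average of [phi o rho'] is at most phi(a); so a failure of
    the conclusion gives [delta phi(m') < phi(a)], which is offered to the scalar step. *)
Lemma trunc_lo pos (phi : R -> R) (a delta : R) :
  subgrad (@dom R pos) phi -> measurable_fun setT phi ->
  (forall u, dom pos (rho u)) -> dom pos a -> intg rho -> intg (phi \o rho) ->
  (forall th r m m', 0 < th <= 1 -> dom pos r -> r < a -> dom pos m -> a <= m' ->
     th * (a - r) = m' - m ->
     ({in `[a, +oo[, forall x, phi x <= phi a} -> delta * phi m' < phi a) ->
     delta * (phi m - phi m') <= th * (phi r - phi a)) ->
  let rho' u := Num.max (rho u) a in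
  [/\ measurable_fun setT rho', intg rho', intg (phi \o rho') &
  E (phi \o rho) <= delta * phi (E rho) -> E (phi \o rho') <= delta * phi (E rho')].
Proof.
move=> cphi mphi Drho Da i1 i3 step rho'.
have mr' : measurable_fun setT rho' by apply: measurable_maxr.
have i2 : intg rho' by exact: (@int_trunc id rho' a mr' i1 (maxE a)).
have i4 : intg (phi \o rho').
  by apply: (@int_trunc phi rho' a _ i3 (maxE a)); exact: measurableT_comp.
split => //.
have mA : measurable [set u | rho u < a].
  by rewrite -[X in measurable X]setTI; exact: measurable_fun_ltr.
apply: (@trunc_ineq pos phi rho rho' [set u | rho u < a] a) => //.
- by move=> u /= ru; rewrite /rho' /Num.max ru.
- by move=> u /= /negP ru; rewrite /rho' /Num.max (negbTE ru).
move=> th r th01 Dr ra em lt.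
have am' : a <= E rho' by apply: Rintegral_prob_ge => // u; rewrite /rho' le_max lexx orbT.
have mm' : E rho <= E rho'.
  by apply: le_Rintegral => // u _; rewrite /rho' le_max lexx.
have Dm : dom pos (E rho).
  move=> ps; apply: (@Rintegral_gt0 _ _ _ P setT setT) => //; first by move=> u _; rewrite ltW// Drho.
    by move=> u _; exact: Drho.
  by rewrite /= probability_setT.
apply: step => //.
  rewrite lt_neqAle ra /= -subr_ge0 -(pmulr_rge0 _ (andP th01).1) em subr_ge0//.
move=> dphi; apply: lt_le_trans lt _; apply: Rintegral_prob_le => // u /=.
by apply: dphi; rewrite in_itv/= andbT le_max lexx orbT.
Qed.

Lemma trunc_hi pos (phi : R -> R) (b delta : R) :
  subgrad (@dom R pos) phi -> measurable_fun setT phi ->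
  (forall u, dom pos (rho u)) -> dom pos b -> intg rho -> intg (phi \o rho) ->
  (forall th r m m', 0 < th <= 1 -> dom pos r -> b < r -> dom pos m' -> m' <= b ->
     th * (b - r) = m' - m ->
     ({in `]-oo, b], forall x, phi x <= phi b} -> delta * phi m' < phi b) ->
     delta * (phi m - phi m') <= th * (phi r - phi b)) ->
  let rho' u := Num.min (rho u) b in
  [/\ measurable_fun setT rho', intg rho', intg (phi \o rho') &
  E (phi \o rho) <= delta * phi (E rho) -> E (phi \o rho') <= delta * phi (E rho')].
Proof.
move=> cphi mphi Drho Db i1 i3 step rho'.
have mr' : measurable_fun setT rho' by apply: measurable_minr.
have i2 : intg rho' by exact: (@int_trunc id rho' b mr' i1 (minE b)).
have i4 : intg (phi \o rho').
  by apply: (@int_trunc phi rho' b _ i3 (minE b)); exact: measurableT_comp.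
split => //.
have mA : measurable [set u | b < rho u].
  by rewrite -[X in measurable X]setTI; exact: measurable_fun_ltr.
apply: (@trunc_ineq pos phi rho rho' [set u | b < rho u] b) => //.
- by move=> u /= ru; rewrite /rho' min_r// ltW.
- by move=> u /= /negP; rewrite -leNgt => ru; rewrite /rho' min_l.
move=> th r th01 Dr rb em lt.
have mb' : E rho' <= b by apply: Rintegral_prob_le => // u; rewrite /rho' ge_min lexx orbT.
have mm' : E rho' <= E rho.
  by apply: le_Rintegral => // u _; rewrite /rho' ge_min lexx.
have Dm : dom pos (E rho').
  have D' u : pos -> 0 < rho' u by move=> ps; rewrite lt_min Drho ?Db.
  move=> ps; apply: (@Rintegral_gt0 _ _ _ P setT setT) => //; first by move=> u _; rewrite ltW// D'.
    by move=> u _; exact: D'.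
  by rewrite /= probability_setT.
apply: step => //.
  by rewrite lt_neqAle eq_sym rb /= -subr_le0 -(pmulr_rle0 _ (andP th01).1) em subr_le0.
move=> dphi; apply: lt_le_trans lt _; apply: Rintegral_prob_le => // u /=.
by apply: dphi; rewrite in_itv/= ge_min lexx orbT.
Qed.

End clip.

Section clip_curves.
Context d (T : measurableType d) (R : realType) (P : probability T R).
Local Notation intg g := (P.-integrable setT (EFin \o g)).
Local Notation E g := (\int[P]_u g u).
Variables (rho : T -> R) (a b delta : R).
Hypotheses (mrho : measurable_fun setT rho) (irho : intg rho) (ab : a < b) (d1 : 1 <= delta).

(** Truncation below, then above, each with the same delta. Only one probability measure is
    involved, so the result applies at every point of the half-space separately. *)
Lemma clip_powR q : 0 < q -> 0 < a -> (forall u, 0 < rho u) ->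
  intg (fun u => rho u `^ (- q)) ->
  E (fun u => rho u `^ (- q)) <= delta * (E rho) `^ (- q) ->
  E (fun u => clip a b (rho u) `^ (- q)) <= delta * (E (clip a b \o rho)) `^ (- q).
Proof.
move=> q0 a0 r0 i3 le; pose phi (x : R) := x `^ (- q).
have mphi : measurable_fun setT phi by exact: measurable_powR.
have b0 := lt_trans a0 ab.
have [|m1 i1 i1' /(_ le) le1] := @trunc_lo _ _ _ P rho mrho true phi a delta
  (subgrad_powRN q0) mphi (fun u _ => r0 u) (fun _ => a0) irho i3.
  move=> th r m m' th01 /(_ isT) r0' ra /(_ isT) m0 am' em /(_ _) dl.
  apply: trunc_lo_powR => //; apply: dl => x; rewrite in_itv/= andbT => ax.
  exact: powRN_nincr.
have r1 u : 0 < Num.max (rho u) a by rewrite lt_max a0 orbT.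
have [|_ _ _ /(_ le1) //] := @trunc_hi _ _ _ P _ m1 true phi b delta
  (subgrad_powRN q0) mphi (fun u _ => r1 u) (fun _ => b0) i1 i1'.
move=> th r m m' th01 _ br /(_ isT) m'0 mb em _.
exact: trunc_hi_powR.
Qed.

Lemma clip_expR : intg (fun u => expR (rho u)) ->
  E (fun u => expR (rho u)) <= delta * expR (E rho) ->
  E (fun u => expR (clip a b (rho u))) <= delta * expR (E (clip a b \o rho)).
Proof.
move=> i3 le; have mphi : measurable_fun setT (@expR R) by exact: measurable_expR.
have triv x : @dom R false x by [].
have [|m1 i1 i1' /(_ le) le1] := @trunc_lo _ _ _ P rho mrho false expR a delta
  (@subgrad_expR R) mphi (fun u => triv _) (triv _) irho i3.
  move=> th r m m' th01 _ ra _ am' em _.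
  exact: trunc_lo_expR.
have [|_ _ _ /(_ le1) //] := @trunc_hi _ _ _ P _ m1 false expR b delta
  (@subgrad_expR R) mphi (fun u => triv _) (triv _) i1 i1'.
move=> th r m m' th01 _ br _ mb em dl.
apply: trunc_hi_expR => //; first exact: lt_le_trans d1.
by apply: dl => x; rewrite in_itv/= ler_expR.
Qed.

End clip_curves.

(** * The inequality at a three-point mean *)

Section bellman_point.
Context (R : realType) (n : nat).
Local Notation T := (n.-tuple R).
Variable mu : {sigma_finite_measure set T -> \bar R}.
Variables (k : T -> R -> T -> R) (J : finType).
Variables (yj : T -> R -> J -> T) (dj : R -> J -> R).
Hypothesis gk : good_kernel mu k yj dj.
Local Notation E := (kavg mu k).

(** The line [al r + be] passes through (b, phi b) and (x2, y), with y strictly between delta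
    phi(x2) and x1. It lies above phi on [x2,b] and above delta phi near x2, so [one_sided] gives
    psi = phi o rho minus the line a nonpositive average at (y0,t0); the three-point mean makes that
    average positive. *)
Let half (phi : R -> R) (rho : T -> R) M N a b delta tha thJ thb x1 x2 y0 t0 :
  bmeas M rho -> bmeas N (phi \o rho) -> (forall u, a <= rho u <= b) ->
  (forall r, x2 <= r <= b -> (b - x2) * phi r <= (b - r) * phi x2 + (r - x2) * phi b) ->
  {for x2, continuous phi} ->
  (forall y t, 0 < t -> E y t (phi \o rho) <= delta * phi (E y t rho)) ->
  0 <= tha -> 0 < thJ -> tha + thJ + thb = 1 -> a < x2 < b -> 0 < t0 ->
  E y0 t0 rho = tha * a + thJ * x2 + thb * b ->
  E y0 t0 (phi \o rho) = tha * phi a + thJ * x1 + thb * phi b ->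
  (b - a) * x1 <= (b - x2) * phi a + (x2 - a) * phi b ->
  1 <= delta -> 0 <= phi x2 -> x2 <= E y0 t0 rho -> x1 <= delta * phi x2.
Proof.
move=> rM pN rab cvx cphi clipE tha0 thJ0 th1 /andP[ax2 x2b] t00 E2 E1 chord d1 phi0 xE.
rewrite leNgt; apply/negP => lt.
pose y := (x1 + delta * phi x2) / 2.
have y1 : y < x1 by rewrite /y; lra.
have y2 : delta * phi x2 < y by rewrite /y; lra.
pose al := (phi b - y) / (b - x2); pose be := phi b - al * b.
have bx : b - x2 != 0 by rewrite subr_eq0 gt_eqF.
have lb : al * b + be = phi b by rewrite /be; ring.
have lx : al * x2 + be = y by rewrite /be /al; field.
pose psi u := phi (rho u) - (al * rho u + be).
have lM : bmeas (`|al| * M + `|be|) (fun u => al * rho u + be).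
  exact: (bmeasD (bmeasZ al rM) (bmeas_cst n be)).
have psiM := bmeasB pN lM; rewrite -/psi in psiM.
have Epsi y' t : 0 < t -> E y' t psi = E y' t (phi \o rho) - (al * E y' t rho + be).
  move=> t_0; rewrite (kavgB gk y' t_0 pN lM) (kavgD gk y' t_0 (bmeasZ al rM) (bmeas_cst n be)).
  by rewrite (kavgZ gk y' al t_0 rM) (kavg_cst gk).
have psi0 u : x2 <= rho u -> psi u <= 0.
  move=> xr; have /andP[_ rb] := rab u.
  have := cvx (rho u); rewrite xr rb => /(_ isT) H.
  have bx0 : 0 < b - x2 by rewrite subr_gt0.
  rewrite -(pmulr_rle0 _ bx0) /psi mulrBr.
  have -> : (b - x2) * (al * rho u + be) = (b - rho u) * y + (rho u - x2) * phi b.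
    by rewrite /be /al; field.
  have : (b - rho u) * phi x2 <= (b - rho u) * y.
    rewrite ler_wpM2l ?subr_ge0//; apply: le_trans (ltW y2).
    by rewrite ler_peMl.
  by move: H; lra.
(* The width e of this zone is the gap required by [one_sided]. *)
have [e e0 He] : exists2 e, 0 < e & forall r, `|x2 - r| < e -> delta * phi r < al * r + be.
  have c : al * r + be - delta * phi r @[r --> x2] --> al * x2 + be - delta * phi x2.
    apply: cvgB; last by apply: cvgMr; exact: cphi.
    by apply: cvgD; [apply: cvgMr; exact: cvg_id|exact: cvg_cst].
  have p0 : 0 < al * x2 + be - delta * phi x2 by rewrite lx subr_gt0.
  have /= [e e0 He] := cvgr_gt _ c _ p0.
  by exists e => // r re; rewrite -subr_gt0; exact: He.
pose M' := Num.max M (N + (`|al| * M + `|be|)).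
have rM' : bmeas M' rho by apply: bmeasW rM; rewrite le_max lexx.
have pM' : bmeas M' psi by apply: bmeasW psiM; rewrite le_max lexx orbT.
have gap y' t : 0 < t -> x2 <= E y' t rho -> 0 < E y' t psi -> x2 + e <= E y' t rho.
  move=> t_0 xr p0; rewrite leNgt; apply/negP => re.
  have : delta * phi (E y' t rho) < al * E y' t rho + be.
    by apply: He; rewrite distrC ger0_norm ?subr_ge0// ltrBlDl.
  by have := clipE y' t t_0; move: p0; rewrite Epsi//; lra.
have := one_sided gk rM' pM' psi0 e0 gap t00 xE.
rewrite Epsi// E1 E2 leNgt => /negP; apply.
(* Contributions of the three points: nonnegative at a by [chord], positive at x2 because x1 > y,
   zero at b. *)
have -> : tha * phi a + thJ * x1 + thb * phi b - (al * (tha * a + thJ * x2 + thb * b) + be) =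
    tha * (phi a - (al * a + be)) + thJ * (x1 - (al * x2 + be)) + thb * (phi b - (al * b + be)).
  rewrite -[in LHS](mul1r be) -th1; ring.
rewrite lx lb subrr mulr0 addr0 ltr_wpDl// ?mulr_gt0 ?subr_gt0// mulr_ge0//.
have bx0 : 0 < b - x2 by rewrite subr_gt0.
rewrite -(pmulr_rge0 _ bx0).
have -> : (b - x2) * (phi a - (al * a + be)) = (b - x2) * phi a + (x2 - a) * phi b - (b - a) * y.
  by rewrite /be /al; field.
rewrite subr_ge0; apply: le_trans chord; rewrite ler_wpM2l ?(ltW y1)// subr_ge0.
exact/ltW/(lt_trans ax2).
Qed.

(** The reflection r -> -r exchanges a and b and reduces the case E rho < x2 to [half]. *)
Lemma bellman_point (D : set R) (phi : R -> R) (rho : T -> R) M N a b delta tha thJ thb x1 x2 y0 t0 :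
  subgrad D phi -> (forall r, a <= r <= b -> D r) ->
  bmeas M rho -> bmeas N (phi \o rho) -> (forall u, a <= rho u <= b) ->
  {for x2, continuous phi} ->
  (forall y t, 0 < t -> E y t (phi \o rho) <= delta * phi (E y t rho)) ->
  0 <= tha -> 0 < thJ -> 0 <= thb -> tha + thJ + thb = 1 -> a < x2 < b -> 0 < t0 ->
  E y0 t0 rho = tha * a + thJ * x2 + thb * b ->
  E y0 t0 (phi \o rho) = tha * phi a + thJ * x1 + thb * phi b ->
  (b - a) * x1 <= (b - x2) * phi a + (x2 - a) * phi b ->
  1 <= delta -> 0 <= phi x2 -> x1 <= delta * phi x2.
Proof.
move=> cphi Dab rM pN rab c2 clipE tha0 thJ0 thb0 th1 xab t00 E2 E1 chord d1 phi0.
have /andP[ax2 x2b] := xab; have ab := ltW (lt_trans ax2 x2b).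
have [xE|Ex] := leP x2 (E y0 t0 rho).
  apply: (@half phi rho M N a b delta tha thJ thb x1 x2 y0 t0) => // r /andP[xr rb].
  apply: (subgrad_chord cphi) => //; apply: Dab; rewrite ?lexx ?ab ?(ltW ax2) ?(ltW x2b)//.
  by rewrite rb (le_trans (ltW ax2)).
pose phin r := phi (- r); pose rhon u := - rho u.
have EN y t : 0 < t -> E y t rhon = - E y t rho by move=> t_0; exact: (kavgN gk y t_0 rM).
have pnE : phin \o rhon = phi \o rho by apply/funext => u; rewrite /phin /rhon /= opprK.
rewrite -[x2]opprK.
apply: (@half phin rhon M N (- b) (- a) delta thb thJ tha x1 (- x2) y0 t0); rewrite /phin ?opprK//.
- exact: bmeasN.
- by rewrite pnE.
- by move=> u; rewrite !lerN2 andbC.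
- move=> r; rewrite lerNr lerNl => /andP[rx ar].
  have := subgrad_chord cphi (x := a) (y := - r) (z := x2).
  rewrite ar rx => /(_ _ _ _ isT isT) H.
  suff : (x2 - a) * phi (- r) <= (x2 - - r) * phi a + (- r - a) * phi x2 by lra.
  by apply: H; apply: Dab; rewrite ?lexx ?ab ?(ltW ax2) ?(ltW x2b)// ar (le_trans rx)// ltW.
- apply: (@continuous_comp _ _ _ -%R phi); last by rewrite opprK.
  exact: opp_continuous.
- by move=> y t t_0; rewrite pnE EN// opprK; exact: clipE.
- by rewrite -th1; ring.
- by rewrite !ltrN2 andbC.
- by rewrite EN// E2; ring.
- by rewrite pnE E1; ring.
- by move: chord; lra.
- by rewrite EN// lerN2 ltW.
Qed.

End bellman_point.

(** * Averages over subintervals of the unit interval *)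

Section unit_interval.
Context (R : realType).
Local Notation leb := (@lebesgue_measure R).
Local Notation "'\I' [ c , d ] f" := (\int[leb]_(s in `[c, d]) f s)
  (at level 10, f at level 9, format "'\I' [ c , d ]  f").
Implicit Types v w : R -> R.

Let sub01 (c d : R) : 0 <= c -> d <= 1 -> (`[c, d]%classic : set R) `<=` `[0%R, 1%R].
Proof.
by move=> c0 d1 s /=; rewrite !in_itv/= => /andP[cs sd]; rewrite (le_trans c0)//= (le_trans sd).
Qed.

Lemma integrable_sub01 v c d : leb.-integrable `[0%R, 1%R] (EFin \o v) -> 0 <= c -> d <= 1 ->
  leb.-integrable `[c, d] (EFin \o v).
Proof. by move=> iv c0 d1; apply: integrableS iv => //; exact: sub01. Qed.

Lemma Rintegral_itv_cat v (a b c : R) : leb.-integrable `[a, c] (EFin \o v) ->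
  a <= b -> b <= c -> \I[a, c] v = \I[a, b] v + \I[b, c] v.
Proof.
move=> iv ab bc; have := @Rintegral_itvB R v (BLeft a) (BRight c) b iv.
rewrite !bnd_simp => /(_ ab bc) => /eqP; rewrite subr_eq => /eqP ->.
rewrite addrC; congr (_ + _); rewrite Rintegral_itv_obnd_cbnd//.
apply: integrableS iv => //.
by move=> s /=; rewrite !in_itv/= => /andP[bs ->]; rewrite (le_trans ab)// ltW.
Qed.

Let cvg_inner v c d e : leb.-integrable `[0%R, 1%R] (EFin \o v) ->
  0 <= c -> c < d -> d <= 1 -> (forall m, 0 < e m) -> (forall m, e m < (d - c) / 2) ->
  e m @[m --> \oo] --> (0 : R) ->
  \I[c + e m, d - e m] v @[m --> \oo] --> \I[c, d] v.
Proof.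
move=> iv c0 cd d1 e0 ecd ce.
pose F x := \int[leb]_(s in `[0, x]) v s.
have lt01 : (0 < 1 :> R) by [].
have := parameterized_integral_continuous (ltW lt01) iv.
move=> /(continuous_within_itvP _ lt01) [cF F0 F1].
have Fr x : 0 <= x < 1 -> F y @[y --> x^'+] --> F x.
  move=> /andP[]; rewrite le_eqVlt => /predU1P[<- _|x0 x1]; first exact: F0.
  by apply: cvg_at_right_filter; apply: cF; rewrite in_itv/= x0.
have Fl x : 0 < x <= 1 -> F y @[y --> x^'-] --> F x.
  move=> /andP[x0]; rewrite le_eqVlt => /predU1P[->|x1]; first exact: F1.
  by apply: cvg_at_left_filter; apply: cF; rewrite in_itv/= x0.
have FE x y : 0 <= x -> x <= y -> y <= 1 -> \I[x, y] v = F y - F x.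
  move=> x0 xy y1; have i0y := integrable_sub01 iv (lexx 0) y1.
  by rewrite /F (Rintegral_itv_cat i0y x0 xy); ring.
have -> : \I[c, d] v = F d - F c by apply: FE => //; exact: ltW.
have E m : \I[c + e m, d - e m] v = F (d - e m) - F (c + e m).
  by apply: FE; have := e0 m; have := ecd m; lra.
under eq_fun do rewrite E.
apply: cvgB.
- have d01 : 0 < d <= 1 by rewrite d1 (le_lt_trans c0).
  apply: (iffLR (cvg_at_leftP _ _ _) (Fl d d01)); split=> [m|]; first by rewrite gtrBl.
  by rewrite -[X in _ --> X]subr0; apply: cvgB => //; exact: cvg_cst.
- have c01 : 0 <= c < 1 by rewrite c0 (lt_le_trans cd).
  apply: (iffLR (cvg_at_rightP _ _ _) (Fr c c01)); split=> [m|]; first by rewrite ltrDl.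
  by rewrite -[X in _ --> X]addr0; apply: cvgD => //; exact: cvg_cst.
Qed.

(** The rearrangement is monotone only on ]0,1[, and may be unbounded at its ends. Averages over
    [c + e, d - e] converge as e tends to 0, by continuity of the primitive. *)
Lemma avg_ineq_closed v w (H : R -> R) (c d : R) :
  leb.-integrable `[0%R, 1%R] (EFin \o v) -> leb.-integrable `[0%R, 1%R] (EFin \o w) ->
  (forall c d, 0 < c -> c < d -> d < 1 ->
     (d - c)^-1 * \I[c, d] w <= H ((d - c)^-1 * \I[c, d] v)) ->
  0 <= c -> c < d -> d <= 1 ->
  {for (d - c)^-1 * \I[c, d] v, continuous H} ->
  (d - c)^-1 * \I[c, d] w <= H ((d - c)^-1 * \I[c, d] v).
Proof.
move=> iv iw le c0 cd d1 cH.
(* The shift by 3 makes e m < (d - c) / 2 for every m. *)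
pose e m : R := (d - c) / m.+3%:R.
have e0 m : 0 < e m by rewrite divr_gt0 ?subr_gt0.
have ecd m : e m < (d - c) / 2.
  by rewrite ltr_pM2l ?subr_gt0// ltf_pV2 ?posrE// ltr_nat.
have ce : e m @[m --> \oo] --> (0 : R).
  rewrite -[X in _ --> X](mulr0 (d - c)); apply: cvgMr.
  have -> : (fun m : nat => m.+3%:R^-1 : R) = (fun m => harmonic (m + 2)%N).
    by apply/funext => m; rewrite addn2.
  have := @cvg_harmonic R; rewrite -(cvg_shiftn 2); exact.
have cdm : (d - e m - (c + e m))^-1 @[m --> \oo] --> (d - c)^-1.
  apply: cvgV; first by rewrite subr_eq0 gt_eqF.
  rewrite -[X in _ --> X](_ : d - 0 - (c + 0) = _); last by ring.
  by apply: cvgB; [apply: cvgB => //|apply: cvgD => //]; exact: cvg_cst.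
have cu u : leb.-integrable `[0%R, 1%R] (EFin \o u) ->
    (d - e m - (c + e m))^-1 * \I[c + e m, d - e m] u @[m --> \oo] --> (d - c)^-1 * \I[c, d] u.
  by move=> iu; apply: cvgM; [exact: cdm|exact: cvg_inner].
have cHv := cvg_comp _ _ (cu v iv) cH.
apply: (ler_cvg_to (cu w iw) cHv); apply: nearW => m /=.
by apply: le; have := e0 m; have := ecd m; lra.
Qed.

End unit_interval.

(** * The rearrangement satisfies the interval condition *)

Section rearrangement.
Context (R : realType) (n : nat).
Local Notation T := (n.-tuple R).
Local Notation leb := (@lebesgue_measure R).
Variable mu : {sigma_finite_measure set T -> \bar R}.
Variables (k : T -> R -> T -> R) (J : finType).
Variables (yj : T -> R -> J -> T) (dj : R -> J -> R).
Hypothesis gk : good_kernel mu k yj dj.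
Local Notation E := (kavg mu k).

Definition kprob (y : T) (t : R) (t0 : 0 < t) : probability T R :=
  density_prob (fun u => gk_ge0 gk y u t0) (measurable_gk gk y t0) (gk_int gk y t0).

Lemma Rintegral_kprob y t (t0 : 0 < t) g : measurable_fun setT g ->
  \int[kprob y t0]_u g u = E y t g.
Proof. by move=> mg; rewrite /Rintegral integral_density_prob_EFin. Qed.

Lemma ge0_integral_kprob y t (t0 : 0 < t) (g : T -> \bar R) :
  measurable_fun setT g -> (forall u, 0 <= g u)%E ->
  (\int[kprob y t0]_u g u = \int[mu]_u ((k y t u)%:E * g u))%E.
Proof. by move=> mg g0; rewrite integral_density_prob. Qed.

Variables (pos : bool) (phi : R -> R) (rho : T -> R) (delta : R).
Local Notation D := (@dom R pos).
Hypotheses (cphi : subgrad D phi) (mphi : measurable_fun setT phi).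
Hypothesis contphi : forall x, D x -> {for x, continuous phi}.
Hypothesis phi0 : forall x, D x -> 0 <= phi x.
Hypothesis d1 : 1 <= delta.
Hypotheses (mrho : measurable_fun setT rho) (Drho : forall u, D (rho u)).
Hypothesis clipE : forall a b, D a -> a < b -> forall y t, 0 < t ->
  E y t (fun u => phi (clip a b (rho u))) <= delta * phi (E y t (clip a b \o rho)).
Variables (y0 : T) (t0 : R) (t00 : 0 < t0).
Local Notation P := (kprob y0 t00).
Hypothesis irho : P.-integrable setT (EFin \o rho).
Hypothesis iphi : P.-integrable setT (EFin \o (phi \o rho)).

Let Dup x y : D x -> x <= y -> D y.
Proof. by move=> Dx xy ps; exact: lt_le_trans (Dx ps) xy. Qed.

Lemma rearrangement_ex : exists v : R -> R,
  [/\ measurable_fun setT v, forall s, D (v s),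
      {in `]0, 1[ &, nondecreasing v} &
      forall g : R -> \bar R, measurable_fun setT g -> (forall x, 0 <= g x)%E ->
      (\int[P]_u g (rho u) = \int[leb]_(s in `[0%R, 1%R]) g (v s))%E].
Proof.
pose X : {RV P >-> R} := HB.pack_for {RV P >-> R} rho
  (isMeasurableFun.Build _ _ _ _ rho mrho).
(* The default value 1 is positive, hence lies in D for either value of [pos]. *)
exists (quantile X 1); split.
- exact: measurable_quantile.
- move=> s ps; have [s01|s01] := boolP (0 < s < 1); last by rewrite /quantile (negbTE s01).
  rewrite ltNge quantile_le// -ltNge; case/andP: s01 => s0 _.
  rewrite (_ : cdf X 0 = 0%E) ?lte_fin//.
  rewrite /cdf /distribution /pushforward (_ : _ @^-1` _ = set0) ?measure0//.
  by apply/seteqP; split => // u /=; rewrite in_itv/= leNgt Drho.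
- exact: quantile_nd.
- by move=> g mg g0; rewrite -(integral_quantile X 1 mg g0).
Qed.

Let clip_ge (a b x : R) : a <= b -> a <= clip a b x.
Proof. by move=> ab; rewrite /clip le_min ab le_max lexx orbT. Qed.

Let clip_le (a b x : R) : clip a b x <= b.
Proof. by rewrite /clip ge_min lexx orbT. Qed.

Let clip_id (a b x : R) : a <= x -> x <= b -> clip a b x = x.
Proof. by move=> ax xb; rewrite /clip max_l// min_l. Qed.

Let clip_lo (a b x : R) : x <= a -> a <= b -> clip a b x = a.
Proof. by move=> xa ab; rewrite /clip max_r// min_l. Qed.

Let clip_hi (a b x : R) : a <= b -> b <= x -> clip a b x = b.
Proof. by move=> ab bx; rewrite /clip max_l ?(le_trans ab)// min_r. Qed.

Let measurable_clip (a b : R) : measurable_fun setT (clip a b).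
Proof. by apply: measurable_minr => //; exact: measurable_maxr. Qed.

(** For [c,d] inside ]0,1[ with a = v c and b = v d, monotonicity makes the clipped v equal to a
    before c, to v on [c,d] and to b after d. Hence the averages of the clipped rho at (y0,t0) are
    the three-point mean of [bellman_point], with weights c, d - c and 1 - d. *)
Lemma rearrangement_bellman : exists v : R -> R,
  [/\ measurable_fun setT v, forall s, D (v s),
      forall g : R -> \bar R, measurable_fun setT g -> (forall x, 0 <= g x)%E ->
      (\int[P]_u g (rho u) = \int[leb]_(s in `[0%R, 1%R]) g (v s))%E,
      forall g : R -> R, measurable_fun setT g ->
        P.-integrable setT (EFin \o (g \o rho)) ->
        leb.-integrable `[0%R, 1%R] (EFin \o (g \o v)) /\
        \int[P]_u g (rho u) = \int[leb]_(s in `[0, 1]) g (v s) &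
      forall c d, 0 <= c -> c < d -> d <= 1 ->
        (d - c)^-1 * \int[leb]_(s in `[c, d]) phi (v s) <=
        delta * phi ((d - c)^-1 * \int[leb]_(s in `[c, d]) v s)].
Proof.
have [v [mv Dv ndv law]] := rearrangement_ex; exists v.
have lawE (g : R -> R) : measurable_fun setT g ->
    (\int[P]_u (g (rho u))%:E = \int[leb]_(s in `[0%R, 1%R]) (g (v s))%:E)%E.
  move=> mg; have mgE : measurable_fun setT (EFin \o g) by exact/measurable_EFinP.
  rewrite integralE [RHS]integralE; congr (_ - _)%E.
  - transitivity (\int[P]_u (EFin \o g)^\+ (rho u))%E.
      by apply: eq_integral => u _; rewrite !funeposE.
    rewrite (law _ (measurable_funepos mgE) (funepos_ge0 _)).
    by apply: eq_integral => u _; rewrite !funeposE.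
  - transitivity (\int[P]_u (EFin \o g)^\- (rho u))%E.
      by apply: eq_integral => u _; rewrite !funenegE.
    rewrite (law _ (measurable_funeneg mgE) (funeneg_ge0 _)).
    by apply: eq_integral => u _; rewrite !funenegE.
have lawI (g : R -> R) : measurable_fun setT g ->
    P.-integrable setT (EFin \o (g \o rho)) ->
    leb.-integrable `[0%R, 1%R] (EFin \o (g \o v)).
  move=> mg /integrableP[_ goo]; apply/integrableP; split.
    by apply/measurable_EFinP; apply: measurable_funTS; exact: measurableT_comp.
  have mg' : measurable_fun setT (fun x => `|(g x)%:E|%E).
    by apply: measurableT_comp => //; exact/measurable_EFinP.
  have L := law _ mg' (fun x => abse_ge0 _).
  by apply: le_lt_trans goo; rewrite le_eqVlt; apply/orP; left; apply/eqP; exact: esym L.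
have iv := lawI id (@measurable_id _ _ _) irho.
have iphiv := lawI phi mphi iphi.
split => //.
  by move=> g mg ig; split; [exact: lawI|rewrite /Rintegral lawE].
have D01 s : 0 < s -> s < 1 -> s \in `]0, 1[ by move=> s0 s1; rewrite in_itv/= s0.
move=> c' d' c'0 cd' d'1.
apply: (@avg_ineq_closed R v (phi \o v) (fun x => delta * phi x)) => //; last first.
  apply: cvgMr; apply: contphi => ps.
  rewrite mulr_gt0 ?invr_gt0 ?subr_gt0//.
  apply: (@Rintegral_gt0 _ _ _ leb _ `[c', d']) => //.
  - exact: integrable_sub01.
  - by move=> s _; exact/ltW/Dv.
  - by move=> s _; exact: Dv.
  - by rewrite /= lebesgue_measure_itv/= lte_fin cd' -EFinB lte_fin subr_gt0.
move=> c d c0 cd d1' {c' d' c'0 cd' d'1}.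
have c1 := lt_trans cd d1'; have d0 := lt_trans c0 cd.
set a := v c; set b := v d.
have ab : a <= b by apply: ndv; rewrite ?D01//; exact: ltW.
have vlo s : 0 < s -> s <= c -> v s <= a.
  by move=> s0 sc; apply: ndv => //; apply: D01 => //; exact: le_lt_trans c1.
have vhi s : d <= s -> s < 1 -> b <= v s.
  by move=> ds s1; apply: ndv => //; apply: D01 => //; exact: lt_le_trans ds.
have vmid s : c <= s -> s <= d -> a <= v s <= b.
  move=> cs sd; apply/andP; split; apply: ndv => //; apply: D01 => //.
    exact: lt_le_trans cs.
    exact: le_lt_trans d1'.
    exact: lt_le_trans cs.
    exact: le_lt_trans d1'.
set x2 := (d - c)^-1 * \int[leb]_(s in `[c, d]) v s.
set x1 := (d - c)^-1 * \int[leb]_(s in `[c, d]) (phi \o v) s.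
have dc0 : 0 < d - c by rewrite subr_gt0.
have lcd : leb `[c, d]%classic = (d - c)%:E.
  by rewrite lebesgue_measure_itv/= lte_fin cd.
have Icst (r x y : R) : x <= y -> \int[leb]_(s in `[x, y]) (cst r s) = r * (y - x).
  move=> xy; rewrite Rintegral_cst//= lebesgue_measure_itv/= lte_fin.
  by move: xy; rewrite le_eqVlt => /predU1P[->|->//]; rewrite ltxx subrr.
have icst (r x y : R) : leb.-integrable `[x, y] (EFin \o cst r).
  by apply: continuous_compact_integrable; [exact: segment_compact|exact/continuous_subspaceT/cst_continuous].
have iZ (r : R) u x y : leb.-integrable `[x, y] (EFin \o u) ->
    leb.-integrable `[x, y] (EFin \o (fun s => r * u s)).
  by move=> iu; rewrite (_ : EFin \o _ = (fun s => r%:E * (EFin \o u) s)%E)//; exact: integrableZl.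
have iD u u' (x y : R) : leb.-integrable `[x, y] (EFin \o u) -> leb.-integrable `[x, y] (EFin \o u') ->
    leb.-integrable `[x, y] (EFin \o (fun s => u s + u' s)).
  by move=> iu iu'; rewrite (_ : EFin \o _ = (EFin \o u) \+ (EFin \o u'))%E//; exact: integrableD.
have ivcd := integrable_sub01 iv (ltW c0) (ltW d1').
have ipcd := integrable_sub01 iphiv (ltW c0) (ltW d1').
have x2a : a <= x2.
  rewrite /x2 mulrC ler_pdivlMr// -(Icst a)//; last exact: ltW.
  by apply: le_Rintegral => // s /=; rewrite in_itv/= => /andP[cs sd]; case/andP: (vmid s cs sd).
have x2b : x2 <= b.
  rewrite /x2 mulrC ler_pdivrMr// -(Icst b)//; last exact: ltW.
  by apply: le_Rintegral => // s /=; rewrite in_itv/= => /andP[cs sd]; case/andP: (vmid s cs sd).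
(* On [c,d] the function phi o v lies under the chord of phi over [a,b]; integrate. *)
have chord : (b - a) * x1 <= (b - x2) * phi a + (x2 - a) * phi b.
  pose h s := (phi b - phi a) * v s + cst (b * phi a - a * phi b) s.
  have ib : leb.-integrable `[c, d] (EFin \o (fun s => (b - a) * (phi \o v) s)).
    exact: iZ.
  have ih1 : leb.-integrable `[c, d] (EFin \o (fun s => (phi b - phi a) * v s)).
    exact: (iZ _ v).
  have ih : leb.-integrable `[c, d] (EFin \o h).
    exact: iD.
  have H : \int[leb]_(s in `[c, d]) ((b - a) * (phi \o v) s) <= \int[leb]_(s in `[c, d]) h s.
    apply: le_Rintegral => // s /=; rewrite in_itv/= => /andP[cs sd].
    have /andP[av vb] := vmid s cs sd.
    have := subgrad_chord cphi (Dv s) (Dv c) (Dv d) av vb.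
    by rewrite -/a -/b /h /cst => /le_trans; apply; rewrite le_eqVlt; apply/orP; left; apply/eqP; ring.
  move: H; rewrite RintegralZl// RintegralD// RintegralZl// Icst; last exact: ltW.
  have -> : \int[leb]_(s in `[c, d]) (phi \o v) s = (d - c) * x1 by rewrite /x1 mulVKf// gt_eqF.
  have -> : \int[leb]_(s in `[c, d]) v s = (d - c) * x2 by rewrite /x2 mulVKf// gt_eqF.
  move=> H; rewrite -(ler_pM2l dc0); apply: le_trans (le_trans H _).
    by rewrite le_eqVlt; apply/orP; left; apply/eqP; ring.
  by rewrite le_eqVlt; apply/orP; left; apply/eqP; ring.
have dphi : phi x2 <= delta * phi x2.
  by rewrite ler_peMl// phi0//; apply: Dup x2a; exact: Dv.
(* In the degenerate cases a = b, x2 = a and x2 = b one has x1 <= phi x2 directly. *)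
have [eab|nab] := eqVneq a b.
  have -> : x1 = phi a.
    rewrite /x1 (_ : \int[leb]_(s in `[c, d]) _ = phi a * (d - c)).
      by field; rewrite gt_eqF.
    rewrite -Icst ?(ltW cd)//; apply: eq_Rintegral.
    move=> s /[!inE]/=; rewrite in_itv/= => /andP[cs sd]; congr phi.
    by apply/eqP; rewrite eq_le andbC; have := vmid s cs sd; rewrite eab.
  have -> : a = x2 by apply/eqP; rewrite eq_le x2a eab.
  exact: dphi.
have ab' : a < b by rewrite lt_neqAle nab.
have [e2a|n2a] := eqVneq x2 a.
  apply: le_trans dphi; rewrite -(ler_pM2l (_ : 0 < b - a)) ?subr_gt0//.
  by move: chord; rewrite e2a subrr mul0r addr0.
have [e2b|n2b] := eqVneq x2 b.
  apply: le_trans dphi; rewrite -(ler_pM2l (_ : 0 < b - a)) ?subr_gt0//.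
  by move: chord; rewrite e2b subrr mul0r add0r.
pose rho' := clip a b \o rho.
have rab u : a <= rho' u <= b by rewrite clip_ge// clip_le.
have Dcl x : D (clip a b x) by apply: (Dup (Dv c)); exact: clip_ge.
have phi_cl x : 0 <= phi (clip a b x) <= phi a + phi b.
  rewrite phi0//=; have := subgrad_chord cphi (Dcl x) (Dv c) (Dv d) (clip_ge x ab) (clip_le a b x).
  have : clip a b x <= b := clip_le a b x; have := clip_ge x ab.
  have := phi0 (Dv c); have := phi0 (Dv d); rewrite -/a -/b.
  move: (clip a b x) => z pb pa az zb H.
  rewrite -(ler_pM2l (_ : 0 < b - a)) ?subr_gt0//; apply: le_trans H _.
  have : 0 <= (z - a) * phi a by rewrite mulr_ge0 ?subr_ge0.
  have : 0 <= (b - z) * phi b by rewrite mulr_ge0 ?subr_ge0.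
  by lra.
have mphicl : measurable_fun setT (phi \o clip a b) by exact: measurableT_comp.
(* The average at (y0,t0) is carried to [0,1] and cut at c and d. On the outer pieces the integrand
   is constant in the interior, which determines the integral. *)
have split_cl (g : R -> R) : measurable_fun setT (g \o clip a b) ->
    (exists M, forall x, `|g (clip a b x)| <= M) ->
    leb.-integrable `[c, d] (EFin \o (g \o v)) ->
    E y0 t0 (g \o rho') = c * g a + \int[leb]_(s in `[c, d]) g (v s) + (1 - d) * g b.
  move=> mg [M gM] igcd.
  have ig : leb.-integrable `[0%R, 1%R] (EFin \o (g \o clip a b \o v)).
    apply: measurable_bounded_integrable => //.
    - by rewrite /= lebesgue_measure_itv/= lte_fin ltr01 ltry.
    - by apply: measurable_funTS; exact: measurableT_comp.
    - by exists M; split; rewrite ?num_real// => x Mx s _; apply: le_trans (gM _) (ltW Mx).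
  have mG : measurable_fun setT (g \o clip a b \o v) by exact: measurableT_comp.
  have Gcst r x y : x <= y -> (forall s, x < s -> s < y -> (g \o clip a b \o v) s = r) ->
      \int[leb]_(s in `[x, y]) (g \o clip a b \o v) s = r * (y - x).
    move=> xy Gr; rewrite -Icst//; congr fine; apply: eq_integral_itv_bounded => //.
    - exact: measurable_funTS.
    - by move=> s; rewrite in_itv/= => /andP[xs sy]; exact: Gr.
  rewrite -(Rintegral_kprob y0 t00); last exact: (measurableT_comp mg mrho).
  transitivity (\int[leb]_(s in `[0, 1]) (g \o clip a b \o v) s).
    by rewrite /Rintegral -(lawE _ mg).
  have i0d := integrable_sub01 ig (lexx 0) (ltW d1').
  rewrite (Rintegral_itv_cat ig (ltW d0) (ltW d1')) (Rintegral_itv_cat i0d (ltW c0) (ltW cd)).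
  rewrite (Gcst (g a) 0 c (ltW c0)); last first.
    by move=> s s0 sc /=; rewrite clip_lo// vlo// ltW.
  rewrite (Gcst (g b) d 1 (ltW d1')); last first.
    by move=> s ds s1 /=; rewrite clip_hi// vhi// ltW.
  congr (_ + _ + _); [by ring| |by ring].
  apply: eq_Rintegral => s /[!inE]/=; rewrite in_itv/= => /andP[cs sd].
  by have /andP[av vb] := vmid s cs sd; rewrite clip_id.
have [Ma HM] : exists M, bmeas M rho'.
  exists (`|a| + `|b|); split=> [|u]; first exact: measurableT_comp.
  by have /andP[] := rab u; rewrite ler_norml; have := ler_norm b; have := ler_norm (- a); rewrite normrN;
    have := normr_ge0 a; have := normr_ge0 b; lra.
have HN : bmeas (phi a + phi b) (phi \o rho').
  split=> [|u]; first by apply: (measurableT_comp mphicl).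
  by have /andP[p0 p1] := phi_cl (rho u); rewrite ger0_norm.
apply: (@bellman_point R n mu k J yj dj gk D phi rho' Ma (phi a + phi b) a b delta c (d - c) (1 - d) x1 x2 y0 t0) => //.
- by move=> r /andP[ar _]; exact: (Dup (Dv c)).
- by apply: contphi; exact: (Dup (Dv c)).
- by move=> y t t_0; apply: clipE => //; exact: Dv.
- exact: ltW.
- by rewrite subr_ge0 ltW.
- by ring.
- by rewrite !lt_neqAle x2a x2b eq_sym n2a n2b.
- rewrite /x2 mulVKf ?gt_eqF//; apply: (split_cl id (@measurable_clip a b) _ ivcd).
  exists (`|a| + `|b|) => x; have := @clip_ge a b x ab; have := clip_le a b x.
  by rewrite ler_norml; have := ler_norm b; have := ler_norm (- a); rewrite normrN;
    have := normr_ge0 a; have := normr_ge0 b; lra.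
- rewrite /x1 mulVKf ?gt_eqF//; apply: (split_cl phi mphicl _ ipcd).
  by exists (phi a + phi b) => x; have /andP[p0 p1] := phi_cl x; rewrite ger0_norm.
- by apply: phi0; exact: (Dup (Dv c)).
Qed.

End rearrangement.

(** * From weights on R^n to weights on the unit interval *)

(** A version of the weight that is positive everywhere, so that [phi (rho u)] recovers it at every
    point rather than almost everywhere. *)
Definition pos_version (R : realType) (T : Type) (w : T -> R) : T -> R :=
  fun u => if 0 < w u then w u else 1.

(* [fcomp f w] is [pos_extension f \o w]. *)
Definition pos_extension (R : realType) (f : R -> R) (x : R) : R := if 0 < x then f x else 0.

Lemma pos_extension_ge0 (R : realType) (f : R -> R) x :
  (forall s, 0 < s -> 0 <= f s) -> 0 <= pos_extension f x.
Proof. by move=> f0; rewrite /pos_extension; case: ifP => // /f0. Qed.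

Lemma measurable_pos_extension (R : realType) (f : R -> R) :
  measurable_fun (`]0%R, +oo[ : set R) f -> measurable_fun setT (pos_extension f).
Proof.
move=> mf; apply: measurable_fun_if => //.
  exact: measurable_fun_ltr.
apply: measurable_funS mf; first exact: measurable_itv.
by move=> x [_ /=]; rewrite in_itv/= andbT => ->.
Qed.

Section extensions.
Context (R : realType) (n : nat) (K : kernel_kind).
Local Notation T := (n.-tuple R).
Local Notation mu := (lebT R n).
Variables (J : finType) (yj : T -> R -> J -> T) (dj : R -> J -> R).
Hypothesis gk : good_kernel mu (fun y t u => Defs.kernel K t (tsub y u)) yj dj.
Local Notation k := (fun y t u => Defs.kernel K t (tsub y u)).
Local Notation P := (kprob gk).

Lemma ext_kprob y t (t0 : 0 < t) (g : T -> R) : measurable_fun setT g ->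
  ext K g y t = (\int[P y t0]_u (g u)%:E)%E.
Proof.
move=> mg; have mgE : measurable_fun setT (EFin \o g) by exact/measurable_EFinP.
have mk := measurable_gk gk y t0.
have H (h : T -> R) : measurable_fun setT h -> (forall u, 0 <= h u) ->
   intRn (fun u => (Defs.kernel K t (tsub y u) * h u)%:E) = (\int[P y t0]_u (h u)%:E)%E.
  move=> mh h0; rewrite intRnE; last 2 first.
  - by apply/measurable_EFinP; exact: measurable_funM.
  - move=> u; rewrite lee_fin mulr_ge0//; exact: (gk_ge0 gk).
  by rewrite ge0_integral_kprob//; exact/measurable_EFinP.
have mp : measurable_fun setT (fun u => Num.max (g u) 0) by exact: measurable_maxr.
have mm : measurable_fun setT (fun u => Num.max (- g u) 0).
  by apply: measurable_maxr => //; exact: measurable_funN.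
have p0 (x : R) : 0 <= Num.max x 0 by rewrite le_max lexx orbT.
rewrite /ext (H _ mp (fun u => p0 _)) (H _ mm (fun u => p0 _)).
rewrite [RHS]integralE; congr (_ - _)%E; apply: eq_integral => u _.
- by rewrite funeposE EFin_max.
- by rewrite funenegE -EFinN EFin_max.
Qed.

Variables (w : T -> R).
Hypothesis ww : weightRn w.
Local Notation w' := (pos_version w).

Lemma pos_version_gt0 u : 0 < w' u.
Proof. by rewrite /pos_version; case: ifP. Qed.

Let mw : measurable_fun setT w. Proof. by case: ww. Qed.

Lemma measurable_pos_version : measurable_fun setT w'.
Proof.
apply: measurable_fun_if => //.
- exact: measurable_fun_ltr.
- exact: measurable_funTS.
Qed.

(** The two versions differ only on a Lebesgue null set, which is null for the kernel measure as
    well. *)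
Lemma ext_pos_version y t (t0 : 0 < t) (g : R -> R) : measurable_fun setT (g \o w) ->
  measurable_fun setT (g \o w') ->
  ext K (g \o w) y t = (\int[P y t0]_u (g (w' u))%:E)%E.
Proof.
move=> m1 m2; rewrite (ext_kprob _ t0)//; apply: ae_eq_integral => //; try exact/measurable_EFinP.
pose N := [set u | w u <= 0].
have mN : measurable N.
  by rewrite -[N]setTI; exact: measurable_fun_ler.
have muN : mu N = 0%E.
  have mI : measurable_fun setT (\1_N : T -> R) by exact: measurable_indic.
  have [_ + _] := ww; rewrite /lebn intRnE; last 2 first.
  - exact/measurable_EFinP.
  - by move=> u; rewrite lee_fin.
  by rewrite integral_indic// setIT.
exists N; split => //.
  rewrite /= /density_prob; apply: null_set_integral => //.
  apply/measurable_EFinP; apply: measurable_funTS; exact: (measurable_gk gk y t0).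
move=> u /= /not_implyP [_ uN]; rewrite /N /= leNgt; apply/negP => wu.
by apply: uN; rewrite /= /pos_version wu.
Qed.


Lemma ext_fcomp (f : R -> R) y t (t0 : 0 < t) : measurable_fun (`]0%R, +oo[ : set R) f ->
  ext K (fcomp f w) y t = (\int[P y t0]_u (pos_extension f (w' u))%:E)%E.
Proof.
move=> /measurable_pos_extension mf.
rewrite -(@ext_pos_version y t t0 (pos_extension f))//; first exact: measurableT_comp.
by apply: measurableT_comp => //; exact: measurable_pos_version.
Qed.

End extensions.

Lemma avgE (R : realType) (c d : R) (g : R -> R) :
  (@lebesgue_measure R).-integrable `[c, d] (EFin \o g) ->
  avg c d g = ((d - c)^-1 * \int[lebesgue_measure]_(s in `[c, d]) g s)%:E.
Proof.
move=> ig; rewrite /avg EFinM; congr (_ * _)%E.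
by rewrite fineK//; exact: integrable_fin_num ig.
Qed.

Section transfer.
Context (R : realType) (n : nat) (K : kernel_kind).
Local Notation T := (n.-tuple R).
Local Notation mu := (lebT R n).
Local Notation leb := (@lebesgue_measure R).
Variables (J : finType) (yj : T -> R -> J -> T) (dj : R -> J -> R).
Hypothesis gk : good_kernel mu (fun y t u => Defs.kernel K t (tsub y u)) yj dj.
Local Notation P := (kprob gk).
Variables (pos : bool) (phi : R -> R) (delta : R) (w rho : T -> R).
Local Notation D := (@dom R pos).
Hypotheses (cphi : subgrad D phi) (mphi : measurable_fun setT phi).
Hypothesis contphi : forall x, D x -> {for x, continuous phi}.
Hypothesis phi_gt0 : forall x, D x -> 0 < phi x.
Hypothesis d1 : 1 <= delta.
Hypothesis clipP : forall (Q : probability T R) a b, D a -> a < b ->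
  Q.-integrable setT (EFin \o rho) -> Q.-integrable setT (EFin \o (phi \o rho)) ->
  \int[Q]_u phi (rho u) <= delta * phi (\int[Q]_u rho u) ->
  \int[Q]_u phi (clip a b (rho u)) <= delta * phi (\int[Q]_u (clip a b \o rho) u).
Hypotheses (ww : weightRn w) (mrho : measurable_fun setT rho) (Drho : forall u, D (rho u)).
Hypothesis phirho : forall u, phi (rho u) = pos_version w u.
Hypothesis irho : forall y t (t0 : 0 < t), (P y t0).-integrable setT (EFin \o rho).
Hypothesis iphi : forall y t (t0 : 0 < t), (P y t0).-integrable setT (EFin \o (phi \o rho)).
Hypothesis bound : forall y t (t0 : 0 < t),
  \int[P y t0]_u phi (rho u) <= delta * phi (\int[P y t0]_u rho u).
Variable f : R -> R.
Hypothesis mf : measurable_fun (`]0%R, +oo[ : set R) f.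
Hypothesis f_ge0 : forall s, 0 < s -> 0 <= f s.

(** The clauses are what makes [phi o v] a competitor on [0,1] with the averages that w has at
    (y0,t0), for a general phi so as to serve both finite p and p = oo. *)
Lemma bellman_transfer y0 t0 (t00 : 0 < t0) : exists v : R -> R,
  [/\ forall s, D (v s),
      weightI 0 1 (phi \o v) /\ leb.-integrable `[0%R, 1%R] (EFin \o v),
      [/\ avg 0 1 (phi \o v) = ext K w y0 t0,
          avg 0 1 v = (\int[P y0 t00]_u (rho u)%:E)%E &
          avg 0 1 (fcomp f (phi \o v)) = ext K (fcomp f w) y0 t0] &
      forall c d, 0 <= c -> c < d -> d <= 1 -> exists A B,
        [/\ avg c d (phi \o v) = A%:E, avg c d v = B%:E, D B & A <= delta * phi B]].
Proof.
have mclip a b : measurable_fun setT (clip a b \o rho).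
  by apply: measurableT_comp => //; apply: measurable_minr => //; exact: measurable_maxr.
(* [clipP] applied to the kernel measure of each point, where [bound] holds. *)
have clipE a b : D a -> a < b -> forall y t, 0 < t ->
    kavg mu (fun y t u => Defs.kernel K t (tsub y u)) y t (fun u => phi (clip a b (rho u))) <=
    delta * phi (kavg mu (fun y t u => Defs.kernel K t (tsub y u)) y t (clip a b \o rho)).
  move=> Da ab y t t_0; rewrite -!(Rintegral_kprob gk y t_0)//.
    by apply: clipP => //; exact: bound.
  exact: (measurableT_comp mphi (mclip a b)).
have [v [mv Dv law lawR ineq]] := @rearrangement_bellman R n mu _ J yj dj gk pos phi rho delta
  cphi mphi contphi (fun x Dx => ltW (phi_gt0 Dx)) d1 mrho Drho clipE y0 t0 t00
  (irho y0 t00) (iphi y0 t00).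
have [iv Ev] := lawR id (@measurable_id _ _ _) (irho y0 t00).
have [iphiv Ephiv] := lawR phi mphi (iphi y0 t00).
have mphiv : measurable_fun setT (phi \o v) by exact: measurableT_comp.
exists v; split => //.
- split => //; split => //; first exact: measurable_funTS.
  rewrite (_ : [set s | _] = set0) ?measure0//; apply/seteqP; split => // s /= [_].
  by rewrite leNgt phi_gt0.
- split.
  + rewrite avgE// subr0 invr1 mul1r -Ephiv /Rintegral fineK; last first.
      exact: (integrable_fin_num measurableT (iphi y0 t00)).
    have mw : measurable_fun setT w by case: ww.
    rewrite (@ext_pos_version R n K J yj dj gk w ww y0 t0 t00 id)//; last exact: measurable_pos_version.
    by apply: eq_integral => u _; rewrite phirho.
  + rewrite avgE// subr0 invr1 mul1r -Ev /Rintegral fineK//.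
    exact: (integrable_fin_num measurableT (irho y0 t00)).
  + have mpf := measurable_pos_extension mf.
    rewrite (ext_fcomp gk ww _ t00 mf) /avg subr0 invr1 mul1e.
    rewrite -(law (fun x => (pos_extension f (phi x))%:E)).
    * by apply: eq_integral => u _; rewrite phirho.
    * by apply/measurable_EFinP; exact: measurableT_comp.
    * by move=> x; rewrite lee_fin; exact: pos_extension_ge0.
move=> c d c0 cd d1'; do 2 eexists; split.
- by apply: avgE; exact: (integrable_sub01 iphiv).
- by apply: avgE; exact: (integrable_sub01 iv).
- move=> ps; rewrite mulr_gt0 ?invr_gt0 ?subr_gt0//.
  apply: (@Rintegral_gt0 _ _ _ leb _ `[c, d]) => //.
  + exact: (integrable_sub01 iv).
  + by move=> s _; exact/ltW/Dv.
  + by move=> s _; exact: Dv.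
  + by rewrite /= lebesgue_measure_itv/= lte_fin cd -EFinB lte_fin subr_gt0.
- exact: ineq.
Qed.

End transfer.

Lemma ge0_integrable_fin_num d (T : measurableType d) (R : realType)
    (P : {measure set T -> \bar R}) (g : T -> R) :
  measurable_fun setT g -> (forall u, 0 <= g u) ->
  (\int[P]_u (g u)%:E \is a fin_num)%E -> P.-integrable setT (EFin \o g).
Proof.
move=> mg g0 fin; apply/integrableP; split; first exact/measurable_EFinP.
under eq_integral do rewrite /= ger0_norm//.
by rewrite ltey_eq fin.
Qed.

(** * The two cases, finite p and p = oo *)

Section inequalities.
Context (R : realType) (n : nat) (K : kernel_kind) (f : R -> R) (dt d : R).
Hypothesis n0 : (0 < n)%N.
Hypothesis mf : measurable_fun (`]0%R, +oo[ : set R) f.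
Hypothesis f_ge0 : forall s : R, 0 < s -> 0 <= f s.
Hypotheses (dt1 : 1 <= dt) (dtd : dt <= d).
Local Notation T := (n.-tuple R).

(** phi and psi are inverse powers on the half-line, so that rho = psi o w' is the dual weight, and
    conversely v is the dual weight of phi o v. *)
Lemma DpK_le_Dp (p : R) (x : R * R) : 1 < p -> (DpK K n p dt f x <= Dp p d f x)%E.
Proof.
move=> p1; apply: ge_ereal_sup => _ [[w [y0 t0]] /= [ww t00 Aw e1 e2] <-].
have [J [yj [dj gk]]] := kernel_good R K n0.
have q0 : 0 < p - 1 by rewrite subr_gt0.
pose q := p - 1; pose phi (r : R) := r `^ (- q); pose psi (r : R) := r `^ (- q^-1).
have phipsi r : 0 < r -> phi (psi r) = r.
  move=> r0; rewrite /phi /psi -powRrM mulrNN mulVf ?powRr1 ?(ltW r0)//.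
  by rewrite gt_eqF.
have psiphi r : 0 < r -> psi (phi r) = r.
  move=> r0; rewrite /phi /psi -powRrM mulrNN mulfV ?powRr1 ?(ltW r0)//.
  by rewrite gt_eqF.
have mphi : measurable_fun setT phi by exact: measurable_powR.
have cphi (r : R) : dom true r -> {for r, continuous phi}.
  move=> /(_ isT) r0; apply: differentiable_continuous; apply/derivable1_diffP.
  by have [] := is_derive1_powR (- q) r0.
have mpsi : measurable_fun setT psi by exact: measurable_powR.
pose w' := pos_version w; pose rho u := psi (w' u).
have mw : measurable_fun setT w by case: ww.
have mw' : measurable_fun setT w' by exact: measurable_pos_version.
have mrho : measurable_fun setT rho by exact: measurableT_comp.
have w'0 u : 0 < w' u by exact: pos_version_gt0.
have rho0 u : 0 < rho u by rewrite powR_gt0.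
have phirho u : phi (rho u) = w' u by rewrite phipsi.
have Ew y t (t_0 : 0 < t) : ext K w y t = (\int[kprob gk y t_0]_u (w' u)%:E)%E.
  exact: (@ext_pos_version R n K J yj dj gk w ww y t t_0 id).
have Er y t (t_0 : 0 < t) : ext K (dualw p w) y t = (\int[kprob gk y t_0]_u (rho u)%:E)%E.
  by apply: (@ext_pos_version R n K J yj dj gk w ww y t t_0 psi); exact: measurableT_comp.
(* [Aprod] is +oo unless both extensions are finite, so a finite characteristic also yields
   integrability. *)
have H y t (t_0 : 0 < t) : [/\ (kprob gk y t_0).-integrable setT (EFin \o w'),
    (kprob gk y t_0).-integrable setT (EFin \o rho) &
    \int[kprob gk y t_0]_u w' u * (\int[kprob gk y t_0]_u rho u) `^ q <= dt].
  have : (Aprod p (ext K w y t) (ext K (dualw p w) y t) <= dt%:E)%E.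
    by apply: le_trans Aw; apply: ereal_sup_ubound; exists (y, t).
  rewrite /Aprod (Ew _ _ t_0) (Er _ _ t_0); case: ifP => // /andP[fw fr] le.
  split => //; apply: ge0_integrable_fin_num => // u; exact: ltW.
have iphi y t (t_0 : 0 < t) : (kprob gk y t_0).-integrable setT (EFin \o (phi \o rho)).
  have [iw _ _] := H y t t_0.
  by rewrite (_ : phi \o rho = w')//; apply/funext => u; exact: phirho.
have bound y t (t_0 : 0 < t) :
    \int[kprob gk y t_0]_u phi (rho u) <= dt * phi (\int[kprob gk y t_0]_u rho u).
  have [_ ir] := H y t t_0.
  have B0 : 0 < \int[kprob gk y t_0]_u rho u.
    apply: (@Rintegral_gt0 _ _ _ (kprob gk y t_0) setT setT) => //.
      by move=> u _; exact: ltW.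
    by rewrite /= probability_setT.
  have -> : \int[kprob gk y t_0]_u phi (rho u) = \int[kprob gk y t_0]_u w' u.
    by apply: eq_Rintegral => u _; exact: phirho.
  by rewrite /phi powRN ler_pdivlMr ?powR_gt0.
have [v [v0 [wv iv] [a1 a2 a3] J_]] := @bellman_transfer R n K J yj dj gk true phi dt w rho
  (subgrad_powRN q0) mphi cphi (fun r r0 => powR_gt0 _ (r0 isT)) dt1
  (fun Q a b a0 ab i1 i2 => clip_powR mrho i1 ab dt1 q0 (a0 isT) rho0 i2)
  ww mrho (fun u _ => rho0 u) phirho (fun y t t_0 => let: And3 _ i _ := H y t t_0 in i)
  iphi bound f mf f_ge0 y0 t0 t00.
have dv : dualw p (phi \o v) = v by apply/funext => s; exact: psiphi (v0 s isT).
rewrite -a3; apply: ereal_sup_ubound; exists (phi \o v, (0, 1)) => //=; split => //.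
- apply: ge_ereal_sup => _ [[c e] /= [c0 [ce e1']] <-].
  have [A [B [-> + B0 AB]]] := J_ c e c0 ce e1'.
  rewrite dv => ->; rewrite /Aprod /= lee_fin; apply: le_trans dtd.
  have {}B0 := B0 isT.
  by move: AB; rewrite /phi powRN ler_pdivlMr ?powR_gt0.
- by rewrite a1.
- by rewrite dv a2 -Er.
Qed.

Lemma DinfK_le_Dinf (x : R * R) : (DinfK K n dt f x <= Dinf d f x)%E.
Proof.
apply: ge_ereal_sup => _ [[w [y0 t0]] /= [[ww lw] t00 Aw e1 e2] <-].
have [J [yj [dj gk]]] := kernel_good R K n0.
have mexp : measurable_fun setT (@expR R) by exact: measurable_expR.
have mln : measurable_fun setT (@ln R) by exact: measurable_ln.
pose w' := pos_version w; pose rho u := ln (w' u).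
have mw : measurable_fun setT w by case: ww.
have mw' : measurable_fun setT w' by exact: measurable_pos_version.
have mrho : measurable_fun setT rho by exact: measurableT_comp.
have w'0 u : 0 < w' u by exact: pos_version_gt0.
have exprho u : expR (rho u) = w' u by rewrite /rho lnK// posrE.
have Ew y t (t_0 : 0 < t) : ext K w y t = (\int[kprob gk y t_0]_u (w' u)%:E)%E.
  exact: (@ext_pos_version R n K J yj dj gk w ww y t t_0 id).
have Er y t (t_0 : 0 < t) :
    ext K (fun u => ln (w u)) y t = (\int[kprob gk y t_0]_u (rho u)%:E)%E.
  by apply: (@ext_pos_version R n K J yj dj gk w ww y t t_0 (@ln R)); exact: measurableT_comp.
(* The logarithm changes sign; its integrability is [ext_defined], read as finiteness of the
   extension of |ln w|. *)
have ir y t (t_0 : 0 < t) : (kprob gk y t_0).-integrable setT (EFin \o rho).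
  apply/integrableP; split; first exact/measurable_EFinP.
  have mabs : measurable_fun setT (fun r : R => `|ln r|) by exact: measurableT_comp.
  have E : ext K (fun u => `|ln (w u)|) y t = (\int[kprob gk y t_0]_u (`|rho u|)%:E)%E.
    apply: (@ext_pos_version R n K J yj dj gk w ww y t t_0 (fun r => `|ln r|)).
      exact: measurableT_comp.
    exact: measurableT_comp.
  rewrite [ltLHS](_ : _ = (\int[kprob gk y t_0]_u (`|rho u|)%:E)%E)// -E /ext.
  rewrite [X in (_ - X)%E](_ : _ = 0%E) ?sube0; last first.
    rewrite (_ : (fun u => _) = cst 0%E) ?intRnE//; first by rewrite integral0.
    by apply/funext => u; rewrite max_r ?mulr0// oppr_le0.
  rewrite (_ : (fun u => _) = (fun u => (Defs.kernel K t (tsub y u) * `|ln (w u)|)%:E)).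
    exact: lw.
  by apply/funext => u; rewrite max_l.
have Aw' y t (t_0 : 0 < t) : (\int[kprob gk y t_0]_u (w' u)%:E *
    (expR (- \int[kprob gk y t_0]_u rho u))%:E <= dt%:E)%E.
  rewrite -Ew /Rintegral -Er; apply: le_trans Aw.
  by apply: ereal_sup_ubound; exists (y, t).
(* An infinite average of w', multiplied by the positive exponential factor, would violate the bound
   [dt]. *)
have iw y t (t_0 : 0 < t) : (kprob gk y t_0).-integrable setT (EFin \o w').
  apply: ge0_integrable_fin_num => // [u|]; first exact: ltW.
  rewrite ge0_fin_numE ?integral_ge0//; last by move=> u _; rewrite lee_fin ltW.
  rewrite ltNge leye_eq; apply/negP => /eqP oo.
  by have := Aw' y t t_0; rewrite oo gt0_mulye ?lte_fin ?expR_gt0.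
have bound y t (t_0 : 0 < t) :
    \int[kprob gk y t_0]_u expR (rho u) <= dt * expR (\int[kprob gk y t_0]_u rho u).
  have -> : \int[kprob gk y t_0]_u expR (rho u) = \int[kprob gk y t_0]_u w' u.
    by apply: eq_Rintegral => u _; exact: exprho.
  have := Aw' y t t_0; rewrite -[X in (X * _)%E]fineK; last first.
    exact: (integrable_fin_num measurableT (iw y t t_0)).
  by rewrite -EFinM lee_fin expRN ler_pdivrMr ?expR_gt0.
have iexp y t (t_0 : 0 < t) : (kprob gk y t_0).-integrable setT (EFin \o (@expR R \o rho)).
  by rewrite (_ : expR \o rho = w')//; apply/funext => u; exact: exprho.
have triv r : @dom R false r by [].
have [v [v0 [wv iv] [a1 a2 a3] J_]] := @bellman_transfer R n K J yj dj gk false expR dt w rho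
  (@subgrad_expR R) mexp (fun r r0 => @continuous_expR R r) (fun r r0 => expR_gt0 r) dt1
  (fun Q a b a0 ab i1 i2 => @clip_expR _ _ _ Q rho a b dt mrho i1 dt1 i2)
  ww mrho (fun u => triv _) exprho ir iexp bound f mf f_ge0 y0 t0 t00.
have lnv : (fun s => ln ((expR \o v) s)) = v by apply/funext => s; exact: expRK.
rewrite -a3; apply: ereal_sup_ubound; exists (expR \o v, (0, 1)) => //=; rewrite lnv; split => //.
- apply: ge_ereal_sup => _ [[c e] /= [c0 [ce e1']] <-].
  have [A [B [-> + B0 AB]]] := J_ c e c0 ce e1'.
  rewrite lnv => ->; rewrite -EFinM lee_fin; apply: le_trans dtd.
  by rewrite expRN ler_pdivrMr ?expR_gt0.
- by rewrite a1.
- by rewrite a2 -Er.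
Qed.

End inequalities.

Theorem theorem3p2 (R : realType) (n : nat) (K : kernel_kind) (f : R -> R)
    (delta deltat : R) (p : \bar R) :
  (1 <= n)%N ->
  measurable_fun (`]0%R, +oo[ : set R) f ->
  (forall s : R, 0 < s -> 0 <= f s) ->
  1 < deltat -> deltat < delta ->
  (1 < p)%E ->
  forall x : R * R, Omega p deltat x ->
    (DbellK K n p deltat f x <= Dbell p delta f x)%E.
Proof.
move=> n1 mf f0 /ltW dt1 /ltW dtd p1 x _; case: p p1 => [p|_|//].
- by rewrite lte_fin => p1; exact: DpK_le_Dp.
- exact: DinfK_le_Dinf.
Qed.
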